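(* Let $Q(\mathbf{x})\in\mathbb{Z}[x_1,x_2,x_3]$ be a non-singular ternary quadratic form which has a non-trivial rational zero, and let $\|\cdot\|$ be any norm on $\mathbb{R}^3$ isometric to the maximum norm. Then for all $B\ge 2$, $$N(Q,B)=c_Q\,B+O\!\left((BK_0)^{1/2}\,\log(BK_0)\,\langle Q\rangle^{5}\right),$$ where the implied constant is absolute.
   Context: A norm $\|\cdot\|$ on $\mathbb{R}^3$ is isometric to the maximum norm if there is $\mathfrak{g}\in GL_3(\mathbb{R})$ with $\|\mathbf{x}\|=\|\mathfrak{g}\mathbf{x}\|_\infty$ for all $\mathbf{x}\in\mathbb{R}^3$. $\mathbb{Z}^3_{\mathrm{prim}}$ is the set of $\mathbf{x}\in\mathbb{Z}^3$ with $\gcd(x_1,x_2,x_3)=1$. $N(Q,B):=\#\{\mathbf{x}\in\mathbb{Z}^3_{\mathrm{prim}}: Q(\mathbf{x})=0,\ \|\mathbf{x}\|\le B\}$. $\langle Q\rangle$ is the maximum modulus of the coefficients of $Q$. $K_0:=1+\sup_{\mathbf{x}\ne\mathbf{0}}\|\mathbf{x}\|_\infty/\|\mathbf{x}\|$. The local densities are $\sigma_\infty:=\lim_{\epsilon\to0}\frac{1}{2\epsilon}\mathrm{vol}\{\mathbf{x}\in\mathbb{R}^3:|Q(\mathbf{x})|\le\epsilon,\ \|\mathbf{x}\|\le1\}$ and, for each prime $p$, $\sigma_p:=\lim_{n\to\infty}p^{-2n}N_Q^*(p^n)$ with $N_Q^*(p^n):=\#\{\mathbf{x}\bmod p^n: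 p\nmid\mathbf{x},\ Q(\mathbf{x})\equiv0\bmod p^n\}$. Then $c_Q:=\frac12\sigma_\infty\prod_p\sigma_p$, the product over all primes (convergent). *)

(* Defs.v *)
From HB Require Import structures.
From mathcomp Require Import all_boot all_order all_algebra.
From mathcomp Require mpoly.

Set Implicit Arguments.
Unset Strict Implicit.
Unset Printing Implicit Defensive.

Import Order.TTheory GRing.Theory Num.Theory.
Local Open Scope ring_scope.

(* The notations of mpoly clash with those of MathComp-Analysis, so mpoly is
   only imported inside this module, and MathComp-Analysis only after it. *)
Module Ternary.
Import mpoly.

Definition polyZ : Type := {mpoly int[3]}.

Definition quadratic_form (Q : polyZ) : Prop := Q \is 2.-homog.

Definition eval (S : comNzRingType) (Q : polyZ) (x : 'cV[S]_3) : S :=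
  mmap (fun c : int => c%:~R) (fun i => x i 0) Q.

(* The symmetric rational matrix M such that Q(x) = x^T M x. *)
Definition gram (Q : polyZ) : 'M[rat]_3 :=
  \matrix_(i < 3, j < 3)
    ((Q@_(U_(i) + U_(j))%MM)%:~R / (if i == j then 1 else 2)).

Definition nonsingular (Q : polyZ) : Prop := \det (gram Q) != 0.

Definition isotropic (Q : polyZ) : Prop :=
  exists2 x : 'cV[rat]_3, x != 0 & eval Q x = 0.

Definition height (Q : polyZ) : nat := \max_(m <- msupp Q) `|Q@_m|%N.

End Ternary.

From mathcomp Require Import finmap.
From mathcomp Require Import all_classical all_reals all_analysis.
Import numFieldNormedType.Exports.
Local Open Scope classical_set_scope.

Section Norms.
Variable R : realType.
Implicit Types nrm : 'cV[R]_3 -> R.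

Definition is_norm nrm : Prop :=
  [/\ forall x, nrm x = 0 -> x = 0,
      forall (a : R) x, nrm (a *: x) = `|a| * nrm x
    & forall x y, nrm (x + y) <= nrm x + nrm y].

(* On matrices, `|_| is the maximum of the absolute values of the entries. *)
Definition isometric_to_max nrm : Prop :=
  exists2 g : 'M[R]_3, g \in unitmx & forall x, nrm x = `|g *m x|.

Definition K0 nrm : R := 1 + sup [set `|x| / nrm x | x in [set x | x != 0]].

End Norms.

Definition primitive (x : 'cV[int]_3) : Prop :=
  \big[gcdn/0%N]_(i < 3) `|x i 0%R|%N = 1%N.

Section Counting.
Variables (R : realType) (Q : Ternary.polyZ) (nrm : 'cV[R]_3 -> R).

Definition zeros (B : R) : set 'cV[int]_3 :=
  [set x | [/\ primitive x, Ternary.eval Q x = 0 & nrm (map_mx intr x) <= B]].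

(* [fset_set A] enumerates A when A is finite, which [zeros B] is as soon as
   nrm is a norm. *)
Definition N (B : R) : nat := #|` fset_set (zeros B)|.

Definition vec3 (t : R * (R * R)) : 'cV[R]_3 :=
  \col_i [:: t.1; t.2.1; t.2.2]`_i.

Definition vol (A : set 'cV[R]_3) : \bar R :=
  (@lebesgue_measure R \x (@lebesgue_measure R \x @lebesgue_measure R))%E
    (vec3 @^-1` A).

(* The limit is one-sided: for e < 0 the set is empty. *)
Definition sigma_oo : R :=
  lim ((2 * e)^-1 *
       fine (vol [set x | `|Ternary.eval Q x| <= e /\ nrm x <= 1]) @[e --> 0^'+]).

(* Residues mod p ^ n are represented by the integers 0, ..., p ^ n - 1. *)
Definition Nstar (p n : nat) : nat :=
  #|[pred x : 'cV['I_(p ^ n)]_3 |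
      ~~ [forall i, (p %| x i 0%R)%N] &&
      ((p ^ n)%N%:Z %|
        Ternary.eval Q (map_mx (fun a : 'I_(p ^ n) => a%:Z) x))%Z]|.

Definition sigma (p : nat) : R :=
  lim (((Nstar p n)%:R / p%:R ^+ (2 * n) : R) @[n --> \oo]).

Definition cQ : R :=
  2^-1 * sigma_oo * lim ((\prod_(p < n | prime p) sigma p) @[n --> \oo]).

End Counting.

(* Main.v *)
(* A primitive integral zero of Q can be moved by shears of determinant one to
   (1,0,0), which puts Q in the shape d x y + A y^2 + B y z + C z^2.  The zeros
   with y <> 0 are then parametrised by coprime pairs (s, t) with s <> 0, as
   (-q(s,t), d s^2, d s t) divided by g, where q(s,t) = A s^2 + B s t + C t^2
   and g = gcd(q(s,t), d s) divides d C.  A reduction of the parametrisation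
   keeps the region norm <= X g inside a box of controlled size.  For each value
   of g one counts lattice points of this planar region in residue classes
   modulo d C, row by row, and removes the coprimality condition by a Moebius
   sum.  The main terms are matched with the local densities: the area of the
   region is half the real density, and the classes modulo d C together with
   the Moebius sum give the Euler product. *)
From HB Require Import structures.
From mathcomp Require Import all_boot all_order all_algebra.
From mathcomp Require mpoly.
From mathcomp Require Import ring lra zify.
Require Import Defs.

Set Implicit Arguments.
Unset Strict Implicit.
Unset Printing Implicit Defensive.

Import Order.TTheory GRing.Theory Num.Theory.
Local Open Scope ring_scope.

(** The obstacle is uniformity in [Q]: a parametrisation built on an arbitrary zero lives in a box
    of uncontrolled size. The zero is therefore taken of least maximum norm. Zeros have the shape
    [s ^ 2 T0 + s t T1 + t ^ 2 T2], and the gradients at the three vectors are cross products of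
    pairs of them; after a shift of [t] this bounds [T1] and [T0] in terms of [T2] and the
    coefficients, and Dirichlet approximation played against minimality bounds [T2]. Pairing a zero
    with [T2] or [T0] in the polar form isolates [s ^ 2] or [t ^ 2], whence the box. With
    [N0 = |d C|] and a box of side [sqrt g H], the value [g] costs [N0 d H log / sqrt g], and
    [N0 d H] is of order [height ^ 4 sqrt (B K0)]. Summing over [g | N0] costs [height ^ (3/4)] and
    the logarithm at most [height ^ (1/4)], which makes the exponent 5. The region attached to [g]
    has area proportional to [g], so residue classes carry the weight [g]; the same weighted sum
    modulo [p ^ v] arises from counting solutions modulo [p ^ n]. At the real place, density and
    area reduce to one integral over the slope. *)

Module QuadraticForms.

(** * Coefficients of a ternary quadratic form *)

Module Coefs.
Import mpoly.

Definition i0 : 'I_3 := inord 0.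
Definition i1 : 'I_3 := inord 1.
Definition i2 : 'I_3 := inord 2.

Definition coef (Q : Ternary.polyZ) (i j : 'I_3) : int := Q@_(U_(i) + U_(j))%MM.

Definition deg2 : seq 'X_{1..3} :=
  [:: U_(i0) + U_(i0); U_(i1) + U_(i1); U_(i2) + U_(i2);
      U_(i1) + U_(i2); U_(i0) + U_(i2); U_(i0) + U_(i1)]%MM.

Lemma valI : (i0 = 0%N :> nat) * (i1 = 1%N :> nat) * (i2 = 2%N :> nat).
Proof. by rewrite !inordK. Qed.

Lemma eqI : (((i0 == i1) = false) * ((i0 == i2) = false) * ((i1 == i2) = false)
  * ((i1 == i0) = false) * ((i2 == i0) = false) * ((i2 == i1) = false))%type.
Proof. by rewrite -!val_eqE /= !valI. Qed.

Lemma ord3 (i : 'I_3) : [\/ i = i0, i = i1 | i = i2].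
Proof.
case: i => [[|[|[|//]]] H]; [constructor 1|constructor 2|constructor 3];
 by apply/val_inj; rewrite /= valI.
Qed.

Lemma sum3 (V : nmodType) (F : 'I_3 -> V) : \sum_i F i = F i0 + F i1 + F i2.
Proof.
rewrite !big_ord_recl big_ord0 addr0 addrA.
by congr (F _ + F _ + F _); apply/val_inj; rewrite /= valI.
Qed.

Lemma deg2P (m : 'X_{1..3}) : mdeg m = 2%N -> m \in deg2.
Proof.
rewrite mdegE => H; have {H} : (m i0 + m i1 + m i2 = 2)%N.
  by apply: etrans _ H; rewrite !big_ord_recl big_ord0 addn0 addnA;
   congr (_ + _ + _)%N; congr (m _); apply/val_inj; rewrite /= valI.
have E (u : 'X_{1..3}) : u i0 = m i0 -> u i1 = m i1 -> u i2 = m i2 -> m = u.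
  by move=> h0 h1 h2; apply/mnmP => i; case: (ord3 i) => ->.
rewrite !inE.
move: E; case: (m i0) => [|[|[|]]]; case: (m i1) => [|[|[|]]];
 case: (m i2) => [|[|[|]]] //; try (intros; lia); move=> E _; 
 [set u := (U_(i2) + U_(i2))%MM|set u := (U_(i1) + U_(i2))%MM
 |set u := (U_(i1) + U_(i1))%MM|set u := (U_(i0) + U_(i2))%MM
 |set u := (U_(i0) + U_(i1))%MM|set u := (U_(i0) + U_(i0))%MM];
 by rewrite -(E u) ?eqxx ?orbT // /u mnmDE !mnm1E ?eqI ?eqxx.
Qed.

Lemma deg2_uniq : uniq deg2.
Proof.
have E (u v : 'X_{1..3}) i : u i != v i -> (u == v) = false.
  by move=> h; apply/negbTE; apply: contra_neq h => ->.
rewrite /= !inE !negb_or -!andbA.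
do ![apply/andP; split=> //].
all: first [by rewrite (@E _ _ i0) // !mnmDE !mnm1E ?eqI ?eqxx
 | by rewrite (@E _ _ i1) // !mnmDE !mnm1E ?eqI ?eqxx
 | by rewrite (@E _ _ i2) // !mnmDE !mnm1E ?eqI ?eqxx].
Qed.

Lemma mmap1_U (S : comNzRingType) (h : 'I_3 -> S) i j :
  mmap1 h (U_(i) + U_(j))%MM = h i * h j.
Proof.
rewrite -!(mmap1U h) /mmap1 -big_split /=.
by apply: eq_bigr => k _; rewrite mnmDE exprD.
Qed.

(** [mmap] sums over the support of [Q]. Homogeneity puts the support inside [deg2], and the
    monomials missing from it have coefficient zero, so the sum may run over all six. *)
Lemma evalE (S : comNzRingType) (Q : Ternary.polyZ) (x : 'cV[S]_3) :
  Ternary.quadratic_form Q ->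
  Ternary.eval Q x =
    (coef Q i0 i0)%:~R * x i0 0 ^+ 2 + (coef Q i1 i1)%:~R * x i1 0 ^+ 2
    + (coef Q i2 i2)%:~R * x i2 0 ^+ 2 + (coef Q i1 i2)%:~R * (x i1 0 * x i2 0)
    + (coef Q i0 i2)%:~R * (x i0 0 * x i2 0) + (coef Q i0 i1)%:~R * (x i0 0 * x i1 0).
Proof.
move=> /dhomogP hQ; rewrite /Ternary.eval /mmap.
transitivity (\sum_(m <- deg2) (Q@_m)%:~R * mmap1 (fun i => x i 0) m).
  rewrite [RHS](bigID (mem (msupp Q))) /= [X in _ = _ + X]big1 ?addr0; last first.
    by move=> m /memN_msupp_eq0 ->; rewrite mul0r.
  rewrite -[RHS]big_filter; apply: perm_big; apply: uniq_perm.
  - exact: msupp_uniq.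
  - by apply: filter_uniq; exact: deg2_uniq.
  - move=> m; rewrite mem_filter /=; case: (boolP (m \in msupp Q)) => //= hm.
    by apply/esym/deg2P; apply: hQ.
rewrite /deg2 !big_cons big_nil /coef !mmap1_U addr0 -!expr2 -!addrA.
by do ![congr (_ + _)].
Qed.

Lemma height_ge (Q : Ternary.polyZ) i j : (`|coef Q i j|%N <= Ternary.height Q)%N.
Proof.
rewrite /Ternary.height /coef; set m := (_ + _)%MM.
case: (boolP (m \in msupp Q)) => hm; first by apply: (@leq_bigmax_seq _ _ xpredT (fun m => `|Q@_m|%N) m).
by rewrite (memN_msupp_eq0 hm).
Qed.

Lemma gram_coef (Q : Ternary.polyZ) i j :
  Ternary.gram Q i j = (coef Q i j)%:~R / (if i == j then 1 else 2).
Proof. by rewrite mxE. Qed.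

Lemma coefC (Q : Ternary.polyZ) i j : coef Q i j = coef Q j i.
Proof. by rewrite /coef Monoid.mulmC. Qed.
End Coefs.

(** * Three by three determinants and the discriminant *)

Section Det3.
Import Coefs.
Variable K : comNzRingType.

Lemma det3 (A : 'M[K]_3) :
  \det A = A i0 i0 * (A i1 i1 * A i2 i2 - A i1 i2 * A i2 i1)
         - A i0 i1 * (A i1 i0 * A i2 i2 - A i1 i2 * A i2 i0)
         + A i0 i2 * (A i1 i0 * A i2 i1 - A i1 i1 * A i2 i0).
Proof.
rewrite (expand_det_row _ i0) sum3 /cofactor !valI.
have d2 (B : 'M[K]_2) : \det B = B 0 0 * B 1 1 - B 0 1 * B 1 0.
  rewrite (expand_det_row _ 0) !big_ord_recl big_ord0 /cofactor !det_mx11 !mxE /=.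
  have -> : lift 0 0 = 1 :> 'I_2 by apply/val_inj.
  have -> : lift 1 0 = 0 :> 'I_2 by apply/val_inj.
  by rewrite !expr0 /= addr0 expr1; ring.
rewrite !d2 !mxE /=.
have E (i : 'I_3) (j : 'I_2) (k : 'I_3) : bump i j = k -> lift i j = k.
  by move=> h; apply/val_inj.
rewrite (E i0 0 i1) ?valI // (E i0 1 i2) ?valI // (E i1 0 i0) ?valI // (E i1 1 i2) ?valI //
 (E i2 0 i0) ?valI // (E i2 1 i1) ?valI //.
ring.
Qed.
End Det3.

Section Disc.
Import Coefs.
Variable Q : Ternary.polyZ.

Definition disc : int :=
  let a := coef Q i0 i0 in let b := coef Q i1 i1 in let c := coef Q i2 i2 in
  let f := coef Q i1 i2 in let g := coef Q i0 i2 in let h := coef Q i0 i1 in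
  4 * a * b * c + f * g * h - a * f ^+ 2 - b * g ^+ 2 - c * h ^+ 2.

(** The determinant of the Gram matrix is a quarter of [disc]. *)
Lemma nonsingular_disc : Ternary.nonsingular Q -> disc != 0.
Proof.
apply: contraNneq => h0; rewrite det3 !gram_coef !eqI !eqxx.
rewrite (coefC Q i1 i0) (coefC Q i2 i0) (coefC Q i2 i1).
have := congr1 (fun z : int => z%:~R : rat) h0; rewrite /disc.
rewrite !(rmorphB, rmorphD, rmorphM, rmorphXn) /=.
move: (_ i0 i0)%:~R (_ i1 i1)%:~R (_ i2 i2)%:~R (_ i1 i2)%:~R (_ i0 i2)%:~R (_ i0 i1)%:~R.
move=> a b c f g h E; apply/eqP; lra.
Qed.
End Disc.

(** * Size bounds for gradients and for the three parametrising vectors *)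

Section Vec3.
Variable R : realFieldType.
Implicit Types u v w : (R * R * R)%type.

Definition dot u v : R := u.1.1 * v.1.1 + u.1.2 * v.1.2 + u.2 * v.2.
Definition crs u v : R * R * R :=
  (u.1.2 * v.2 - u.2 * v.1.2, u.2 * v.1.1 - u.1.1 * v.2,
   u.1.1 * v.1.2 - u.1.2 * v.1.1).
Definition lin3 (r s t : R) u v w : R * R * R :=
  (r * u.1.1 + s * v.1.1 + t * w.1.1, r * u.1.2 + s * v.1.2 + t * w.1.2,
   r * u.2 + s * v.2 + t * w.2).

Lemma dot_ge0 u : 0 <= dot u u.
Proof. by rewrite /dot -!expr2 !addr_ge0 ?sqr_ge0. Qed.

Lemma lagrange u v : dot (crs u v) (crs u v) = dot u u * dot v v - dot u v ^+ 2.
Proof. by case: u v => [[? ?] ?] [[? ?] ?]; rewrite /dot /crs /=; ring. Qed.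

Lemma cauchy u v : dot u v ^+ 2 <= dot u u * dot v v.
Proof. by rewrite -subr_ge0 -lagrange dot_ge0. Qed.

Variables (a b c f g h q : R).
Definition grad u : R * R * R :=
  (2 * a * u.1.1 + h * u.1.2 + g * u.2, h * u.1.1 + 2 * b * u.1.2 + f * u.2,
   g * u.1.1 + f * u.1.2 + 2 * c * u.2).
Definition dsc : R := 4 * a * b * c + f * g * h - a * f ^+ 2 - b * g ^+ 2 - c * h ^+ 2.

Hypotheses (ha : `|a| <= q) (hb : `|b| <= q) (hc : `|c| <= q)
  (hf : `|f| <= q) (hg : `|g| <= q) (hh : `|h| <= q).

Let q0 : 0 <= q. Proof. exact: le_trans (normr_ge0 a) ha. Qed.

Lemma sqr_le_norm (x y : R) : `|x| <= y -> x ^+ 2 <= y ^+ 2.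
Proof. by move=> hxy; rewrite -real_normK ?num_real // ler_pXn2r ?nnegrE // (le_trans _ hxy). Qed.

Lemma norm_le_sqr (x y : R) : 0 <= y -> x ^+ 2 <= y ^+ 2 -> `|x| <= y.
Proof. by move=> y0; rewrite -real_normK ?num_real // ler_pXn2r ?nnegrE. Qed.

Lemma dot_bound (m : R) u v : dot u u <= m -> dot u v ^+ 2 <= m * dot v v.
Proof. by move=> hm; apply: le_trans (cauchy u v) _; rewrite ler_wpM2r ?dot_ge0. Qed.

Lemma normM_le (x y m n : R) : `|x| <= m -> `|y| <= n -> `|x * y| <= m * n.
Proof. by move=> h1 h2; rewrite normrM ler_pM. Qed.

Lemma dsc_le : `|dsc| <= 8 * q ^+ 3.
Proof.
have E : dsc = 4 * (a * b * c) + f * g * h - a * (f * f) - b * (g * g) - c * (h * h).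
  by rewrite /dsc; ring.
have m3 x y z : `|x| <= q -> `|y| <= q -> `|z| <= q -> `|x * y * z| <= q ^+ 3.
  move=> h1 h2 h3; rewrite exprS expr2 mulrA.
  by apply: normM_le => //; apply: normM_le.
have m3' x y : `|x| <= q -> `|y| <= q -> `|x * (y * y)| <= q ^+ 3.
  by move=> h1 h2; rewrite mulrA m3.
have := m3 _ _ _ ha hb hc; have := m3 _ _ _ hf hg hh.
have := m3' _ _ ha hf; have := m3' _ _ hb hg; have := m3' _ _ hc hh.
rewrite E; move: (_ * _ * _) (_ * _ * _) (_ * (_ * _)) (_ * (_ * _)) (_ * (_ * _)) (q ^+ 3).
move=> x y z t u Q; rewrite !ler_norml.
by move=> /andP[? ?] /andP[? ?] /andP[? ?] /andP[? ?] /andP[? ?]; apply/andP; split; lra.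
Qed.

(** Each coordinate of the gradient is a scalar product with a row such as [(2 a, h, g)], of squared
    length at most [6 q ^ 2]; Cauchy's inequality is applied to the three rows. *)
Lemma grad_le u : dot (grad u) (grad u) <= 18 * q ^+ 2 * dot u u.
Proof.
have s2 (x : R) : `|x| <= q -> x * x <= q ^+ 2 by move=> /sqr_le_norm; rewrite expr2.
have k r1 r2 r3 : `|r1| <= q -> `|r2| <= q -> `|r3| <= q ->
    dot (2 * r1, r2, r3) u ^+ 2 <= 6 * q ^+ 2 * dot u u.
  move=> /s2 h1 /s2 h2 /s2 h3; apply: dot_bound; rewrite /dot /=; lra.
have k1 := k _ _ _ ha hh hg; have k2 := k _ _ _ hb hh hf; have k3 := k _ _ _ hc hg hf.
have -> : dot (grad u) (grad u) = dot (2 * a, h, g) u ^+ 2 +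
   dot (2 * b, h, f) (u.1.2, u.1.1, u.2) ^+ 2 + dot (2 * c, g, f) (u.2, u.1.1, u.1.2) ^+ 2.
  by rewrite /dot /grad /=; ring.
have k2' : dot (2 * b, h, f) (u.1.2, u.1.1, u.2) ^+ 2 <= 6 * q ^+ 2 * dot u u.
  have -> : dot u u = dot (u.1.2, u.1.1, u.2) (u.1.2, u.1.1, u.2) by rewrite /dot /=; ring.
  apply: dot_bound; rewrite /dot /=; have := s2 _ hb; have := s2 _ hh; have := s2 _ hf; lra.
have k3' : dot (2 * c, g, f) (u.2, u.1.1, u.1.2) ^+ 2 <= 6 * q ^+ 2 * dot u u.
  have -> : dot u u = dot (u.2, u.1.1, u.1.2) (u.2, u.1.1, u.1.2) by rewrite /dot /=; ring.
  apply: dot_bound; rewrite /dot /=; have := s2 _ hc; have := s2 _ hg; have := s2 _ hf; lra.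
lra.
Qed.

(** The adjugate of the matrix of [grad] recovers [2 dsc u] from [grad u]. Its diagonal entries are
    at most [5 q ^ 2] and the others at most [3 q ^ 2], so a row has squared length at most
    [(25 + 9 + 9) q ^ 4], and three rows give 129. *)
Lemma grad_ge u : 4 * dsc ^+ 2 * dot u u <= 129 * q ^+ 4 * dot (grad u) (grad u).
Proof.
have s2 (x y : R) : `|x| <= y -> x * x <= y * y by move=> /sqr_le_norm; rewrite !expr2.
have d1 x y z : `|x| <= q -> `|y| <= q -> `|z| <= q -> `|4 * (x * y) - z * z| <= 5 * q ^+ 2.
  move=> h1 h2 h3; have := normM_le h1 h2; have := normM_le h3 h3; rewrite -[q * q]expr2.
  move: (x * y) (z * z) => X Z; rewrite !ler_norml.
  by move=> /andP[? ?] /andP[? ?]; apply/andP; split; lra.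
have d2 x y z t : `|x| <= q -> `|y| <= q -> `|z| <= q -> `|t| <= q ->
   `|x * y - 2 * (z * t)| <= 3 * q ^+ 2.
  move=> h1 h2 h3 h4; have := normM_le h1 h2; have := normM_le h3 h4; rewrite -[q * q]expr2.
  move: (x * y) (z * t) => X Z; rewrite !ler_norml.
  by move=> /andP[? ?] /andP[? ?]; apply/andP; split; lra.
have q4 : q ^+ 4 = q ^+ 2 * q ^+ 2 by rewrite -exprD.
pose r1 := (4 * (b * c) - f * f, f * g - 2 * (c * h), f * h - 2 * (b * g)).
pose r2 := (f * g - 2 * (c * h), 4 * (a * c) - g * g, g * h - 2 * (a * f)).
pose r3 := (f * h - 2 * (b * g), g * h - 2 * (a * f), 4 * (a * b) - h * h).
have e1 : 2 * dsc * u.1.1 = dot r1 (grad u) by rewrite /dsc /dot /grad /=; ring.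
have e2 : 2 * dsc * u.1.2 = dot r2 (grad u) by rewrite /dsc /dot /grad /=; ring.
have e3 : 2 * dsc * u.2 = dot r3 (grad u) by rewrite /dsc /dot /grad /=; ring.
have -> : 4 * dsc ^+ 2 * dot u u = (2 * dsc * u.1.1) ^+ 2 + (2 * dsc * u.1.2) ^+ 2 + (2 * dsc * u.2) ^+ 2.
  by rewrite /dot; ring.
rewrite e1 e2 e3.
have b1 : dot r1 (grad u) ^+ 2 <= 43 * q ^+ 4 * dot (grad u) (grad u).
  apply: dot_bound; rewrite /dot /= q4.
  have := s2 _ _ (d1 _ _ _ hb hc hf); have := s2 _ _ (d2 _ _ _ _ hf hg hc hh).
  have := s2 _ _ (d2 _ _ _ _ hf hh hb hg); lra.
have b2 : dot r2 (grad u) ^+ 2 <= 43 * q ^+ 4 * dot (grad u) (grad u).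
  apply: dot_bound; rewrite /dot /= q4.
  have := s2 _ _ (d1 _ _ _ ha hc hg); have := s2 _ _ (d2 _ _ _ _ hf hg hc hh).
  have := s2 _ _ (d2 _ _ _ _ hg hh ha hf); lra.
have b3 : dot r3 (grad u) ^+ 2 <= 43 * q ^+ 4 * dot (grad u) (grad u).
  apply: dot_bound; rewrite /dot /= q4.
  have := s2 _ _ (d1 _ _ _ ha hb hh); have := s2 _ _ (d2 _ _ _ _ hf hh hb hg).
  have := s2 _ _ (d2 _ _ _ _ hg hh ha hf); lra.
lra.
Qed.

Variables (T0 T1 T2 : (R * R * R)%type).
Hypotheses (gT2 : grad T2 = crs T1 T2) (gT0 : grad T0 = crs T0 T1)
  (gT1 : grad T1 = lin3 2 0 0 (crs T0 T2) (crs T0 T2) (crs T0 T2)).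
Hypotheses (T2n0 : 0 < dot T2 T2) (dn0 : dsc != 0).

(** The shift for which [T1 + 2 xi T2] is orthogonal to [T2]. Replacing [t] by [t + xi s] in
    [s ^ 2 T0 + s t T1 + t ^ 2 T2] changes the vectors into [T0x], [T1x], [T2], and the relations
    between gradients and cross products persist. *)
Definition xi : R := - dot T1 T2 / (2 * dot T2 T2).
Definition T1x := lin3 1 (2 * xi) 0 T1 T2 T2.
Definition T0x := lin3 1 xi (xi ^+ 2) T0 T1 T2.

Lemma T1x_perp : dot T1x T2 = 0.
Proof.
have -> : dot T1x T2 = dot T1 T2 + 2 * xi * dot T2 T2 by rewrite /dot /T1x /lin3 /=; ring.
by rewrite /xi; field; rewrite gt_eqF.
Qed.

Lemma gradD u v r s : grad (lin3 r s 0 u v v) = lin3 r s 0 (grad u) (grad v) (grad v).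
Proof. by rewrite /grad /lin3 /=; congr (_, _, _); ring. Qed.

(** By orthogonality the product of the lengths of [T1x] and [T2] is the length of [crs T1x T2],
    which is [grad T2]; the length of [T2] then cancels. *)
Lemma T1x_le : dot T1x T1x <= 18 * q ^+ 2.
Proof.
have E : crs T1x T2 = grad T2.
  by rewrite gT2 /T1x /crs /lin3 /=; congr (_, _, _); ring.
have := grad_le T2; rewrite -E lagrange T1x_perp expr0n subr0.
by rewrite ler_pM2r.
Qed.

Lemma grad_T1x : grad T1x = lin3 2 0 0 (crs T0x T2) T2 T2.
Proof.
rewrite /T1x gradD gT1 gT2 /T0x /crs /lin3 /=; congr (_, _, _); ring.
Qed.

Lemma grad_T0x : grad T0x = crs T0x T1x.
Proof.
have -> : T0x = lin3 1 1 0 (lin3 1 xi 0 T0 T1 T1) (lin3 0 (xi ^+ 2) 0 T2 T2 T2)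
   (lin3 0 (xi ^+ 2) 0 T2 T2 T2) by rewrite /T0x /lin3 /=; congr (_, _, _); ring.
rewrite !gradD gT1 gT2 gT0 /T1x /crs /lin3 /=; congr (_, _, _); ring.
Qed.

(** Twice this cross product is the gradient of [T1x], whose size is already known. *)
Lemma crsT0x_le : dot (crs T0x T2) (crs T0x T2) <= 81 * q ^+ 4.
Proof.
have := grad_le T1x; rewrite grad_T1x.
have -> : dot (lin3 2 0 0 (crs T0x T2) T2 T2) (lin3 2 0 0 (crs T0x T2) T2 T2)
   = 4 * dot (crs T0x T2) (crs T0x T2) by rewrite /dot /lin3 /=; ring.
have q4 : q ^+ 4 = q ^+ 2 * q ^+ 2 by rewrite -exprD.
have := T1x_le; rewrite q4.
have : 0 <= q ^+ 2 by rewrite sqr_ge0.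
move: (dot (crs _ _) _) (dot T1x _) (q ^+ 2) => x y Q Q0 h1 h2.
have : 18 * Q * y <= 18 * Q * (18 * Q) by rewrite ler_wpM2l // mulr_ge0.
lra.
Qed.

(** [T0x] splits as [be T2 + p] with [p] orthogonal to [T2]. The length of [p] comes from
    [crs T0x T2]; the identity [2 be grad T2 = crs p T1x - grad p] bounds [be grad T2] by [p]; and
    [grad_ge] passes from [grad T2] to [T2] at the price of the discriminant. *)
Lemma T0x_le : dsc ^+ 2 * dot T0x T0x * dot T2 T2 <= 229 * 229 * q ^+ 10.
Proof.
pose A := dot T2 T2; have A0 : 0 < A := T2n0.
pose be := dot T0x T2 / A.
pose p := lin3 1 (- be) 0 T0x T2 T2.
have pa : dot p T2 = 0.
  have -> : dot p T2 = dot T0x T2 - be * A by rewrite /dot /p /lin3 /A /dot /=; ring.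
  by rewrite /be divfK ?subrr // gt_eqF.
have cp : crs p T2 = crs T0x T2.
  by rewrite /crs /p /lin3 /=; congr (_, _, _); ring.
have pA : dot p p * A <= 81 * q ^+ 4.
  by have := crsT0x_le; rewrite -cp lagrange pa expr0n subr0.
have dT0 : dot T0x T0x = be ^+ 2 * A + dot p p.
  have -> : be ^+ 2 * A + dot p p = dot T0x T0x - 2 * be * (dot T0x T2 - be * A).
    by rewrite /p /lin3 /A /dot /=; ring.
  by rewrite /be divfK ?gt_eqF // subrr mulr0 subr0.
have key : lin3 (2 * be) 0 0 (grad T2) T2 T2 = lin3 1 (-1) 0 (crs p T1x) (grad p) T2.
  have e1 : grad p = lin3 1 (- be) 0 (crs T0x T1x) (grad T2) T2.
    by rewrite /p gradD grad_T0x /lin3 /=; congr (_, _, _); ring.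
  rewrite e1 gT2 /p.
  have -> : crs T1 T2 = crs T1x T2 by rewrite /crs /T1x /lin3 /=; congr (_, _, _); ring.
  rewrite /lin3 /crs /=; congr (_, _, _); ring.
have n1 : dot (lin3 (2 * be) 0 0 (grad T2) T2 T2) (lin3 (2 * be) 0 0 (grad T2) T2 T2)
   = 4 * be ^+ 2 * dot (grad T2) (grad T2) by rewrite /dot /lin3 /=; ring.
have n2 x y : dot (lin3 1 (-1) 0 x y T2) (lin3 1 (-1) 0 x y T2) <= 2 * (dot x x + dot y y).
  have := dot_ge0 (lin3 1 1 0 x y T2).
  rewrite -subr_ge0 => H; rewrite -subr_ge0; move: H; congr (0 <= _).
  by rewrite /dot /lin3 /=; ring.
have n3 : 4 * be ^+ 2 * dot (grad T2) (grad T2) <= 72 * q ^+ 2 * dot p p.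
  rewrite -n1 key; apply: le_trans (n2 _ _) _.
  have h1 : dot (crs p T1x) (crs p T1x) <= 18 * q ^+ 2 * dot p p.
    rewrite lagrange; apply: (@le_trans _ _ (dot p p * dot T1x T1x)).
      by rewrite lerBlDr lerDl sqr_ge0.
    by rewrite mulrC ler_wpM2r ?dot_ge0 ?T1x_le.
  have h2 := grad_le p; lra.
have n4 : 4 * dsc ^+ 2 * (be ^+ 2 * A) <= 129 * q ^+ 4 * (18 * q ^+ 2 * dot p p).
  have h1 := grad_ge T2; rewrite -/A in h1.
  have : be ^+ 2 * (4 * dsc ^+ 2 * A) <= be ^+ 2 * (129 * q ^+ 4 * dot (grad T2) (grad T2)).
    by rewrite ler_wpM2l ?sqr_ge0.
  have : q ^+ 4 * (4 * be ^+ 2 * dot (grad T2) (grad T2)) <= q ^+ 4 * (72 * q ^+ 2 * dot p p).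
    by rewrite ler_wpM2l ?exprn_ge0.
  lra.
have d6 : dsc ^+ 2 * dot p p <= 64 * q ^+ 6 * dot p p.
  rewrite ler_wpM2r ?dot_ge0 //.
  have -> : 64 * q ^+ 6 = (8 * q ^+ 3) ^+ 2 by rewrite exprMn -exprM -natrX.
  exact: sqr_le_norm dsc_le.
have q6 : q ^+ 4 * q ^+ 2 = q ^+ 6 by rewrite -exprD.
(* [129 * 18 / 4 + 64 <= 645], and at the end [645 * 81 <= 229 ^ 2]. *)
have n5 : dsc ^+ 2 * dot T0x T0x <= 645 * q ^+ 6 * dot p p.
  rewrite dT0; have p0 := dot_ge0 p; have : 0 <= q ^+ 6 * dot p p by rewrite mulr_ge0 ?exprn_ge0.
  have e : 129 * q ^+ 4 * (18 * q ^+ 2 * dot p p) = 129 * 18 * (q ^+ 6 * dot p p).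
    by rewrite -q6; ring.
  rewrite e in n4; lra.
have : dsc ^+ 2 * dot T0x T0x * A <= 645 * q ^+ 6 * dot p p * A by rewrite ler_wpM2r // ltW.
have : 645 * q ^+ 6 * (dot p p * A) <= 645 * q ^+ 6 * (81 * q ^+ 4).
  by rewrite ler_wpM2l // mulr_ge0 ?exprn_ge0.
have : q ^+ 6 * q ^+ 4 = q ^+ 10 by rewrite -exprD.
have : 0 <= q ^+ 6 * q ^+ 4 by rewrite mulr_ge0 ?exprn_ge0.
move: (q ^+ 6) (q ^+ 4) (q ^+ 10) => x y z xy <-; rewrite -/A.
move: (dsc ^+ 2 * dot T0x T0x * A) (dot p p) => u w; lra.
Qed.
End Vec3.

(* [S1 a b], [S2 a b], [S3 a b] add to one coordinate an integral combination
   of the other two; lists of them represent unimodular matrices. *)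
Inductive shear := S1 of int & int | S2 of int & int | S3 of int & int.

Definition shear1 (S : comNzRingType) (o : shear) (v : S * S * S) : S * S * S :=
  match o with
  | S1 a b => (v.1.1 + (a%:~R * v.1.2 + b%:~R * v.2), v.1.2, v.2)
  | S2 a b => (v.1.1, v.1.2 + (a%:~R * v.1.1 + b%:~R * v.2), v.2)
  | S3 a b => (v.1.1, v.1.2, v.2 + (a%:~R * v.1.1 + b%:~R * v.1.2))
  end.

Definition act (S : comNzRingType) (l : seq shear) (v : S * S * S) : S * S * S :=
  foldr (@shear1 S) v l.

Definition sinv (o : shear) :=
  match o with S1 a b => S1 (- a) (- b) | S2 a b => S2 (- a) (- b) | S3 a b => S3 (- a) (- b) end.

(** * Forms given by their coefficients, the action of shears, and the normal form *)

Record qform (S : Type) := Form { fa : S; fb : S; fc : S; ff : S; fg : S; fh : S }.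

Definition ev (S : comNzRingType) (F : qform S) (v : S * S * S) : S :=
  fa F * v.1.1 ^+ 2 + fb F * v.1.2 ^+ 2 + fc F * v.2 ^+ 2
  + ff F * (v.1.2 * v.2) + fg F * (v.1.1 * v.2) + fh F * (v.1.1 * v.1.2).

Definition fdisc (S : comNzRingType) (F : qform S) : S :=
  4 * fa F * fb F * fc F + ff F * fg F * fh F - fa F * ff F ^+ 2
  - fb F * fg F ^+ 2 - fc F * fh F ^+ 2.

Section Generic.
Variable S : comNzRingType.
Implicit Types (v u w : S * S * S) (l : seq shear).

Lemma act_cat l1 l2 v : act (l1 ++ l2) v = act l1 (act l2 v).
Proof. by rewrite /act foldr_cat. Qed.

Lemma shear1K o v : shear1 (sinv o) (shear1 o v) = v.
Proof.
by case: o v => a b [[x y] z] /=; rewrite !rmorphN /=; congr (_, _, _); ring.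
Qed.

Lemma shear1VK o v : shear1 o (shear1 (sinv o) v) = v.
Proof.
by case: o v => a b [[x y] z] /=; rewrite !rmorphN /=; congr (_, _, _); ring.
Qed.

Definition linv l := rev (map sinv l).

Lemma actK l v : act (linv l) (act l v) = v.
Proof.
elim: l v => //= o l IH v; rewrite /linv /= rev_cons -cats1 act_cat /= shear1K.
exact: IH.
Qed.

Lemma actVK l v : act l (act (linv l) v) = v.
Proof.
elim: l v => //= o l IH v; rewrite /linv /= rev_cons -cats1 act_cat /= IH.
exact: shear1VK.
Qed.

Definition lc3 (r s t : S) u v w : S * S * S :=
  (r * u.1.1 + s * v.1.1 + t * w.1.1, r * u.1.2 + s * v.1.2 + t * w.1.2,
   r * u.2 + s * v.2 + t * w.2).

Lemma act_lc3 l r s t u v w :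
  act l (lc3 r s t u v w) = lc3 r s t (act l u) (act l v) (act l w).
Proof.
elim: l => //= o l ->; case: o => a b; rewrite /lc3 /=; congr (_, _, _); ring.
Qed.

Lemma act0 l : act l (0, 0, 0) = (0, 0, 0) :> (S * S * S)%type.
Proof. by elim: l => //= o l ->; case: o => a b /=; rewrite !mulr0 !addr0. Qed.

Definition det3v u v w : S :=
  u.1.1 * (v.1.2 * w.2 - v.2 * w.1.2) + u.1.2 * (v.2 * w.1.1 - v.1.1 * w.2)
  + u.2 * (v.1.1 * w.1.2 - v.1.2 * w.1.1).

Lemma det_act l u v w : det3v (act l u) (act l v) (act l w) = det3v u v w.
Proof.
elim: l => //= o l <-; case: o => a b; rewrite /det3v /=; ring.
Qed.

Definition pull1 (F : qform S) (o : shear) : qform S :=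
  match o with
  | S1 a b => Form (fa F) (fb F + fh F * a%:~R + fa F * a%:~R ^+ 2)
       (fc F + fg F * b%:~R + fa F * b%:~R ^+ 2)
       (ff F + fg F * a%:~R + fh F * b%:~R + 2 * fa F * a%:~R * b%:~R)
       (fg F + 2 * fa F * b%:~R) (fh F + 2 * fa F * a%:~R)
  | S2 a b => Form (fa F + fh F * a%:~R + fb F * a%:~R ^+ 2) (fb F)
       (fc F + ff F * b%:~R + fb F * b%:~R ^+ 2)
       (ff F + 2 * fb F * b%:~R)
       (fg F + ff F * a%:~R + fh F * b%:~R + 2 * fb F * a%:~R * b%:~R)
       (fh F + 2 * fb F * a%:~R)
  | S3 a b => Form (fa F + fg F * a%:~R + fc F * a%:~R ^+ 2)
       (fb F + ff F * b%:~R + fc F * b%:~R ^+ 2) (fc F)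
       (ff F + 2 * fc F * b%:~R) (fg F + 2 * fc F * a%:~R)
       (fh F + ff F * a%:~R + fg F * b%:~R + 2 * fc F * a%:~R * b%:~R)
  end.

Definition pull (F : qform S) l := foldl pull1 F l.

Lemma ev_pull1 F o v : ev (pull1 F o) v = ev F (shear1 o v).
Proof. by case: o => a b; rewrite /ev /=; ring. Qed.

Lemma ev_pull F l v : ev (pull F l) v = ev F (act l v).
Proof. by elim: l F v => //= o l IH F v; rewrite IH ev_pull1. Qed.

Lemma fdisc_pull1 F o : fdisc (pull1 F o) = fdisc F.
Proof. by case: o => a b; rewrite /fdisc /=; ring. Qed.

Lemma fdisc_pull F l : fdisc (pull F l) = fdisc F.
Proof. by elim: l F => //= o l IH F; rewrite IH fdisc_pull1. Qed.
End Generic.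

Definition castv (S : comNzRingType) (v : int * int * int) : S * S * S :=
  (v.1.1%:~R, v.1.2%:~R, v.2%:~R).

Lemma cast_act (S : comNzRingType) l v : castv S (act l v) = act l (castv S v).
Proof.
elim: l => //= o l <-; case: o => a b; rewrite /castv /=; congr (_, _, _);
 rewrite !(rmorphD, rmorphM) /= ?intz //.
Qed.

Definition size3 (v : int * int * int) : nat := (`|v.1.1| + `|v.1.2| + `|v.2|)%N.

(** Euclid's algorithm: while two coordinates are nonzero, a shear decreases the larger one. A
    single nonzero coordinate in second or third place is carried to the first by three shears,
    which form a rotation by a right angle; hence the minus sign. *)
Lemma euclid3 (v : int * int * int) : exists l g, v = act l (g, 0, 0).
Proof.
elim: {v}(size3 v) {-2}v (leqnn (size3 v)) => [|n IH] [[x y] z]; rewrite /size3 /=.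
  by move=> h; exists [::], 0 => /=; congr (_, _, _); lia.
move=> hn.
have step o : (size3 (shear1 (sinv o) (x, y, z)) <= n)%N ->
    exists l g, (x, y, z) = act l (g, 0, 0).
  move=> /IH [l [g E]]; exists (o :: l), g => /=.
  by rewrite -E shear1VK.
have [y0|y0] := eqVneq y 0; have [z0|z0] := eqVneq z 0; have [x0|x0] := eqVneq x 0.
- by exists [::], x; rewrite /= y0 z0.
- by exists [::], x; rewrite /= y0 z0.
- exists [:: S1 0 1; S3 (-1) 0; S1 0 1], (- z); rewrite /= x0 y0 !rmorphN /= ?intz.
  by congr (_, _, _); ring.
- have [h|h] := leqP `|x|%N `|z|%N.
    have [s|s] := boolP ((0 < x) == (0 < z)).
      by apply: (step (S3 1 0)); rewrite /size3 /= !intz; lia.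
    by apply: (step (S3 (-1) 0)); rewrite /size3 /= !intz; lia.
  have [s|s] := boolP ((0 < x) == (0 < z)).
    by apply: (step (S1 0 1)); rewrite /size3 /= !intz; lia.
  by apply: (step (S1 0 (-1))); rewrite /size3 /= !intz; lia.
- exists [:: S1 1 0; S2 (-1) 0; S1 1 0], (- y); rewrite /= x0 z0 !rmorphN /= ?intz.
  by congr (_, _, _); ring.
- have [h|h] := leqP `|x|%N `|y|%N.
    have [s|s] := boolP ((0 < x) == (0 < y)).
      by apply: (step (S2 1 0)); rewrite /size3 /= !intz; lia.
    by apply: (step (S2 (-1) 0)); rewrite /size3 /= !intz; lia.
  have [s|s] := boolP ((0 < x) == (0 < y)).
    by apply: (step (S1 1 0)); rewrite /size3 /= !intz; lia.
  by apply: (step (S1 (-1) 0)); rewrite /size3 /= !intz; lia.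
all: have [h|h] := leqP `|z|%N `|y|%N;
  [ have [s|s] := boolP ((0 < z) == (0 < y));
    [ by apply: (step (S2 0 1)); rewrite /size3 /= !intz; lia
    | by apply: (step (S2 0 (-1))); rewrite /size3 /= !intz; lia]
  | have [s|s] := boolP ((0 < z) == (0 < y));
    [ by apply: (step (S3 0 1)); rewrite /size3 /= !intz; lia
    | by apply: (step (S3 0 (-1))); rewrite /size3 /= !intz; lia]].
Qed.

(* Euclid's algorithm on the coefficients of the linear form h y + g z. *)
Lemma euclid2 (h g : int) : exists l d,
  [/\ forall x : int, act l (x, 0, 0) = (x, 0, 0)
    & forall v : int * int * int, (act l v).1.1 = v.1.1 /\
        h * (act l v).1.2 + g * (act l v).2 = d * v.1.2].
Proof.
elim: {h g}(`|h| + `|g|)%N {-2}h {-2}g (leqnn (`|h| + `|g|)%N) => [|n IH] h g hn.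
  have -> : h = 0 by lia.
  have -> : g = 0 by lia.
  by exists [::], 0; split=> //= v; split=> //; rewrite !mul0r.
have step h' g' o : (`|h'| + `|g'| <= n)%N -> (forall x : int, shear1 o (x, 0, 0) = (x, 0, 0)) ->
   (forall v : int * int * int, (shear1 o v).1.1 = v.1.1 /\
      h * (shear1 o v).1.2 + g * (shear1 o v).2 = h' * v.1.2 + g' * v.2) ->
   exists l d, [/\ forall x : int, act l (x, 0, 0) = (x, 0, 0)
    & forall v : int * int * int, (act l v).1.1 = v.1.1 /\
        h * (act l v).1.2 + g * (act l v).2 = d * v.1.2].
  move=> /IH [l [d [h1 h2]]] o1 o2; exists (o :: l), d; split=> [x|v] /=.
    by rewrite h1 o1.
  by have [-> ->] := o2 (act l v); have [-> ->] := h2 v.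
have [g0|g0] := eqVneq g 0.
  by exists [::], h; split=> //= v; split=> //; rewrite g0 mul0r addr0.
have [h0|h0] := eqVneq h 0.
  exists [:: S3 0 1; S2 0 (-1)], g; split=> [x|v] /=.
    by rewrite !intz; congr (_, _, _); ring.
  by split=> //; rewrite h0 !rmorphN /= ?intz; ring.
have [hl|hl] := leqP `|h|%N `|g|%N.
  have [s|s] := boolP ((0 < h) == (0 < g)).
    apply: (step h (g - h) (S2 0 (-1))); first lia.
      by move=> x /=; rewrite !intz; congr (_, _, _); ring.
    by move=> v /=; split=> //; rewrite !intz; ring.
  apply: (step h (g + h) (S2 0 1)); first lia.
    by move=> x /=; rewrite !intz; congr (_, _, _); ring.
  by move=> v /=; split=> //; rewrite !intz; ring.
have [s|s] := boolP ((0 < h) == (0 < g)).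
  apply: (step (h - g) g (S3 0 (-1))); first lia.
    by move=> x /=; rewrite !intz; congr (_, _, _); ring.
  by move=> v /=; split=> //; rewrite !intz; ring.
apply: (step (h + g) g (S3 0 1)); first lia.
  by move=> x /=; rewrite !intz; congr (_, _, _); ring.
by move=> v /=; split=> //; rewrite !intz; ring.
Qed.

(* Rotation by pi in the (y, z) plane. *)
Definition rot_yz : seq shear := [:: S2 0 1; S3 0 (-1); S2 0 1; S2 0 1; S3 0 (-1); S2 0 1].

Lemma act_rot (v : int * int * int) : act rot_yz v = (v.1.1, - v.1.2, - v.2).
Proof. by rewrite /= !intz; congr (_, _, _); ring. Qed.

(** The values at the six vectors with entries 0 and 1, not all equal, determine the
    coefficients. *)
Lemma ev_inj (F G : qform int) : (forall v, ev F v = ev G v) -> F = G.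
Proof.
case: F G => a b c f g h [a' b' c' f' g' h'] E.
have := E (1, 0, 0); have := E (0, 1, 0); have := E (0, 0, 1).
have := E (0, 1, 1); have := E (1, 0, 1); have := E (1, 1, 0).
rewrite /ev /= => E1 E2 E3 E4 E5 E6.
have ? : a = a' by lia.
have ? : b = b' by lia.
have ? : c = c' by lia.
by congr Form => //; lia.
Qed.

(** Once the zero lies on the first axis, the coefficient of [x ^ 2] vanishes and the terms in [x]
    are [x] times a linear form in [y], [z]. [euclid2] makes that linear form a multiple of [y]
    while fixing the first axis. *)
Lemma normal_form (F : qform int) (x0 : int * int * int) :
  fdisc F != 0 -> ev F x0 = 0 -> x0 != (0, 0, 0) ->
  exists l g d A B C, [/\ 0 < d, x0 = act l (g, 0, 0)
    & forall v, ev F (act l v) = d * v.1.1 * v.1.2 + A * v.1.2 ^+ 2 + B * v.1.2 * v.2 + C * v.2 ^+ 2].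
Proof.
move=> dF Fx0 x00; have [l1 [g Ex0]] := euclid3 x0.
have g0 : g != 0.
  by apply: contraNneq x00 => g0; rewrite Ex0 g0 act0.
pose F1 := pull F l1.
have a0 : fa F1 = 0.
  have : ev F1 (g, 0, 0) = 0 by rewrite ev_pull -Ex0.
  rewrite /ev /= => /eqP; rewrite !(expr0n, mulr0, mul0r, addr0) /=.
  by rewrite mulf_eq0 expf_eq0 /= (negbTE g0) orbF => /eqP.
have [l2 [d [h1 h2]]] := euclid2 (fh F1) (fg F1).
pose F2 := pull F1 l2.
have E2 v : ev F2 v = d * v.1.1 * v.1.2 +
    (fb F1 * (act l2 (0, v.1.2, v.2)).1.2 ^+ 2 + fc F1 * (act l2 (0, v.1.2, v.2)).2 ^+ 2
    + ff F1 * ((act l2 (0, v.1.2, v.2)).1.2 * (act l2 (0, v.1.2, v.2)).2)).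
  have -> : v = lc3 1 1 0 (v.1.1, 0, 0) (0, v.1.2, v.2) (0, 0, 0).
    by case: v => [[x y] z]; rewrite /lc3 /=; congr (_, _, _); ring.
  set x := v.1.1; set y := v.1.2; set z := v.2.
  rewrite ev_pull act_lc3 h1 /lc3 /= !(mul1r, mul0r, mulr0, addr0, add0r).
  have [e1 e2] := h2 (0, y, z); rewrite /= in e1 e2.
  rewrite /ev /= e1 a0 !addr0 mul0r add0r.
  transitivity (x * (fh F1 * (act l2 (0, y, z)).1.2 + fg F1 * (act l2 (0, y, z)).2)
    + (fb F1 * (act l2 (0, y, z)).1.2 ^+ 2 + fc F1 * (act l2 (0, y, z)).2 ^+ 2
    + ff F1 * ((act l2 (0, y, z)).1.2 * (act l2 (0, y, z)).2))); first ring.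
  by rewrite e2; ring.
have F2a : fa F2 = 0.
  have := E2 (1, 0, 0); rewrite /ev /= h1 /=; lra.
have F2h v : ev F2 v = d * v.1.1 * v.1.2 + fb F2 * v.1.2 ^+ 2 + ff F2 * v.1.2 * v.2 + fc F2 * v.2 ^+ 2.
  have e1 := E2 (1, 1, 0); have e2 := E2 (0, 1, 0).
  have e3 := E2 (1, 0, 1); have e4 := E2 (0, 0, 1).
  have hh : fh F2 = d by move: e1 e2; rewrite /ev /=; lra.
  have hg : fg F2 = 0 by move: e3 e4; rewrite /ev /=; lra.
  by rewrite /ev F2a hh hg; ring.
(* With [d = 0] the form would not involve [x], and its discriminant would vanish. *)
have d0 : d != 0.
  apply: contraNneq dF => d0; rewrite -(fdisc_pull F l1) -/F1 -(fdisc_pull F1 l2) -/F2.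
  have e1 := F2h (1, 1, 0); have e3 := F2h (1, 0, 1).
  have hh : fh F2 = 0 by move: e1; rewrite /ev /=; lra.
  have hg : fg F2 = 0 by move: e3; rewrite /ev /=; lra.
  by rewrite /fdisc F2a hh hg; apply/eqP; ring.
have E3 v : ev F (act (l1 ++ l2) v) = ev F2 v by rewrite act_cat -!ev_pull.
have [dp|dn] := ltP 0 d.
  exists (l1 ++ l2), g, d, (fb F2), (ff F2), (fc F2); split=> //.
    by rewrite act_cat h1.
  by move=> v; rewrite E3 F2h.
(* The rotation by pi changes the sign of [d] and leaves the terms in [y], [z] alone, without
   leaving the group generated by shears. *)
exists ((l1 ++ l2) ++ rot_yz), g, (- d), (fb F2), (ff F2), (fc F2); split.
- by rewrite oppr_gt0 lt_neqAle d0.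
- by rewrite [act (_ ++ rot_yz) _]act_cat act_rot /= oppr0 act_cat h1.
- by move=> v; rewrite [act (_ ++ rot_yz) _]act_cat act_rot E3 F2h /=; ring.
Qed.

End QuadraticForms.

From mathcomp Require Import boolp.

Module Reduction.
Import QuadraticForms.

(** * The maximum norm and Dirichlet approximation *)

Section Sup3.
Variable R : realFieldType.
Implicit Types u v w : (R * R * R)%type.

Definition sup3 v : R := Num.max `|v.1.1| (Num.max `|v.1.2| `|v.2|).

Lemma sup3_le v m : (sup3 v <= m) = [&& `|v.1.1| <= m, `|v.1.2| <= m & `|v.2| <= m].
Proof. by rewrite /sup3 !ge_max. Qed.

Lemma sup3_ge v : [/\ `|v.1.1| <= sup3 v, `|v.1.2| <= sup3 v & `|v.2| <= sup3 v].
Proof. by have := lexx (sup3 v); rewrite {1}sup3_le => /and3P. Qed.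

Lemma sup3_ge0 v : 0 <= sup3 v.
Proof. by have [h _ _] := sup3_ge v; apply: le_trans h. Qed.

Lemma sup3_sqr v : sup3 v ^+ 2 <= dot v v.
Proof.
have h (x y z : R) : 0 <= y -> 0 <= z -> x ^+ 2 <= x * x + y + z by rewrite expr2; lra.
have s x : 0 <= x * x :> R by rewrite -expr2 sqr_ge0.
rewrite /sup3 /dot; move: v.1.1 v.1.2 v.2 (s v.1.1) (s v.1.2) (s v.2) => x y z hx hy hz.
rewrite /Num.max; case: ifP => _; first case: ifP => _.
all: rewrite real_normK ?num_real // expr2; lra.
Qed.

Lemma dot_sup3 v : dot v v <= 3 * sup3 v ^+ 2.
Proof.
have [] := sup3_ge v; move=> /sqr_le_norm h1 /sqr_le_norm h2 /sqr_le_norm h3.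
by move: h1 h2 h3; rewrite /dot !expr2; lra.
Qed.

Lemma sup3_lin r s t u v w :
  sup3 (lin3 r s t u v w) <= `|r| * sup3 u + `|s| * sup3 v + `|t| * sup3 w.
Proof.
have [u1 u2 u3] := sup3_ge u; have [v1 v2 v3] := sup3_ge v; have [w1 w2 w3] := sup3_ge w.
have k x y z : `|x| <= sup3 u -> `|y| <= sup3 v -> `|z| <= sup3 w ->
    `|r * x + s * y + t * z| <= `|r| * sup3 u + `|s| * sup3 v + `|t| * sup3 w.
  move=> h1 h2 h3; apply: le_trans (ler_normD _ _) _; apply: lerD.
    by apply: le_trans (ler_normD _ _) _; apply: lerD; rewrite normrM ler_wpM2l.
  by rewrite normrM ler_wpM2l.
by rewrite sup3_le; apply/and3P; split; apply: k.
Qed.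

Lemma sup3_eq0 v : (sup3 v == 0) = (v == (0, 0, 0)).
Proof.
apply/idP/eqP => [/eqP h|->].
  have := lexx (sup3 v); rewrite {2}h sup3_le !normr_le0.
  by case: v {h} => [[x y] z] /= /and3P[/eqP-> /eqP-> /eqP->].
by rewrite /sup3 /= normr0 !maxxx.
Qed.
End Sup3.

Section Dirichlet.
Variable R : archiRealFieldType.

(** Pigeonhole: the fractional parts of [0 x, ..., n x] are [n + 1] points in [n] intervals of
    length [1 / n]. *)
Lemma dirichlet (x : R) (S : nat) : (0 < S)%N ->
  exists (s : nat) (t : int), [/\ (0 < s)%N, (s <= S)%N & `|t%:~R - x * s%:R| <= S%:R^-1].
Proof.
case: S => // S _; pose n := S.+1.
pose fr (i : nat) : R := i%:R * x - (Num.floor (i%:R * x))%:~R.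
have fr01 i : 0 <= fr i < 1.
  rewrite /fr subr_ge0 ltrBlDr addrC floor_le /=.
  by have := floorD1_gt (i%:R * x); rewrite intrD.
pose f (i : 'I_n.+1) : 'I_n := inord `|Num.floor (n%:R * fr i)|%N.
have ff (i : 'I_n.+1) : (Num.floor (n%:R * fr i)) = (f i)%:Z.
  have /andP[h0 h1] := fr01 i.
  have g0 : 0 <= Num.floor (n%:R * fr i) by rewrite floor_ge0 mulr_ge0.
  have g1 : Num.floor (n%:R * fr i) < n%:Z.
    by rewrite floor_lt_int pmulrn gtr_pMr ?ltr0n.
  rewrite /f inordK; first by rewrite gez0_abs.
  by rewrite -ltz_nat gez0_abs.
have [i [j [ij fij]]] : exists i j : 'I_n.+1, (i < j)%N /\ f i = f j.
  have : ~~ injectiveb f.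
    by apply/negP => /injectiveP /leq_card; rewrite !card_ord ltnn.
  move=> /injectivePn [i [j ij e]].
  case: (ltngtP i j) => h; [by exists i, j|by exists j, i|].
  by move/val_inj: h ij => ->; rewrite eqxx.
exists (j - i)%N, (Num.floor (j%:R * x) - Num.floor (i%:R * x)); split.
- by rewrite subn_gt0.
- by have := ltn_ord j; rewrite /n; lia.
have e : (Num.floor (j%:R * x) - Num.floor (i%:R * x))%:~R - x * (j - i)%:R = fr i - fr j.
  by rewrite /fr natrB 1?ltnW // intrB; ring.
rewrite e.
have bi := ff i; have bj := ff j; rewrite fij -bj in bi.
have n0 : (0 : R) < n%:R by rewrite ltr0n.
have l1 := floor_le (n%:R * fr i); have l2 := floorD1_gt (n%:R * fr i).
have l3 := floor_le (n%:R * fr j); have l4 := floorD1_gt (n%:R * fr j).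
rewrite bi !intrD in l1 l2 l3 l4.
rewrite -[n%:R^-1]mul1r ler_pdivlMr // -[X in _ * X]gtr0_norm // -normrM ler_norml.
by apply/andP; split; lra.
Qed.
End Dirichlet.

(** * Bounds for the parametrisation in terms of the coefficients *)

Definition castF (R : comNzRingType) (F : qform int) : qform R :=
  Form (fa F)%:~R (fb F)%:~R (fc F)%:~R (ff F)%:~R (fg F)%:~R (fh F)%:~R.

Lemma cast_pull (R : comNzRingType) (F : qform int) l :
  pull (castF R F) l = castF R (pull F l).
Proof.
elim: l F => //= o l IH F; rewrite -IH; congr (pull _ _); case: o => a b;
 by rewrite /castF /=; congr Form; rewrite !(rmorphD, rmorphM, rmorphXn) /= ?intz.
Qed.

Section NormalForm.
Variable R : archiRealFieldType.
Variables (F : qform int) (q : int).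
Hypotheses (ha : `|fa F| <= q) (hb : `|fb F| <= q) (hc : `|fc F| <= q)
  (hf : `|ff F| <= q) (hg : `|fg F| <= q) (hh : `|fh F| <= q).

Notation "n %:r" := (n%:~R : R) (at level 2, left associativity, format "n %:r").

Let FR := castF R F.
Let gr := grad (fa F)%:r (fb F)%:r (fc F)%:r (ff F)%:r (fg F)%:r (fh F)%:r.
Let dR := dsc (fa F)%:r (fb F)%:r (fc F)%:r (ff F)%:r (fg F)%:r (fh F)%:r.

Let hR (x : int) : `|x| <= q -> `|x%:r| <= q%:r.
Proof. by rewrite -intr_norm ler_int. Qed.

Lemma dscE : dR = (fdisc F)%:r.
Proof. by rewrite /dR /dsc /fdisc !(rmorphB, rmorphD, rmorphM, rmorphXn) /=. Qed.

Lemma polar (u v : R * R * R) :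
  dot (gr u) v = ev FR (u.1.1 + v.1.1, u.1.2 + v.1.2, u.2 + v.2) - ev FR u - ev FR v.
Proof. by rewrite /dot /gr /grad /ev /=; ring. Qed.

(** The polar form has nine monomials, and the three diagonal ones carry a factor 2, which makes
    12. *)
Lemma polar_le (u v : R * R * R) : `|dot (gr u) v| <= 12 * q%:r * sup3 u * sup3 v.
Proof.
have [u1 u2 u3] := sup3_ge u; have [v1 v2 v3] := sup3_ge v.
have k (x : int) (y z : R) : `|x| <= q -> `|y| <= sup3 u -> `|z| <= sup3 v ->
   `|x%:r * y * z| <= q%:r * sup3 u * sup3 v.
  by move=> /hR h1 h2 h3; do 2?apply: normM_le.
have -> : dot (gr u) v = 2 * ((fa F)%:r * u.1.1 * v.1.1) + (fh F)%:r * u.1.2 * v.1.1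
  + (fg F)%:r * u.2 * v.1.1 + (fh F)%:r * u.1.1 * v.1.2 + 2 * ((fb F)%:r * u.1.2 * v.1.2)
  + (ff F)%:r * u.2 * v.1.2 + (fg F)%:r * u.1.1 * v.2 + (ff F)%:r * u.1.2 * v.2
  + 2 * ((fc F)%:r * u.2 * v.2).
  by rewrite /dot /gr /grad /=; ring.
have := k _ _ _ ha u1 v1; have := k _ _ _ hh u2 v1; have := k _ _ _ hg u3 v1.
have := k _ _ _ hh u1 v2; have := k _ _ _ hb u2 v2; have := k _ _ _ hf u3 v2.
have := k _ _ _ hg u1 v3; have := k _ _ _ hf u2 v3; have := k _ _ _ hc u3 v3.
have -> : 12 * q%:r * sup3 u * sup3 v = 12 * (q%:r * sup3 u * sup3 v) by ring.
rewrite !ler_norml.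
move: (q%:r * sup3 u * sup3 v) => Z.
do 9 (move=> /andP[? ?]); apply/andP; split; lra.
Qed.

(** Cramer's rule: the difference of [X] and [Y] is recovered from its products with the basis by
    means of the cross products of pairs. *)
Lemma vec_eq (T0 T1 T2 X Y : R * R * R) : det3v T0 T1 T2 != 0 ->
  dot X T0 = dot Y T0 -> dot X T1 = dot Y T1 -> dot X T2 = dot Y T2 -> X = Y.
Proof.
move=> d0 h0 h1 h2; pose Z := lin3 1 (-1) 0 X Y Y.
have z T : dot X T = dot Y T -> dot Z T = 0.
  by move=> h; rewrite -[RHS](subrr (dot Y T)) -{1}h /dot /Z /lin3 /=; ring.
have e : lin3 (dot Z T0) (dot Z T1) (dot Z T2) (crs T1 T2) (crs T2 T0) (crs T0 T1)
   = lin3 (det3v T0 T1 T2) 0 0 Z Z Z.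
  by rewrite /lin3 /crs /det3v /dot /=; congr (_, _, _); ring.
rewrite !z // /lin3 !mul0r !addr0 in e.
case: e => /esym/eqP; rewrite mulf_eq0 (negbTE d0) /= => /eqP e1.
move=> /esym/eqP; rewrite mulf_eq0 (negbTE d0) /= => /eqP e2.
move=> /esym/eqP; rewrite mulf_eq0 (negbTE d0) /= => /eqP e3.
case: X Y e1 e2 e3 @Z {h0 h1 h2 z} => [[x y] z] [[x' y'] z'] /= e1 e2 e3.
by congr (_, _, _); lra.
Qed.

Variables (l : seq shear) (d A B C : int).
Hypothesis nf : forall v, ev F (act l v) =
  d * v.1.1 * v.1.2 + A * v.1.2 ^+ 2 + B * v.1.2 * v.2 + C * v.2 ^+ 2.
Hypothesis dF : fdisc F != 0.

Lemma nf_pull : pull F l = Form 0 A C B 0 d.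
Proof. by apply: ev_inj => v; rewrite ev_pull nf /ev /=; ring. Qed.

Lemma nf_disc : fdisc F = - (C * d ^+ 2).
Proof. by rewrite -(fdisc_pull F l) nf_pull /fdisc /=; ring. Qed.

Lemma nfR v : ev FR (act l v) = d%:r * v.1.1 * v.1.2 + A%:r * v.1.2 ^+ 2
  + B%:r * v.1.2 * v.2 + C%:r * v.2 ^+ 2.
Proof. by rewrite -ev_pull cast_pull nf_pull /ev /=; ring. Qed.

Lemma polar_act (u v : R * R * R) : dot (gr (act l u)) (act l v) =
  d%:r * (u.1.1 * v.1.2 + u.1.2 * v.1.1) + 2 * A%:r * u.1.2 * v.1.2
  + B%:r * (u.1.2 * v.2 + u.2 * v.1.2) + 2 * C%:r * u.2 * v.2.
Proof.
rewrite polar !nfR.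
have -> : ((act l u).1.1 + (act l v).1.1, (act l u).1.2 + (act l v).1.2,
    (act l u).2 + (act l v).2) = act l (lc3 1 1 0 u v v).
  by rewrite act_lc3 /lc3; congr (_, _, _); ring.
by rewrite nfR /lc3 /=; ring.
Qed.

(** [Tz], [To], [Tt] are the coefficient vectors of [s ^ 2], [s t], [t ^ 2] in [par]; [Tt] is [- C]
    times the image of the first axis, that is of the chosen zero up to scaling. *)
Definition Tz : R * R * R := act l (- A%:r, d%:r, 0).
Definition To : R * R * R := act l (- B%:r, 0, d%:r).
Definition Tt : R * R * R := act l (- C%:r, 0, 0).
Definition par (s t : R) : R * R * R :=
  act l (- (A%:r * s ^+ 2 + B%:r * s * t + C%:r * t ^+ 2), d%:r * s ^+ 2, d%:r * s * t).

Lemma parE s t : par s t = lin3 (s ^+ 2) (s * t) (t ^+ 2) Tz To Tt.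
Proof.
rewrite /par -[RHS]act_lc3 /lc3 /=; congr (act l _); congr (_, _, _); ring.
Qed.

Let D : R := (C * d ^+ 2)%:r.
Lemma D_neq0 : D != 0.
Proof. by rewrite intr_eq0; move: dF; rewrite nf_disc oppr_eq0. Qed.

Lemma det_T : det3v Tz To Tt = - D.
Proof. by rewrite det_act /det3v /D !(rmorphM, rmorphXn) /=; ring. Qed.

(** Both sides are compared through their products with the basis [Tz], [To], [Tt]. On the left
    these are values of the polar form, computed in normal coordinates by [polar_act]; on the right
    they are triple products, zero or a determinant. *)
Lemma grad_Tt : gr Tt = crs To Tt.
Proof.
apply: (@vec_eq Tz To Tt); first by rewrite det_T oppr_eq0 D_neq0.
- rewrite polar_act; transitivity (det3v Tz To Tt).
    by rewrite det_T /D !(rmorphM, rmorphXn) /=; ring.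
  by rewrite /det3v /dot /crs /=; ring.
- rewrite polar_act; transitivity (0 : R); last by rewrite /dot /crs /=; ring.
  by rewrite /=; ring.
- rewrite polar_act; transitivity (0 : R); last by rewrite /dot /crs /=; ring.
  by rewrite /=; ring.
Qed.

Lemma grad_Tz : gr Tz = crs Tz To.
Proof.
apply: (@vec_eq Tz To Tt); first by rewrite det_T oppr_eq0 D_neq0.
- rewrite polar_act; transitivity (0 : R); last by rewrite /dot /crs /=; ring.
  by rewrite /=; ring.
- rewrite polar_act; transitivity (0 : R); last by rewrite /dot /crs /=; ring.
  by rewrite /=; ring.
- rewrite polar_act; transitivity (det3v Tz To Tt).
    by rewrite det_T /D !(rmorphM, rmorphXn) /=; ring.
  by rewrite /det3v /dot /crs /=; ring.
Qed.

Lemma grad_To : gr To = lin3 2 0 0 (crs Tz Tt) (crs Tz Tt) (crs Tz Tt).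
Proof.
apply: (@vec_eq Tz To Tt); first by rewrite det_T oppr_eq0 D_neq0.
- rewrite polar_act; transitivity (0 : R); last by rewrite /dot /crs /lin3 /=; ring.
  by rewrite /=; ring.
- rewrite polar_act; transitivity (- 2 * det3v Tz To Tt).
    by rewrite det_T /D !(rmorphM, rmorphXn) /=; ring.
  by rewrite /det3v /dot /crs /lin3 /=; ring.
- rewrite polar_act; transitivity (0 : R); last by rewrite /dot /crs /lin3 /=; ring.
  by rewrite /=; ring.
Qed.

(** In the polar form [Tt] is orthogonal to itself and to [To], so only the term in [s ^ 2] of
    [par s t] survives the pairing. *)
Lemma par_bound_s s t : `|D| * s ^+ 2 <= 12 * q%:r * sup3 Tt * sup3 (par s t).
Proof.
apply: le_trans (polar_le Tt (par s t)); rewrite polar_act /=.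
set X := (X in _ <= `|X|); have -> : X = - (D * s ^+ 2).
  by rewrite /X /D !(rmorphM, rmorphXn) /=; ring.
by rewrite normrN normrM [ `|s ^+ 2|]ger0_norm ?sqr_ge0.
Qed.

Lemma par_bound_t s t : `|D| * t ^+ 2 <= 12 * q%:r * sup3 Tz * sup3 (par s t).
Proof.
apply: le_trans (polar_le Tz (par s t)); rewrite polar_act /=.
set X := (X in _ <= `|X|); have -> : X = - (D * t ^+ 2).
  by rewrite /X /D !(rmorphM, rmorphXn) /=; ring.
by rewrite normrN normrM [ `|t ^+ 2|]ger0_norm ?sqr_ge0.
Qed.

Definition shiftx : R := xi To Tt.
Let T0' := T0x Tz To Tt.
Let T1' := T1x To Tt.

Lemma par_shift s t : par s t =
  lin3 (s ^+ 2) (s * (t - shiftx * s)) ((t - shiftx * s) ^+ 2) T0' T1' Tt.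
Proof.
rewrite parE /T0' /T1' /T0x /T1x -/shiftx; move: shiftx => x.
by rewrite /lin3 /=; congr (_, _, _); ring.
Qed.

Let q0 : 0 <= q%:r.
Proof. by rewrite ler0z; apply: le_trans ha. Qed.

Lemma Tt_gt0 : 0 < dot Tt Tt.
Proof.
rewrite lt_neqAle dot_ge0 andbT eq_sym; apply/eqP => h.
have : sup3 Tt ^+ 2 <= 0 by rewrite -h sup3_sqr.
rewrite exprn_even_le0 //= sup3_eq0 => /eqP e.
have := det_T; rewrite e => /eqP; rewrite /det3v !mulr0 !subrr !mulr0 !addr0.
by rewrite eq_sym oppr_eq0 (negbTE D_neq0).
Qed.

Lemma T1'_le : sup3 T1' <= 5 * q%:r.
Proof.
have h : dot T1' T1' <= 18 * q%:r ^+ 2.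
  exact: (T1x_le (hR ha) (hR hb) (hR hc) (hR hf) (hR hg) (hR hh) grad_Tt Tt_gt0).
rewrite -[sup3 T1']ger0_norm ?sup3_ge0 //; apply: norm_le_sqr; first by rewrite mulr_ge0.
apply: le_trans (sup3_sqr _) _; apply: le_trans h _; rewrite exprMn ler_wpM2r ?sqr_ge0 //.
by rewrite -natrX ler_nat.
Qed.

Lemma T0'_le : `|D| * sup3 T0' * sup3 Tt <= 229 * q%:r ^+ 5.
Proof.
have h : dR ^+ 2 * dot T0' T0' * dot Tt Tt <= 229 * 229 * q%:r ^+ 10.
  apply: (T0x_le (hR ha) (hR hb) (hR hc) (hR hf) (hR hg) (hR hh) grad_Tt grad_Tz grad_To Tt_gt0).
have eD : `|D| ^+ 2 = dR ^+ 2.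
  by rewrite dscE nf_disc real_normK ?num_real // rmorphN sqrrN.
have p0 : 0 <= `|D| * sup3 T0' * sup3 Tt by rewrite !mulr_ge0 ?sup3_ge0.
rewrite -[leLHS]ger0_norm //; apply: norm_le_sqr; first by rewrite mulr_ge0 ?exprn_ge0.
have -> : (229 * q%:r ^+ 5) ^+ 2 = 229 * 229 * q%:r ^+ 10 by ring.
rewrite !exprMn eD; apply: le_trans h; apply: ler_pM; [by rewrite mulr_ge0 ?sqr_ge0|exact: sqr_ge0| |exact: sup3_sqr].
by apply: ler_wpM2l; [exact: sqr_ge0|exact: sup3_sqr].
Qed.

Lemma D_le : `|D| <= 8 * q%:r ^+ 3.
Proof.
have -> : `|D| = `|dR| by rewrite dscE nf_disc rmorphN normrN.
exact: (dsc_le (hR ha) (hR hb) (hR hc) (hR hf) (hR hg) (hR hh)).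
Qed.

Lemma D_ge : `|C|%:r <= `|D|.
Proof.
rewrite /D rmorphM normrM -intr_norm ler_peMr ?ler0z //.
rewrite -intr_norm ler1z -gtz0_ge1 normr_gt0.
by move: D_neq0; rewrite /D rmorphM mulf_eq0 negb_or !intr_eq0 => /andP[].
Qed.

Lemma C_neq0 : C != 0.
Proof. by move: D_neq0; rewrite /D rmorphM mulf_eq0 negb_or !intr_eq0 => /andP[]. Qed.

Variable m : R.
Hypothesis m1 : 1 <= m.
Hypothesis Ttm : sup3 Tt = `|C|%:r * m.
Hypothesis minm : forall (s : nat) (t : int), (0 < s)%N -> m <= sup3 (par s%:R t%:r).

(** Dirichlet's theorem gives [s <= S] and [t] with [|t - shiftx s| <= 1 / S], and minimality at
    this point yields [m <= S ^ 2 |T0'| + |T1'| + |C| m / S ^ 2]. With [S ^ 2] between [2 |C|] and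
    [8 |C|] the last term is at most [m / 2]. *)
Lemma m_bound : `|D| * m ^+ 2 <= 8 * 1016 * q%:r ^+ 5.
Proof.
pose c := `|C|%N; have c0 : (0 < c)%N by rewrite absz_gt0 C_neq0.
have [S [S0 S1 S2]] : exists S : nat, [/\ (0 < S)%N, (2 * c <= S ^ 2)%N & (S ^ 2 <= 8 * c)%N].
  have ex : exists S : nat, (2 * c <= S ^ 2)%N by exists (2 * c)%N; nia.
  case: (ex_minnP ex) => S hS minS; exists S.
  have S0 : (0 < S)%N by lia.
  split=> //; have := minS S.-1; case: (leqP (2 * c) (S.-1 ^ 2)) => [h /(_ isT)|]; first lia.
  by move=> h _; have [->|] := eqVneq S 1%N; [lia|nia].
have [s [t [s0 sS st]]] := dirichlet shiftx S0.
have h1 := minm t s0; rewrite par_shift in h1.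
have {h1} := le_trans h1 (sup3_lin _ _ _ _ _ _).
have SR : (0 : R) < S%:R by rewrite ltr0n.
set w := t%:r - _ in st *.
have w1 : `|s%:R ^+ 2| <= S%:R ^+ 2 :> R.
  by rewrite ger0_norm ?sqr_ge0 // -!natrX ler_nat leq_exp2r.
have w2 : `|s%:R * w| <= 1.
  rewrite normrM -[leRHS](mulfV (lt0r_neq0 SR)); apply: ler_pM => //.
  by rewrite normr_nat ler_nat.
have w3 : `|w ^+ 2| <= S%:R ^- 2.
  by rewrite normrX -exprVn ler_pXn2r ?nnegrE ?invr_ge0.
have z0 := sup3_ge0 T0'; have z1 := sup3_ge0 T1'; have z2 := sup3_ge0 Tt.
move=> h; have {h} : m <= S%:R ^+ 2 * sup3 T0' + 1 * sup3 T1' + S%:R ^- 2 * sup3 Tt.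
  by apply: le_trans h _; do 2?[apply: lerD]; apply: ler_wpM2r.
have cR : `|C|%:r = c%:R by rewrite /c -pmulrn natr_absz.
have cp : (0 : R) < c%:R by rewrite ltr0n.
have S2R : S%:R ^+ 2 <= 8 * c%:R :> R by rewrite -natrX -natrM ler_nat.
have S1R : 2 * c%:R <= S%:R ^+ 2 :> R by rewrite -natrX -natrM ler_nat.
have b3 : S%:R ^- 2 * sup3 Tt <= m / 2.
  rewrite Ttm cR mulrC ler_pdivrMr ?exprn_gt0 //.
  have : m * (2 * c%:R) <= m * S%:R ^+ 2 by rewrite ler_wpM2l // (le_trans _ m1).
  lra.
have b1 : S%:R ^+ 2 * sup3 T0' <= 8 * c%:R * sup3 T0' by rewrite ler_wpM2r.
move=> h; have {h b1 b3} : m / 2 <= 8 * (c%:R * sup3 T0') + 5 * q%:r.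
  have := T1'_le; lra.
move=> h; have m0 : 0 < m by apply: lt_le_trans m1.
have Dm : 0 <= `|D| * m by rewrite mulr_ge0 // ltW.
have h2 : `|D| * m * (m / 2) <= `|D| * m * (8 * (c%:R * sup3 T0') + 5 * q%:r).
  by rewrite ler_wpM2l.
have h3 := T0'_le; rewrite Ttm cR in h3.
have h4 := D_le.
have h5 : q%:r ^+ 2 * `|D| <= q%:r ^+ 2 * (8 * q%:r ^+ 3) by rewrite ler_wpM2l ?sqr_ge0.
have e5 : q%:r ^+ 2 * q%:r ^+ 3 = q%:r ^+ 5 by rewrite -exprD.
(* This square bounds [5 q |D| m] by [|D| m ^ 2 / 4 + 25 q ^ 2 |D|]; the total is then
   [4 (8 * 229 + 25 * 8) = 8 * 1016]. *)
have h6 : 0 <= `|D| * (m - 10 * q%:r) ^+ 2 by rewrite mulr_ge0 ?sqr_ge0.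
have : 0 <= q%:r ^+ 5 by rewrite exprn_ge0.
move: h2 h3 h5 h6; rewrite -e5.
have -> : `|D| * m * (8 * (c%:R * sup3 T0') + 5 * q%:r) =
  8 * (`|D| * sup3 T0' * (c%:R * m)) + 5 * (q%:r * `|D| * m) by ring.
move: (`|D| * sup3 T0' * (c%:R * m)) => X.
move: (q%:r ^+ 3) => Y.
lra.
Qed.
End NormalForm.

(** * Choice of the zero and of the integral shift *)

Definition isup (v : int * int * int) : nat := maxn `|v.1.1| (maxn `|v.1.2| `|v.2|).

Lemma sup3_cast (R : archiRealFieldType) v : sup3 (castv R v) = (isup v)%:R.
Proof.
have mx (a b : nat) : Num.max (a%:R : R) b%:R = (maxn a b)%:R.
  rewrite /Num.max ltr_nat /maxn; by case: ifP.
by rewrite /sup3 /isup /castv /= -!intr_norm -!natr_absz -!mx.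
Qed.

Section Choice.
Variable R : archiRealFieldType.
Variables (F : qform int) (q : int).
Hypotheses (ha : `|fa F| <= q) (hb : `|fb F| <= q) (hc : `|fc F| <= q)
  (hf : `|ff F| <= q) (hg : `|fg F| <= q) (hh : `|fh F| <= q).
Hypothesis dF : fdisc F != 0.

Lemma cast_par (s t : int) l d A B C :
  par l d A B C s%:~R t%:~R =
  castv R (act l (- (A * s ^+ 2 + B * s * t + C * t ^+ 2), d * s ^+ 2, d * s * t)).
Proof.
rewrite cast_act /par /castv /=; congr (act l _); congr (_, _, _);
 by rewrite ?rmorphN !(rmorphD, rmorphM, rmorphXn).
Qed.

Lemma ev_par (s t : int) l d A B C :
  (forall v, ev F (act l v) =
    d * v.1.1 * v.1.2 + A * v.1.2 ^+ 2 + B * v.1.2 * v.2 + C * v.2 ^+ 2) ->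
  ev F (act l (- (A * s ^+ 2 + B * s * t + C * t ^+ 2), d * s ^+ 2, d * s * t)) = 0.
Proof. by move=> ->; rewrite /=; ring. Qed.

Lemma act_eq0 l (v : int * int * int) : act l v = (0, 0, 0) -> v = (0, 0, 0).
Proof. by move=> h; rewrite -(actK l v) h act0. Qed.

(** The zero has least norm among nonzero integral zeros, and the points [par s t] with integral
    arguments and [s > 0] are such zeros, so [m_bound] applies. Then [t] is shifted by the integral
    part [n] of the best real shift, which replaces [Tz] by [par 1 n] and keeps [Tt]. *)
Lemma good_parametrization (x0 : int * int * int) : ev F x0 = 0 -> x0 != (0, 0, 0) ->
  exists l d A B C, [/\ 0 < d, C != 0, forall v, ev F (act l v) =
      d * v.1.1 * v.1.2 + A * v.1.2 ^+ 2 + B * v.1.2 * v.2 + C * v.2 ^+ 2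
    & exists H0 : R, [/\ 0 < H0, `|(C * d ^+ 2)%:~R : R| <= 8 * q%:~R ^+ 3,
       `|(C * d ^+ 2)%:~R : R| ^+ 2 * H0 <= 60 * 1000 * q%:~R ^+ 8
     & forall s t : R, s ^+ 2 <= H0 * sup3 (par l d A B C s t) /\
                   t ^+ 2 <= H0 * sup3 (par l d A B C s t)]].
Proof.
move=> Fx0 x00.
pose P n := `[< exists v, [/\ ev F v = 0, v != (0, 0, 0) & isup v = n] >].
have exP : exists n, P n by exists (isup x0); apply/asboolP; exists x0.
case: (ex_minnP exP) => m /asboolP[x1 [Fx1 x10 x1m]] minm.
have {}minm v : ev F v = 0 -> v != (0, 0, 0) -> (m <= isup v)%N.
  by move=> h1 h2; apply: minm; apply/asboolP; exists v.
have [l [g [d [A [B [C [d0 Ex1 nf]]]]]]] := normal_form dF Fx1 x10.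
have C0 : C != 0 := C_neq0 R nf dF.
pose e := act l (1, 0, 0) : int * int * int.
(* The minimal zero is [g e], so the zero [e] is no larger; by minimality it has the same norm. *)
have em : isup e = m.
  have Fe : ev F e = 0 by rewrite nf /=; ring.
  have e0 : e != (0, 0, 0) by apply/eqP => /act_eq0 [].
  have g0 : g != 0 by apply: contraNneq x10 => g0; rewrite Ex1 g0 act0.
  have x1e : x1 = (g * e.1.1, g * e.1.2, g * e.2).
    rewrite Ex1; transitivity (act l (lc3 g 0 0 (1, 0, 0) (1, 0, 0) (1, 0, 0))).
      by rewrite /lc3 /=; congr (act l _); congr (_, _, _); ring.
    by rewrite act_lc3 -/e /lc3; congr (_, _, _); ring.
  apply/eqP; rewrite eqn_leq (minm e) // andbT -x1m x1e /isup /= !abszM.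
  by rewrite -!maxnMr leq_pmull // absz_gt0.
have m0 : (0 < m)%N.
  rewrite -em /isup; have : e != (0, 0, 0) by apply/eqP => /act_eq0 [].
  case: e {em} => [[x y] z] /=; apply: contraNT; rewrite -leqNgt !geq_max.
  by rewrite !leqn0 !absz_eq0 => /and3P[/eqP-> /eqP-> /eqP->].
have m1 : 1 <= (m%:R : R) by rewrite ler1n.
have Ttm : sup3 (Tt R l C) = `|C|%:~R * m%:R.
  have -> : Tt R l C = castv R (- C * e.1.1, - C * e.1.2, - C * e.2).
    rewrite /Tt.
    transitivity (act l (castv R (lc3 (- C) 0 0 (1, 0, 0) (1, 0, 0) (1, 0, 0)))).
      by rewrite /lc3 /castv /= !(mulr0, mulr1, addr0) rmorphN.
    rewrite -cast_act act_lc3 -/e /lc3; congr (castv R _); congr (_, _, _); ring.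
  rewrite sup3_cast /isup /= !abszM -!maxnMr -/(isup e) em natrM natr_absz.
  by rewrite normrN.
have minp (s : nat) (t : int) : (0 < s)%N -> m%:R <= sup3 (par l d A B C (s%:R : R) t%:~R).
  move=> s0; have -> : s%:R = s%:Z%:~R :> R by [].
  rewrite cast_par sup3_cast ler_nat; apply: minm.
    exact: ev_par.
  apply/eqP => /act_eq0 [] _ /eqP; rewrite mulf_eq0 gt_eqF //= sqrf_eq0.
  by move/eqP; lia.
have mb := m_bound ha hb hc hf hg hh nf dF m1 Ttm minp.
pose x := shiftx R l d B C; pose n := Num.floor x.
pose A' := A + B * n + C * n ^+ 2; pose B' := B + 2 * C * n.
pose l' := l ++ [:: S3 0 n].
have actl' (S : comNzRingType) (v : S * S * S) :
    act l' v = act l (v.1.1, v.1.2, v.2 + n%:~R * v.1.2).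
  by rewrite act_cat /= mul0r add0r.
have nf' v : ev F (act l' v) =
    d * v.1.1 * v.1.2 + A' * v.1.2 ^+ 2 + B' * v.1.2 * v.2 + C * v.2 ^+ 2.
  by rewrite actl' nf /A' /B' /= intz; ring.
have par' (s t : R) : par l' d A' B' C s t = par l d A B C s (t + n%:~R * s).
  rewrite /par actl' /A' /B' /=; congr (act l _); congr (_, _, _);
   rewrite ?(rmorphD, rmorphM, rmorphXn) /= ?rmorphXn /=; ring.
exists l', d, A', B', C; split=> //.
pose D : R := (C * d ^+ 2)%:~R.
have DD := D_neq0 R nf dF; rewrite -/D in DD mb.
have qge0 : 0 <= (q%:~R : R) by rewrite ler0z; apply: le_trans ha.
have Dle := D_le R ha hb hc hf hg hh nf; rewrite -/D in Dle.
have Tt' : Tt R l' C = Tt R l C by rewrite /Tt actl' /= mulr0 addr0.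
have Tz' : Tz R l' d A' = par l d A B C (1 : R) n%:~R.
  rewrite -[n%:~R]mulr1 -[X in par _ _ _ _ _ _ X]add0r -par' /par /Tz.
  by congr (act l' _); congr (_, _, _); ring.
pose tz := sup3 (Tz R l' d A'); pose tt := sup3 (Tt R l C).
have tz0 : 0 <= tz := sup3_ge0 _.
have tt1 : 1 <= tt.
  rewrite /tt Ttm; apply: mulr_ege1 => //; rewrite ler1z -gtz0_ge1 normr_gt0 //.
have tzle : tz <= sup3 (T0x (Tz R l d A) (To R l d B) (Tt R l C)) + 5 * q%:~R + tt.
  rewrite /tz Tz' par_shift; apply: le_trans (sup3_lin _ _ _ _ _ _) _.
  have w0 : `|n%:~R - shiftx R l d B C * 1| <= 1.
    rewrite mulr1 -/x; have := floor_le x; have := floorD1_gt x; rewrite -/n intrD.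
    by move=> h1 h2; rewrite ler_norml; apply/andP; split; lra.
  have T1 := T1'_le R ha hb hc hf hg hh nf dF.
  have T10 := sup3_ge0 (T1x (To R l d B) (Tt R l C)).
  rewrite expr1n normr1 !mul1r; apply: lerD; first apply: lerD => //.
    by apply: le_trans T1; rewrite ler_piMl.
  by rewrite -/tt normrX ler_piMl ?exprn_ile1 // (le_trans _ tt1).
have T0 := T0'_le R ha hb hc hf hg hh nf dF; rewrite -/D -/tt in T0.
have nD : 0 < `|D| by rewrite normr_gt0.
(* The bound for [s ^ 2] carries [tt] and the one for [t ^ 2] carries [tz]; the sum serves for
   both. *)
exists (12 * q%:~R * (tz + tt) / `|D|); split.
- rewrite divr_gt0 // mulr_gt0 ?ltr_wpDl // ?(lt_le_trans _ tt1) //.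
  rewrite mulr_gt0 // ltr0z; have := dF; rewrite /fdisc; apply: contraNT; rewrite -leNgt => q0.
  have z (y : int) : `|y| <= q -> y = 0.
    by move=> h; apply/eqP; rewrite -normr_le0 (le_trans h).
  rewrite (z _ ha) (z _ hb) (z _ hc) (z _ hf).
  by apply/eqP; ring.
- exact: Dle.
- rewrite -/D expr2 -mulrA mulrCA mulrC -!mulrA mulVf ?gt_eqF // mulr1.
  have e1 : `|D| * tz <= 229 * q%:~R ^+ 5 + 5 * (q%:~R * `|D|) + `|D| * tt.
    set T := sup3 (T0x _ _ _) in tzle T0.
    have T_0 : 0 <= T := sup3_ge0 _.
    have : `|D| * T <= `|D| * T * tt by rewrite ler_peMr // mulr_ge0.
    have : `|D| * tz <= `|D| * (T + 5 * q%:~R + tt) by rewrite ler_wpM2l.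
    lra.
  have q1 : 1 <= (q%:~R : R).
    rewrite ler1z; case: (ltrP 0 q) => [|q0]; first by rewrite gtz0_ge1.
    have : `|D| <= 0; last by rewrite leNgt nD.
    apply: le_trans Dle _; have -> : q = 0 by apply/le_anti; rewrite q0 -(ler0z R).
    by rewrite expr0n mulr0.
  (* The square is [(|D| |C| ^ 2) (|D| m ^ 2)]. The first factor is at most [(8 q ^ 3) ^ 3], the
     second is bounded by [m_bound], and [512 * 8128 <= 2040 ^ 2]. *)
  have e2 : `|D| * tt <= 2040 * q%:~R ^+ 7.
    rewrite -[leLHS]ger0_norm ?mulr_ge0 ?(le_trans _ tt1) //; apply: norm_le_sqr.
      by rewrite mulr_ge0 ?exprn_ge0.
    rewrite /tt Ttm.
    have -> : (`|D| * (`|C|%:~R * m%:R)) ^+ 2 = (`|D| * `|C|%:~R ^+ 2) * (`|D| * m%:R ^+ 2).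
      by ring.
    have c3 : `|D| * `|C|%:~R ^+ 2 <= (8 * q%:~R ^+ 3) ^+ 3.
      rewrite [X in _ <= X]exprS ler_pM ?exprn_ge0 ?ler0z //.
      rewrite ler_pXn2r ?nnegrE ?ler0z // ?mulr_ge0 ?exprn_ge0 //.
      by apply: le_trans Dle; have := D_ge R nf dF.
    apply: le_trans (ler_pM _ _ c3 mb) _; rewrite ?mulr_ge0 ?exprn_ge0 ?ler0z //.
    have -> : (2040 * q%:~R ^+ 7) ^+ 2 = 2040 * 2040 * q%:~R ^+ 14 :> R by ring.
    have -> : (8 * q%:~R ^+ 3) ^+ 3 * (8 * 1016 * q%:~R ^+ 5) = 512 * 8 * 1016 * q%:~R ^+ 14 :> R by ring.
    rewrite ler_wpM2r ?exprn_ge0 //; lra.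
  have l5 : q%:~R ^+ 5 <= q%:~R ^+ 7 :> R by rewrite ler_weXn2l.
  have l4 : q%:~R ^+ 4 <= q%:~R ^+ 7 :> R by rewrite ler_weXn2l.
  have l8 : q%:~R * q%:~R ^+ 7 = q%:~R ^+ 8 :> R by rewrite -exprS.
  have e3 : q%:~R * `|D| <= 8 * q%:~R ^+ 4.
    have -> : 8 * q%:~R ^+ 4 = q%:~R * (8 * q%:~R ^+ 3) :> R by ring.
    by rewrite ler_wpM2l.
  (* [229 + 5 * 8 + 2 * 2040 <= 5000]. *)
  have e4 : `|D| * (tz + tt) <= 5 * 1000 * q%:~R ^+ 7.
    rewrite mulrDr; move: e1 e2 e3 l4 l5 (exprn_ge0 7 qge0).
    move: (`|D| * tz) (`|D| * tt) (q%:~R * `|D|) (q%:~R ^+ 4) (q%:~R ^+ 5) (q%:~R ^+ 7).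
    by move=> *; lra.
  have : 12 * q%:~R * (`|D| * (tz + tt)) <= 12 * q%:~R * (5 * 1000 * q%:~R ^+ 7).
    by rewrite ler_wpM2l // mulr_ge0.
  rewrite -l8; move: (q%:~R ^+ 7) => Y; lra.
move=> s t; have b1 := par_bound_s ha hb hc hf hg hh nf' s t.
have b2 := par_bound_t ha hb hc hf hg hh nf' s t.
rewrite -/D Tt' -/tz -/tt in b1 b2.
have p0 := sup3_ge0 (par l' d A' B' C s t); set p := sup3 _ in b1 b2 p0 *.
have qp : 0 <= 12 * q%:~R * p by rewrite !mulr_ge0.
have h1 : 0 <= 12 * q%:~R * p * tt by rewrite mulr_ge0 // (le_trans _ tt1).
have h2 : 0 <= 12 * q%:~R * p * tz by rewrite mulr_ge0.
by split; rewrite mulrAC ler_pdivlMr // mulrC; lra.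
Qed.
End Choice.

End Reduction.

From mathcomp Require Import finmap.
From mathcomp Require Import all_classical.

Local Open Scope classical_set_scope.
Local Open Scope ring_scope.

(** * Primitive zeros of the normal form *)

Module Parametrisation.
Import QuadraticForms Reduction.

Definition gcd3 (v : int * int * int) : nat :=
  gcdn `|v.1.1| (gcdn `|v.1.2| `|v.2|).

Lemma dvdn_gcd3 n v : (n %| gcd3 v)%N = [&& (n%:Z %| v.1.1)%Z, (n%:Z %| v.1.2)%Z & (n%:Z %| v.2)%Z].
Proof. by rewrite /gcd3 !dvdn_gcd. Qed.

Lemma gcd3_shear_dvd o v : (gcd3 v %| gcd3 (shear1 o v))%N.
Proof.
have := dvdnn (gcd3 v); rewrite dvdn_gcd3 => /and3P[h1 h2 h3].
rewrite dvdn_gcd3; move: (gcd3 v) h1 h2 h3 => n h1 h2 h3.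
by case: o => a b /=; rewrite ?h1 ?h2 ?h3 ?andbT /= !rpredD // ?dvdz_mull.
Qed.

Lemma gcd3_shear o v : gcd3 (shear1 o v) = gcd3 v.
Proof.
apply/eqP; rewrite eqn_dvd gcd3_shear_dvd andbT -{2}(shear1K o v).
exact: gcd3_shear_dvd.
Qed.

Lemma gcd3_act l v : gcd3 (act l v) = gcd3 v.
Proof. by elim: l => //= o l <-; rewrite gcd3_shear. Qed.

Section Param.
Variables (d A B C : int).
Hypotheses (d0 : 0 < d) (C0 : C != 0).

Definition qq (s t : int) : int := A * s ^+ 2 + B * s * t + C * t ^+ 2.
Definition gg (s t : int) : nat := gcdn `|qq s t| `|(d * s)%R|.
Definition nf (v : int * int * int) : int :=
  d * v.1.1 * v.1.2 + A * v.1.2 ^+ 2 + B * v.1.2 * v.2 + C * v.2 ^+ 2.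
Definition kk (s t : int) : nat := (`|(d * s)%R| %/ gg s t)%N.
(** The vector [(-q, d s ^ 2, d s t)] divided by [gg s t], with the sign of [s]. The sign makes the
    multiplier [kk s t] of [(s, t)] positive, so that a coprime pair [(s, t)] can be read off from
    the last two coordinates. *)
Definition pt (s t : int) : int * int * int :=
  (- (Num.sg s * (qq s t %/ (gg s t)%:Z)%Z), (kk s t)%:Z * s, (kk s t)%:Z * t).

Lemma gg_gt0 s t : s != 0 -> (0 < gg s t)%N.
Proof. by move=> s0; rewrite gcdn_gt0 orbC absz_gt0 mulf_neq0 // gt_eqF. Qed.

Lemma kk_gg s t : (kk s t)%:Z * (gg s t)%:Z = Num.sg s * (d * s).
Proof.
have h : (kk s t * gg s t = `|(d * s)%R|)%N by rewrite divnK // dvdn_gcdr.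
by rewrite -PoszM h abszE normrM gtr0_norm // mulrCA -normrEsg.
Qed.

Lemma qq_gg s t : (qq s t %/ (gg s t)%:Z)%Z * (gg s t)%:Z = qq s t.
Proof. by rewrite divzK // dvdzE /= dvdn_gcdl. Qed.

Lemma pt_scale s t :
  let g := (gg s t)%:Z in
  [/\ g * (pt s t).1.1 = Num.sg s * - qq s t, g * (pt s t).1.2 = Num.sg s * (d * s ^+ 2)
    & g * (pt s t).2 = Num.sg s * (d * s * t)].
Proof.
split=> /=.
- by rewrite -[in RHS](qq_gg s t); ring.
- by rewrite mulrA [_ * (kk s t)%:Z]mulrC kk_gg; ring.
- by rewrite mulrA [_ * (kk s t)%:Z]mulrC kk_gg; ring.
Qed.

Lemma pt_zero s t : s != 0 -> nf (pt s t) = 0.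
Proof.
move=> s0; have g0 : (gg s t)%:Z != 0 by rewrite eqz_nat -lt0n gg_gt0.
have [h1 h2 h3] := pt_scale s t.
apply: (mulfI (mulf_neq0 g0 g0)); rewrite mulr0 /nf.
transitivity (d * ((gg s t)%:Z * (pt s t).1.1) * ((gg s t)%:Z * (pt s t).1.2)
  + A * ((gg s t)%:Z * (pt s t).1.2) ^+ 2
  + B * ((gg s t)%:Z * (pt s t).1.2) * ((gg s t)%:Z * (pt s t).2)
  + C * ((gg s t)%:Z * (pt s t).2) ^+ 2); first by ring.
by rewrite h1 h2 h3 /qq; ring.
Qed.

Lemma kk_gt0 s t : s != 0 -> (0 < kk s t)%N.
Proof.
move=> s0; rewrite divn_gt0 ?gg_gt0 //; apply: dvdn_leq; last exact: dvdn_gcdr.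
by rewrite absz_gt0 mulf_neq0 // gt_eqF.
Qed.

(** For coprime [s], [t] the last two coordinates have gcd [kk s t], that is [|d s| / gg], and the
    first is [qq / gg] up to sign; these quotients are coprime because [gg] is the gcd of [qq] and
    [d s]. *)
Lemma pt_prim s t : s != 0 -> coprime `|s| `|t| -> gcd3 (pt s t) = 1%N.
Proof.
move=> s0 st; rewrite /gcd3 /= !abszM /= -muln_gcdr (eqP st) muln1 abszN.
have -> : (`|(Num.sg s * (qq s t %/ (gg s t)%:Z)%Z)%R| = `|qq s t| %/ gg s t)%N.
  rewrite abszM; have -> : (`|Num.sg s|%N = 1)%N by case: sgrP s0.
  apply/eqP; rewrite mul1n -(eqn_pmul2r (gg_gt0 t s0)) divnK ?dvdn_gcdl //.
  by rewrite -{2}(qq_gg s t) abszM.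
rewrite /kk; have g0 := gg_gt0 t s0; apply/eqP.
rewrite -(eqn_pmul2r g0) muln_gcdl !divnK ?dvdn_gcdl ?dvdn_gcdr //.
by rewrite mul1n /gg.
Qed.

Lemma pt_inj s t s' t' : s != 0 -> s' != 0 -> coprime `|s| `|t| -> coprime `|s'| `|t'| ->
  pt s t = pt s' t' -> (s, t) = (s', t').
Proof.
move=> s0 s0' st st' [_ h2 h3].
have e : kk s t = kk s' t'.
  have : gcdn `|((kk s t)%:Z * s)%R| `|((kk s t)%:Z * t)%R| =
    gcdn `|((kk s' t')%:Z * s')%R| `|((kk s' t')%:Z * t')%R| by rewrite h2 h3.
  by rewrite !abszM /= -!muln_gcdr (eqP st) (eqP st') !muln1.
have k0 : (kk s' t')%:Z != 0 by rewrite eqz_nat -lt0n kk_gt0.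
by rewrite e in h2 h3; congr (_, _); apply: (mulfI k0).
Qed.

(** With [k] the gcd of [y = k s] and [z = k t], the equation becomes [k q(s,t) = - d s x]. As [x]
    is prime to [k], the gcd of [k q] and [k d s] is [|d s|], so [k] equals [kk s t], and the
    equation determines [x]. *)
Lemma pt_surj v : gcd3 v = 1%N -> nf v = 0 -> v.1.2 != 0 ->
  exists s t, [/\ s != 0, coprime `|s| `|t| & v = pt s t].
Proof.
case: v => [[x y] z] /= g1 E y0; rewrite /gcd3 /= in g1.
pose k := gcdn `|y| `|z|.
have k0 : (0 < k)%N by rewrite gcdn_gt0 absz_gt0 y0.
pose s := (y %/ k%:Z)%Z; pose t := (z %/ k%:Z)%Z.
have ys : y = k%:Z * s by rewrite mulrC divzK // dvdzE /= dvdn_gcdl.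
have zt : z = k%:Z * t by rewrite mulrC divzK // dvdzE /= dvdn_gcdr.
have kz0 : k%:Z != 0 by rewrite eqz_nat -lt0n.
have s0 : s != 0 by apply: contraNneq y0 => s0; rewrite ys s0 mulr0.
have st : coprime `|s| `|t|.
  rewrite /coprime -(eqn_pmul2l k0) muln_gcdr muln1.
  by rewrite -[X in (gcdn (X * _) _)]/(`|k%:Z|%N) -[X in (gcdn _ (X * _))]/(`|k%:Z|%N) -!abszM -ys -zt.
have E2 : k%:Z * qq s t = - (d * s * x).
  apply: (mulfI kz0); apply/eqP; rewrite -subr_eq0; apply/eqP.
  by rewrite -[RHS]E /nf /qq ys zt /=; ring.
have kg : (k * gg s t = `|(d * s)%R|)%N.
  rewrite /gg muln_gcdr; have -> : (k * `|qq s t| = `|(d * s)%R| * `|x|)%N.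
    by rewrite -[k]/(`|k%:Z|%N) -!abszM E2 abszN.
  by rewrite [(k * _)%N]mulnC -muln_gcdr g1 muln1.
have g0 := gg_gt0 t s0.
have kE : kk s t = k by rewrite /kk -kg mulnK.
exists s, t; split=> //; rewrite /pt kE -ys -zt; congr (_, _, _).
have gz0 : (gg s t)%:Z != 0 by rewrite eqz_nat -lt0n.
have ds0 : d * s != 0 by rewrite mulf_neq0 // gt_eqF.
apply: (mulfI ds0).
transitivity (- (k%:Z * qq s t)); first by rewrite E2 opprK.
have h := kk_gg s t; rewrite kE in h.
rewrite -{1}(qq_gg s t); move: (qq s t %/ _)%Z => w.
have -> : k%:Z * (w * (gg s t)%:Z) = (k%:Z * (gg s t)%:Z) * w by ring.
by rewrite h; ring.
Qed.

Lemma zero_y0 v : gcd3 v = 1%N -> nf v = 0 -> v.1.2 = 0 -> v = (1, 0, 0) \/ v = (-1, 0, 0).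
Proof.
case: v => [[x y] z] /= g1 E y0; rewrite /nf /= y0 in E.
have z0 : z = 0.
  apply/eqP; have : C * z ^+ 2 == 0 by rewrite -E; apply/eqP; ring.
  by rewrite mulf_eq0 (negbTE C0) /= sqrf_eq0.
have gx : `|x|%N = 1%N.
  by move: g1; rewrite /gcd3 /= y0 z0 (_ : gcdn `|0| `|0| = 0%N) // gcdn0.
rewrite y0 z0; have [->|->] : x = 1 \/ x = -1 by lia.
  by left.
by right.
Qed.

(** Both [d C s ^ 2 = C s (d s)] and [d C t ^ 2 = d q(s,t) - (A s + B t) (d s)] are divisible by
    [gg], and [s ^ 2], [t ^ 2] are coprime. *)
Lemma gg_dvd s t : coprime `|s| `|t| -> (gg s t %| `|(d * C)%R|)%N.
Proof.
move=> st; pose g := gg s t.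
have h1 : (g%:Z %| qq s t)%Z by rewrite dvdzE /= dvdn_gcdl.
have h2 : (g%:Z %| d * s)%Z by rewrite dvdzE /= dvdn_gcdr.
have h3 : (g%:Z %| d * C * t ^+ 2)%Z.
  have -> : d * C * t ^+ 2 = d * qq s t - (A * s + B * t) * (d * s) by rewrite /qq; ring.
  by rewrite rpredB // dvdz_mull.
have h4 : (g%:Z %| d * C * s ^+ 2)%Z.
  have -> : d * C * s ^+ 2 = C * s * (d * s) by ring.
  by rewrite dvdz_mull.
have : (g %| gcdn `|(d * C * s ^+ 2)%R| `|(d * C * t ^+ 2)%R|)%N by rewrite dvdn_gcd; apply/andP.
rewrite [X in gcdn X _]abszM [X in gcdn _ X]abszM -muln_gcdr !abszX.
have -> : gcdn (`|s| ^ 2) (`|t| ^ 2) = 1%N by apply/eqP; rewrite -/(coprime _ _) coprimeXl // coprimeXr.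
by rewrite muln1.
Qed.
End Param.

Definition zr (L : nat) : seq int := [seq (i%:Z - L%:Z) | i <- iota 0 (2 * L).+1].
Arguments zr : simpl never.

Lemma mem_zr L (s : int) : (s \in zr L) = (`|s| <= L)%N.
Proof.
apply/mapP/idP => [[i]|h].
  by rewrite mem_iota add0n => h ->; lia.
by exists `|(s + L%:Z)%R|%N; rewrite ?mem_iota; lia.
Qed.

Lemma zr_uniq L : uniq (zr L).
Proof. by rewrite map_inj_uniq ?iota_uniq // => i j; lia. Qed.

Lemma card_box (b : int -> int -> bool) L :
  (forall s t, b s t -> (`|s| <= L)%N /\ (`|t| <= L)%N) ->
  finite_set [set p : int * int | b p.1 p.2] /\
  #|` fset_set [set p : int * int | b p.1 p.2]| = (\sum_(s <- zr L) \sum_(t <- zr L) b s t)%N.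
Proof.
move=> hb; pose sq := [seq p <- [seq (s, t) | s <- zr L, t <- zr L] | b p.1 p.2].
have memsq s t : ((s, t) \in sq) = b s t.
  rewrite /sq mem_filter andbC; case: (boolP (_ \in _)) => //= hn.
  apply/esym; apply: contraNF hn => h; have [h1 h2] := hb _ _ h.
  have hs : s \in zr L by rewrite mem_zr.
  have ht : t \in zr L by rewrite mem_zr.
  by have := allpairs_f pair hs ht.
have E : [set p : int * int | b p.1 p.2] = [set` [fset x in sq]%fset].
  apply/seteqP; split=> -[s t] /= h; first by rewrite in_fset memsq.
  by move: h; rewrite in_fset memsq.
split; first by rewrite E; exact: finite_fset.
rewrite E set_fsetK card_fseq undup_id; last first.
  apply: filter_uniq; apply: allpairs_uniq; rewrite ?zr_uniq //.
  by move=> [x y] [x' y'].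
rewrite size_filter -sum1_count big_mkcond big_flatten big_map.
by apply: eq_bigr => s _; rewrite big_map; apply: eq_bigr => t _ /=; case: (b s t).
Qed.

End Parametrisation.

From mathcomp Require Import all_reals all_analysis.
From mathcomp Require Import measurable_realfun.
Require Import Defs.

Import numFieldNormedType.Exports.
Import QuadraticForms Reduction Parametrisation.
Local Open Scope classical_set_scope.
Local Open Scope ring_scope.

(** * Affine substitutions and iterated integrals *)

Section Affine.
Variable R : realType.
Notation mu := (@lebesgue_measure R).
Local Open Scope ereal_scope.

Lemma measurable_affine (a b : R) : measurable_fun setT (fun x : R => (a * x + b)%R).
Proof. by apply: measurable_realfun.measurable_funD => //; apply: measurable_funM. Qed.

(** The right side is a measure in [A], a scaled pushforward, so uniqueness of Lebesgue measure
    reduces the claim to half-open intervals. For [a < 0] the preimage is closed at the other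
    end. *)
Lemma lebesgue_affine (a b : R) (A : set R) : a != 0%R -> measurable A ->
  mu A = `|a|%:E * mu ((fun x => a * x + b)%R @^-1` A).
Proof.
move=> a0 mA.
pose nu0 : {measure set (measurableTypeR R) -> \bar R} :=
  measure_function_pushforward__canonical__measure_function_Measure mu
      (measurable_affine a b : measurable_fun [set: measurableTypeR R]
        (fun x : measurableTypeR R => (a * x + b)%R : measurableTypeR R)).
pose nu : {measure set (measurableTypeR R) -> \bar R} :=
  mscale (NngNum (normr_ge0 a)) nu0.
rewrite (@lebesgue_measure_unique R nu) //.
move=> X /ocitvP[->|[[l r] /= lr ->]]; first by rewrite !measure0.
rewrite /nu /= /mscale /= /pushforward lebesgue_measure_itv /= lte_fin lr.
have [a_gt0|a_le0] := ltP 0%R a.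
  rewrite (_ : _ @^-1` _ = [set` `](l - b) / a, (r - b) / a]%R]%classic); last first.
    apply/seteqP; split=> x /=; rewrite !in_itv /= ltr_pdivrMr // ler_pdivlMr //;
    move=> /andP[h1 h2]; apply/andP; split; lra.
  rewrite lebesgue_measure_itv /= lte_fin ltr_pM2r ?invr_gt0 // ltrD2r lr.
  by rewrite -!EFinB -EFinM gtr0_norm //; congr EFin; field; rewrite gt_eqF.
have {a0 a_le0} a_lt0 : (a < 0)%R by rewrite lt_neqAle a0.
rewrite (_ : _ @^-1` _ = [set` `[(r - b) / a, (l - b) / a[%R]%classic); last first.
  apply/seteqP; split=> x /=; rewrite !in_itv /= ltr_ndivlMr // ler_ndivrMr //;
  move=> /andP[h1 h2]; apply/andP; split; lra.
rewrite lebesgue_measure_itv /= lte_fin ltr_nM2r ?invr_lt0 // ltrD2r lr.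
by rewrite -!EFinB -EFinM ltr0_norm //; congr EFin; field; rewrite lt_eqF.
Qed.

Lemma integral_affine (a b : R) (f : R -> \bar R) : a != 0%R ->
  measurable_fun setT f -> (forall x, 0 <= f x) ->
  \int[mu]_x f x = `|a|%:E * \int[mu]_x f (a * x + b)%R.
Proof.
move=> a0 mf f0.
pose nu0 : {measure set (measurableTypeR R) -> \bar R} :=
  measure_function_pushforward__canonical__measure_function_Measure mu
      (measurable_affine a b : measurable_fun [set: measurableTypeR R]
        (fun x : measurableTypeR R => (a * x + b)%R : measurableTypeR R)).
pose nu : {measure set (measurableTypeR R) -> \bar R} :=
  mscale (NngNum (normr_ge0 a)) nu0.
transitivity (\int[nu]_x f x).
  by apply: eq_measure_integral => A mA _; exact: lebesgue_affine.
rewrite ge0_integral_mscale //=; congr (_ * _).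
exact: (@ge0_integral_pushforward _ _ (measurableTypeR R) (measurableTypeR R) R
  (fun x => (a * x + b)%R) (measurable_affine a b) mu setT f).
Qed.
End Affine.

Section BoolIndicator.
Variables (d : measure_display) (T : measurableType d) (R : realType).
Local Open Scope ereal_scope.

Lemma measurable_boolR (D : set T) (b : T -> bool) : measurable_fun D b ->
  measurable_fun D (fun x => (b x)%:R : R).
Proof.
move=> mb; have -> : (fun x => (b x)%:R : R) = (fun x => if b x then 1 else 0)%R.
  by apply/funext => x; case: (b x).
move=> mD; apply: measurable_fun_if => //; exact: mb.
Qed.

Lemma measurable_boolE (D : set T) (b : T -> bool) : measurable_fun D b ->
  measurable_fun D (fun x => (b x)%:R%:E : \bar R).
Proof. by move=> mb; apply/measurable_EFinP; exact: measurable_boolR. Qed.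

Lemma measurable_boolset (b : T -> bool) : measurable_fun setT b ->
  measurable [set x | b x].
Proof.
by move=> mb; have := @mb measurableT [set true] I; rewrite setTI.
Qed.

Lemma integral_bool (mu : {measure set T -> \bar R}) (b : T -> bool) :
  measurable_fun setT b ->
  \int[mu]_x (b x)%:R%:E = mu [set x | b x].
Proof.
move=> mb; rewrite -[X in _ = mu X]setIT -integral_indic //; last exact: measurable_boolset.
apply: eq_integral => x _; rewrite indicE.
by have -> : (x \in [set x | b x]) = b x by apply/idP/idP; rewrite inE.
Qed.
End BoolIndicator.

Section Iterated.
Variable R : realType.
Local Open Scope ereal_scope.
Notation RM := (measurableTypeR R).

Definition leb1 : {sigma_finite_measure set RM -> \bar R} := @lebesgue_measure R.
Notation mu := leb1.

Definition leb2_fun : set (RM * RM)%type -> \bar R := product_measure1 leb1 leb1.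
HB.instance Definition _ := Measure.copy leb2_fun
  (lebesgue_integral_fubini_product_measure1__canonical__measure_function_Measure
    leb1 leb1).

(* The canonical sigma-finite structure of a product measure is shadowed in the
   library by that of a product of subprobabilities, hence this instance. *)
Lemma leb2_sigma_finite : sigma_finite setT leb2_fun.
Proof.
by case: (lebesgue_integral_fubini.measure_function_Measure_isSigmaFinite__to__measure_function_isSigmaFinite leb1 leb1).
Qed.
HB.instance Definition _ := Measure_isSigmaFinite.Build _ _ _ leb2_fun leb2_sigma_finite.

Definition leb2 : {sigma_finite_measure set (RM * RM)%type -> \bar R} := leb2_fun.

Lemma tonelli2 (f : R * R -> \bar R) : measurable_fun setT f -> (forall t, 0 <= f t) ->
  \int[leb2]_t f t = \int[mu]_x \int[mu]_y f (x, y).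
Proof. by move=> mf f0; exact: (@fubini_tonelli1 _ _ _ _ R leb1 leb1 f mf f0). Qed.

Lemma tonelliC (f : R * R -> \bar R) : measurable_fun setT f -> (forall t, 0 <= f t) ->
  \int[mu]_x \int[mu]_y f (x, y) = \int[mu]_y \int[mu]_x f (x, y).
Proof. by move=> mf f0; exact: (@fubini_tonelli _ _ _ _ R leb1 leb1 f mf f0). Qed.

Lemma measurable_tonelli1 (f : R * R -> \bar R) : measurable_fun setT f ->
  (forall t, 0 <= f t) -> measurable_fun setT (fun x => \int[mu]_y f (x, y)).
Proof.
by move=> mf f0; exact: (@measurable_fun_fubini_tonelli_F _ _ _ _ R leb1 f mf f0).
Qed.

Implicit Types h : R * (R * R) -> \bar R.

Lemma tonelli3 h : measurable_fun setT h -> (forall t, 0 <= h t) ->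
  \int[mu]_x \int[leb2]_p h (x, p) = \int[leb2]_p \int[mu]_x h (x, p).
Proof. by move=> mh h0; exact: (@fubini_tonelli _ _ _ _ R leb1 leb2 h mh h0). Qed.

(** On this iterated integral a shear acts as a translation of one variable, once Tonelli has moved
    that variable to the innermost place. *)
Definition I3 h := \int[mu]_x \int[mu]_y \int[mu]_z h (x, (y, z)).

Lemma measurable_section h x : measurable_fun setT h ->
  measurable_fun setT (fun p : R * R => h (x, p)).
Proof. by move=> mh; apply: (measurableT_comp mh); apply: measurable_fun_pair. Qed.

Lemma I3E h : measurable_fun setT h -> (forall t, 0 <= h t) ->
  I3 h = \int[mu]_x \int[leb2]_p h (x, p).
Proof.
by move=> mh h0; apply: eq_integral => x _; rewrite tonelli2 //; exact: measurable_section.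
Qed.

Lemma integral_shift (f : R -> \bar R) (c : R) : measurable_fun setT f ->
  (forall x, 0 <= f x) -> \int[mu]_x f (x + c)%R = \int[mu]_x f x.
Proof.
move=> mf f0; rewrite [RHS](@integral_affine R 1 c) ?oner_neq0 // normr1 mul1e.
by apply: eq_integral => x _; rewrite mul1r.
Qed.

Lemma I3_shift3 h (a b : R) : measurable_fun setT h -> (forall t, 0 <= h t) ->
  I3 (fun t => h (t.1, (t.2.1, t.2.2 + (a * t.1 + b * t.2.1)))%R) = I3 h.
Proof.
move=> mh h0; apply: eq_integral => x _; apply: eq_integral => y _ /=.
rewrite (@integral_shift (fun z => h (x, (y, z)))) //.
by apply: (measurableT_comp mh); apply: measurable_fun_pair.
Qed.

Lemma I3_shift2 h (a b : R) : measurable_fun setT h -> (forall t, 0 <= h t) ->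
  I3 (fun t => h (t.1, (t.2.1 + (a * t.1 + b * t.2.2), t.2.2))%R) = I3 h.
Proof.
move=> mh h0; apply: eq_integral => x _ /=.
have m1 : measurable_fun setT (fun p : R * R => h (x, (p.1, p.2))).
  apply: (measurableT_comp mh); apply: measurable_fun_pair => //.
  by apply: measurable_fun_pair.
have m2 : measurable_fun setT (fun p : R * R => h (x, (p.1 + (a * x + b * p.2), p.2))%R).
  apply: (measurableT_comp mh); apply: measurable_fun_pair => //.
  apply: measurable_fun_pair => //; apply: measurable_funD => //.
  by apply: measurable_funD => //; apply: measurable_funM.
rewrite (tonelliC m2) // (tonelliC m1) //=.
apply: eq_integral => z _.
rewrite (@integral_shift (fun y => h (x, (y, z)))) //.
by apply: (measurableT_comp mh); apply: measurable_fun_pair => //; apply: measurable_fun_pair.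
Qed.

Lemma I3_shift1 h (a b : R) : measurable_fun setT h -> (forall t, 0 <= h t) ->
  I3 (fun t => h (t.1 + (a * t.2.1 + b * t.2.2), t.2)%R) = I3 h.
Proof.
move=> mh h0.
have m2 : measurable_fun setT (fun t : (R * (R * R))%type => h (t.1 + (a * t.2.1 + b * t.2.2), t.2)%R).
  apply: (measurableT_comp mh); apply: measurable_fun_pair => //.
  apply: measurable_funD => //; apply: measurable_funD; apply: measurable_funM => //;
  exact: measurableT_comp.
rewrite !I3E // (tonelli3 m2) // (tonelli3 mh) //.
apply: eq_integral => p _ /=.
rewrite (@integral_shift (fun x => h (x, p))) //.
by apply: (measurableT_comp mh); apply: measurable_fun_pair.
Qed.
End Iterated.

Lemma int_seq_min (r : seq int) : r != [::] -> exists2 m, m \in r & forall x, x \in r -> m <= x.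
Proof.
elim: r => // a [|b r] IH _; first by exists a => [|x]; rewrite inE // => /eqP->.
have [m mr hm] := IH isT; have [am|ma] := lerP a m.
  exists a => [|x]; first exact: mem_head.
  by rewrite inE => /orP[/eqP-> //|/hm]; apply: le_trans.
exists m => [|x]; first by rewrite inE mr orbT.
by rewrite inE => /orP[/eqP->|/hm //]; apply: ltW.
Qed.

Lemma int_seq_max (r : seq int) : r != [::] -> exists2 m, m \in r & forall x, x \in r -> x <= m.
Proof.
move=> r0; have [|m] := @int_seq_min (map -%R r); first by case: r r0.
move=> /mapP[k kr ->] hk; exists k => // x xr.
by rewrite -lerN2; apply: hk; apply: map_f.
Qed.

(** * Terms of an arithmetic progression in subsets of the line *)

Section OneDim.
Variable R : realType.
Notation mu := (@leb1 R).
Variables (L h : nat) (s0 : int) (D : R).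
Hypotheses (h0 : (0 < h)%N) (D0 : 0 <= D) (DL : D <= L%:R).

Definition box : set R := [set x | `|x| <= D].
(** [zr L] makes the sum finite; as [D <= L] it loses no integer of the box. *)
Definition cnt (E : set R) : R :=
  \sum_(s <- zr L) ((h%:Z %| s - s0)%Z && ((s%:~R : R) \in E))%:R.
Definition len (E : set R) : R := fine (mu E).

Lemma boxE : box = [set` `[- D, D]].
Proof. by apply/seteqP; split=> x; rewrite /box /= in_itv /= ler_norml. Qed.

Lemma mbox : measurable box. Proof. by rewrite boxE; apply: measurable_itv. Qed.

Lemma mu_itvcc (a b : R) : a <= b -> mu [set` `[a, b]] = (b - a)%:E.
Proof.
move=> ab; rewrite /leb1 /= lebesgue_measure_itv /= lte_fin.
by have [|ba] := ltP a b; [|have -> : a = b by apply/le_anti/andP]; rewrite ?subrr // EFinB.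
Qed.

Lemma mu_box : mu box = (2 * D)%:E.
Proof.
have DD : - D <= D by move: D0; lra.
by rewrite boxE mu_itvcc //; congr EFin; ring.
Qed.

Lemma mu_fin E : measurable E -> E `<=` box -> mu E \is a fin_num.
Proof.
move=> mE EB; rewrite ge0_fin_numE //; apply: le_lt_trans (_ : _ <= mu box)%E _.
  by apply: le_measure; rewrite ?inE //; exact: mbox.
by rewrite mu_box ltry.
Qed.

Lemma lenK E : measurable E -> E `<=` box -> (len E)%:E = mu E.
Proof. by move=> mE EB; rewrite /len fineK // mu_fin. Qed.

Lemma len_ge0 E : 0 <= len E.
Proof. by rewrite /len fine_ge0. Qed.

Lemma len_le E E' : measurable E -> measurable E' -> E' `<=` box -> E `<=` E' -> len E <= len E'.
Proof.
move=> mE mE' B EE'; rewrite -lee_fin !lenK //; last exact: subset_trans EE' B.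
by apply: le_measure; rewrite ?inE.
Qed.

Lemma interval_mu_le (I : set R) (a b : R) : measurable I -> I `<=` box -> a <= b ->
  (forall x, I x -> a <= x <= b) -> len I <= b - a.
Proof.
move=> mI IB ab H; rewrite -lee_fin lenK // -mu_itvcc //.
apply: le_measure; rewrite ?inE //.
all: try exact: measurable_itv.
all: by move=> x /H; rewrite /= in_itv.
Qed.

Lemma interval_mu_ge (I : set R) (a b : R) : measurable I -> I `<=` box -> a <= b ->
  (forall x, a <= x <= b -> I x) -> b - a <= len I.
Proof.
move=> mI IB ab H; rewrite -lee_fin lenK // -mu_itvcc //.
apply: le_measure; rewrite ?inE //.
all: try exact: measurable_itv.
all: by move=> x /=; rewrite in_itv => /H.
Qed.

(** An interval that misses the progression lies between two neighbouring terms. Otherwise it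
    contains exactly [n + 1] consecutive terms, so its length is at least [n h] and at most the
    distance [(n + 2) h] between the two terms just outside. *)
Lemma interval_count (I : set R) : is_interval I -> I `<=` box ->
  `|cnt I - len I / h%:R| <= 1.
Proof.
move=> itvI IB; have mI : measurable I by apply: is_interval_measurable.
pose P (s : int) := (h%:Z %| s - s0)%Z && ((s%:~R : R) \in I).
have PL s : P s -> s \in zr L.
  move=> /andP[_]; rewrite inE => /IB; rewrite /box /= mem_zr => hs.
  by rewrite -(ler_nat R) natr_absz intr_norm (le_trans hs).
have hR : (0 : R) < h%:R by rewrite ltr0n.
have cntE : cnt I = (size [seq s <- zr L | P s])%:R.
  rewrite /cnt size_filter -sum1_count natr_sum [RHS]big_mkcond /=.
  by apply: eq_bigr => s _; rewrite /P; case: ifP.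
have notin (s : int) : (h%:Z %| s - s0)%Z -> s \notin [seq s <- zr L | P s] -> ~ I s%:~R.
  move=> hs; apply: contraNnot => Is; rewrite mem_filter.
  have Ps : P s by rewrite /P hs inE.
  by rewrite Ps PL.
have out (s : int) x y : I x -> ~ I s%:~R -> s%:~R <= x -> I y -> s%:~R <= y.
  move=> Ix Is sx Iy; rewrite leNgt; apply/negP => ys; apply: Is.
  by apply: (itvI y x) => //; rewrite (ltW ys).
have out' (s : int) x y : I x -> ~ I s%:~R -> x <= s%:~R -> I y -> y <= s%:~R.
  move=> Ix Is sx Iy; rewrite leNgt; apply/negP => ys; apply: Is.
  by apply: (itvI x y) => //; rewrite (ltW ys) sx.
case: (eqVneq [seq s <- zr L | P s] [::]) => [S0|S0].
  rewrite cntE S0 /= sub0r normrN ger0_norm ?divr_ge0 ?len_ge0 // ler_pdivrMr // mul1r.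
  have [->|/set0P[x Ix]] := eqVneq I set0; first by rewrite /len measure0.
  pose m := Num.floor ((x - s0%:~R) / h%:R); pose s := s0 + h%:Z * m.
  have sx : s%:~R <= x.
    rewrite intrD intrM -lerBrDl mulrC -ler_pdivlMr //; exact: floor_le.
  have xs : x <= (s + h%:Z)%:~R.
    have := floorD1_gt ((x - s0%:~R) / h%:R); rewrite ltr_pdivrMr // -/m => /ltW h1.
    rewrite lerBlDr in h1; apply: le_trans h1 _; rewrite le_eqVlt; apply/orP; left; apply/eqP.
    by rewrite /s !(intrD, intrM) /=; ring.
  have d1 : (h%:Z %| s - s0)%Z by rewrite /s addrAC subrr add0r dvdz_mulr.
  have d2 : (h%:Z %| s + h%:Z - s0)%Z by rewrite addrAC rpredD // dvdzz.
  have n1 := notin _ d1; have n2 := notin _ d2; rewrite S0 /= in n1 n2.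
  have {}n1 := n1 isT; have {}n2 := n2 isT.
  have -> : h%:R = (s + h%:Z)%:~R - s%:~R :> R by rewrite intrD addrC addKr.
  apply: interval_mu_le => //; first by rewrite ler_int lerDl.
  move=> y Iy; apply/andP; split; first exact: (out s x).
  exact: (out' (s + h%:Z) x).
have [s1 s1P min1] := int_seq_min S0; have [s2 s2P max2] := int_seq_max S0.
have /andP[/andP[d1 I1] _] : P s1 && (s1 \in zr L) by rewrite -mem_filter.
have /andP[/andP[d2 I2] _] : P s2 && (s2 \in zr L) by rewrite -mem_filter.
rewrite !inE in I1 I2.
have s12 := min1 _ s2P.
have /dvdzP[n0 n0E] : (h%:Z %| s2 - s1)%Z.
  have -> : s2 - s1 = (s2 - s0) - (s1 - s0) by ring.
  by rewrite rpredB.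
have [n nE] : exists n : nat, n0 = n%:Z.
  exists `|n0|%N; rewrite gez0_abs //.
  have : 0 <= n0 * h%:Z by rewrite -n0E subr_ge0.
  by rewrite pmulr_lge0.
rewrite nE in n0E.
have szE : size [seq s <- zr L | P s] = n.+1.
  rewrite -(size_iota 0 n.+1) -(size_map (fun i : nat => s1 + h%:Z * i%:Z)).
  apply/perm_size/uniq_perm.
  - by rewrite filter_uniq // zr_uniq.
  - by rewrite map_inj_uniq ?iota_uniq // => i j; nia.
  move=> s; apply/idP/mapP.
    move=> sP; have := sP; rewrite mem_filter => /andP[/andP[ds _] _].
    have /dvdzP[k kE] : (h%:Z %| s - s1)%Z.
      have -> : s - s1 = (s - s0) - (s1 - s0) by ring.
      by rewrite rpredB.
    have := min1 _ sP; have := max2 _ sP => hs2 hs1.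
    by exists `|k|%N; rewrite ?mem_iota; nia.
  move=> [i]; rewrite mem_iota add0n => hi ->.
  have Pi : P (s1 + h%:Z * i%:Z).
    apply/andP; split.
      by rewrite addrAC rpredD // dvdz_mulr.
    rewrite inE; apply: (itvI s1%:~R s2%:~R) => //.
    by rewrite !ler_int; apply/andP; split; nia.
  by rewrite mem_filter Pi PL.
have dm : (h%:Z %| s1 - h%:Z - s0)%Z by rewrite addrAC rpredB // dvdzz.
have dp : (h%:Z %| s2 + h%:Z - s0)%Z by rewrite addrAC rpredD // dvdzz.
have nm : ~ I (s1 - h%:Z)%:~R by apply: (notin _ dm); apply/negP => /min1; lia.
have np : ~ I (s2 + h%:Z)%:~R by apply: (notin _ dp); apply/negP => /max2; lia.
have e12 : s2%:~R = s1%:~R + n%:R * h%:R :> R.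
  have -> : s2 = s1 + n%:Z * h%:Z by rewrite -n0E; ring.
  by rewrite intrD intrM.
have u1 : len I <= (s2 + h%:Z)%:~R - (s1 - h%:Z)%:~R.
  apply: interval_mu_le => //; first by rewrite ler_int; lia.
  move=> y Iy; apply/andP; split.
    by apply: (out _ s1%:~R) => //; rewrite ler_int; lia.
  by apply: (out' _ s1%:~R) => //; rewrite ler_int; lia.
have u2 : s2%:~R - s1%:~R <= len I.
  by apply: interval_mu_ge => // [|x xx]; [rewrite ler_int|apply: (itvI s1%:~R s2%:~R)].
have v1 : len I / h%:R <= n%:R + 2.
  rewrite ler_pdivrMr //; apply: le_trans u1 _; rewrite intrD intrB e12 /=.
  by rewrite le_eqVlt; apply/orP; left; apply/eqP; ring.
have v2 : n%:R <= len I / h%:R.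
  by rewrite ler_pdivlMr //; apply: le_trans u2; rewrite e12; lra.
by rewrite cntE szE -natr1 ler_norml; apply/andP; split; lra.
Qed.

(** The bound is asked of the trace of [E] on every interval of the box, so that it survives
    intersection with a further difference of intervals. *)
Definition discrepancy (n : R) (E : set R) := measurable E /\
  forall K, is_interval K -> K `<=` box -> `|cnt (E `&` K) - len (E `&` K) / h%:R| <= n.

Lemma is_intervalI (I J : set R) : is_interval I -> is_interval J -> is_interval (I `&` J).
Proof.
move=> hI hJ x y [Ix Jx] [Iy Jy] z xzy.
by split; [exact: (hI x y)|exact: (hJ x y)].
Qed.

Lemma discrepancyT : discrepancy 1 setT.
Proof. by split=> // K iK KB; rewrite setTI; exact: interval_count. Qed.

(** On an interval [K] the new set is the trace of [E] on the meet of [I] and [K], minus its trace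
    on the meet of [J] and [K]; the two errors add. *)
Lemma discrepancy_step n E I J : discrepancy n E -> is_interval I -> is_interval J ->
  J `<=` I -> discrepancy (2 * n) (E `&` (I `\` J)).
Proof.
move=> [mE dE] iI iJ JI.
have mI : measurable I by apply: is_interval_measurable.
have mJ : measurable J by apply: is_interval_measurable.
split; first by apply: measurableI => //; apply: measurableD.
move=> K iK KB; have mK : measurable K by apply: is_interval_measurable.
set U := E `&` (I `&` K); set V := E `&` (J `&` K).
have VU : V `<=` U by move=> x [Ex [Jx Kx]]; split=> //; split=> //; exact: JI.
have EUV : E `&` (I `\` J) `&` K = U `\` V.
  apply/seteqP; split=> x.
    by move=> [[Ex [Ix nJ]] Kx]; split=> // -[_ []].
  move=> [[Ex [Ix Kx]] nV]; split=> //; split=> //; split=> // Jx; exact: nV.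
have mU : measurable U by do 2?apply: measurableI.
have mV : measurable V by do 2?apply: measurableI.
have UB : U `<=` box by move=> x [_ [_ /KB]].
have VB : V `<=` box by apply: subset_trans VU UB.
have hU := dE _ (is_intervalI iI iK) (fun x Kx => KB x Kx.2).
have hV := dE _ (is_intervalI iJ iK) (fun x Kx => KB x Kx.2).
rewrite -/U in hU; rewrite -/V in hV.
have -> : cnt (E `&` (I `\` J) `&` K) = cnt U - cnt V.
  rewrite EUV /cnt -sumrB; apply: eq_bigr => s _.
  case: (_ %| _)%Z => /=; last by rewrite subrr.
  have [sV|sV] := boolP ((s%:~R : R) \in V).
    have sU : (s%:~R : R) \in U by move: sV; rewrite !inE => /VU.
    by rewrite sU subrr; case: (boolP (_ \in _)) => //; rewrite !inE in sV * => -[].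
  rewrite subr0; congr (nat_of_bool _)%:R.
  apply/idP/idP; rewrite !inE; first by case.
  by move=> sU; split=> // sV'; move/negP: sV; apply; rewrite inE.
have -> : len (E `&` (I `\` J) `&` K) = len U - len V.
  rewrite EUV; apply: EFin_inj; rewrite EFinB !lenK //; first last.
  - by move=> x [/UB].
  - exact: measurableD.
  rewrite measureD //; last by rewrite -ge0_fin_numE ?mu_fin.
  by rewrite setIidr.
rewrite mulrBl; move: hU hV; rewrite !ler_norml => /andP[? ?] /andP[? ?]; apply/andP.
by split; lra.
Qed.
End OneDim.

(** * Sets where a quadratic polynomial is bounded *)

Section Quad.
Variable R : realType.

Lemma quad_convex (a b c X x y z : R) : 0 <= a -> x <= z <= y ->
  a * x ^+ 2 + b * x + c <= X -> a * y ^+ 2 + b * y + c <= X ->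
  a * z ^+ 2 + b * z + c <= X.
Proof.
move=> a0 /andP[xz zy] hx hy; have [xy|xy] := ltP x y; last first.
  have -> // : z = x by apply/le_anti; rewrite xz andbT (le_trans zy).
rewrite -(ler_pM2l (_ : 0 < y - x)) ?subr_gt0 //.
have h1 : (y - z) * (a * x ^+ 2 + b * x + c) <= (y - z) * X by rewrite ler_wpM2l ?subr_ge0.
have h2 : (z - x) * (a * y ^+ 2 + b * y + c) <= (z - x) * X by rewrite ler_wpM2l ?subr_ge0.
have h3 : 0 <= a * ((y - x) * ((z - x) * (y - z))) by rewrite !mulr_ge0 ?subr_ge0 // ltW.
lra.
Qed.

Lemma quad_convex_lt (a b c X x y z : R) : 0 <= a -> x <= z <= y ->
  a * x ^+ 2 + b * x + c < X -> a * y ^+ 2 + b * y + c < X ->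
  a * z ^+ 2 + b * z + c < X.
Proof.
move=> a0 xzy hx hy; pose Y := Num.max (a * x ^+ 2 + b * x + c) (a * y ^+ 2 + b * y + c).
apply: le_lt_trans (_ : Y < X); last by rewrite gt_max hx hy.
by apply: quad_convex xzy _ _ => //; rewrite le_max lexx ?orbT.
Qed.

(** Up to a change of sign the polynomial is convex, so the set where it is at most [X] and the set
    where it is below [- X] are intervals. *)
Lemma quad_set (a b c X : R) : exists I J : set R, [/\ is_interval I, is_interval J, J `<=` I
  & [set t | `|a * t ^+ 2 + b * t + c| <= X] = I `\` J].
Proof.
wlog a0 : a b c / 0 <= a => [H|].
  have [a0|a0] := leP 0 a; first exact: H.
  have [|I [J [iI iJ JI E]]] := H (- a) (- b) (- c); first by rewrite oppr_ge0 ltW.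
  exists I, J; split=> //; rewrite -E.
  have e t : - a * t ^+ 2 + - b * t - c = - (a * t ^+ 2 + b * t + c) by ring.
  by apply/seteqP; split=> t /=; rewrite e normrN.
have [X0|X0] := leP 0 X; last first.
  exists set0, set0; split=> //; rewrite set0D; apply/seteqP; split=> t //= h.
  by have := le_lt_trans h X0; rewrite normr_lt0.
exists [set t | a * t ^+ 2 + b * t + c <= X], [set t | a * t ^+ 2 + b * t + c < - X]; split.
- by move=> x y /= hx hy z xzy; apply: quad_convex xzy _ _.
- by move=> x y /= hx hy z xzy; apply: quad_convex_lt xzy _ _.
- by move=> t /= /ltW h; apply: le_trans h _; lra.
apply/seteqP; split=> t /=.
  by rewrite ler_norml => /andP[h1 h2]; split=> //; apply/negP; rewrite -leNgt.
by move=> [h1 /negP]; rewrite -leNgt ler_norml => h2; rewrite h2.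
Qed.
End Quad.

(** * Lattice points of a planar region cut out by three binary quadratic forms *)

Section TwoDim.
Variable R : realType.
Notation mu := (@leb1 R).
Variables (c0 c1 c2 : R * R * R) (X D : R).
Definition qf (c : R * R * R) (s t : R) : R := c.1.1 * s ^+ 2 + c.1.2 * s * t + c.2 * t ^+ 2.
Definition reg (s t : R) : bool := [&& `|qf c0 s t| <= X, `|qf c1 s t| <= X & `|qf c2 s t| <= X].
Hypothesis D0 : 0 <= D.
Hypothesis regbox : forall s t, reg s t -> `|s| <= D /\ `|t| <= D.
Variables (L h : nat) (s0 t0 : int).
Hypotheses (h0 : (0 < h)%N) (DL : D <= L%:R).

Lemma measurable_reg : measurable_fun setT (fun p : R * R => reg p.1 p.2).
Proof.
have k c : measurable_fun setT (fun p : R * R => `|qf c p.1 p.2| <= X).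
  apply: measurable_fun_ler => //; apply: measurableT_comp => //.
  apply: measurable_funD; first apply: measurable_funD.
  - by apply: measurable_funM => //; apply: measurable_funX.
  - by apply: measurable_funM => //; apply: measurable_funM.
  - by apply: measurable_funM => //; apply: measurable_funX.
by apply: measurable_and => //; apply: measurable_and.
Qed.

Lemma measurable_row s : measurable_fun setT (fun t => reg s t).
Proof.
apply: (measurableT_comp measurable_reg (g := fun t : R => (s, t))).
exact: measurable_fun_pair.
Qed.

Lemma measurable_col t : measurable_fun setT (fun s => reg s t).
Proof.
apply: (measurableT_comp measurable_reg (g := fun s : R => (s, t))).
exact: measurable_fun_pair.
Qed.

Lemma box_interval : is_interval (box D).
Proof.
move=> x y; rewrite /box /= !ler_norml => /andP[? ?] /andP[? ?] z /andP[? ?].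
by rewrite ler_norml; apply/andP; split; lra.
Qed.

(** Each of the three differences of intervals doubles the discrepancy 1 of the whole line, whence
    8. *)
Lemma three_disc (I0 J0 I1 J1 I2 J2 : set R) (E : set R) (k0 : int) :
  is_interval I0 -> is_interval J0 -> J0 `<=` I0 ->
  is_interval I1 -> is_interval J1 -> J1 `<=` I1 ->
  is_interval I2 -> is_interval J2 -> J2 `<=` I2 ->
  E = (I0 `\` J0) `&` (I1 `\` J1) `&` (I2 `\` J2) -> E `<=` box D ->
  `|cnt L h k0 E - len E / h%:R| <= 8.
Proof.
move=> i0 j0 ji0 i1 j1 ji1 i2 j2 ji2 EE EB.
have d1 := discrepancy_step D0 (discrepancyT k0 h0 D0 DL) i0 j0 ji0.
have d2 := discrepancy_step D0 d1 i1 j1 ji1.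
have [_ d3] := discrepancy_step D0 d2 i2 j2 ji2.
have := d3 _ box_interval (@subset_refl _ _); rewrite setTI -EE setIidl //.
by have -> : 2 * (2 * (2 * 1)) = 8 :> R by ring.
Qed.

Lemma row_count s : `|cnt L h t0 [set t | reg s t] - len [set t | reg s t] / h%:R| <= 8.
Proof.
have k c := quad_set c.2 (c.1.2 * s) (c.1.1 * s ^+ 2) X.
have [I0 [J0 [i0 j0 ji0 E0]]] := k c0.
have [I1 [J1 [i1 j1 ji1 E1]]] := k c1.
have [I2 [J2 [i2 j2 ji2 E2]]] := k c2.
apply: (three_disc _ i0 j0 ji0 i1 j1 ji1 i2 j2 ji2) => [|t /regbox[]//].
rewrite -E0 -E1 -E2; have e c t : c.2 * t ^+ 2 + c.1.2 * s * t + c.1.1 * s ^+ 2 = qf c s t.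
  by rewrite /qf; ring.
apply/seteqP; split=> t /=; rewrite !e.
  by move=> /and3P[].
by move=> [[h1 h2] h3]; apply/and3P.
Qed.

Lemma col_count t : `|cnt L h s0 [set s | reg s t] - len [set s | reg s t] / h%:R| <= 8.
Proof.
have k c := quad_set c.1.1 (c.1.2 * t) (c.2 * t ^+ 2) X.
have [I0 [J0 [i0 j0 ji0 E0]]] := k c0.
have [I1 [J1 [i1 j1 ji1 E1]]] := k c1.
have [I2 [J2 [i2 j2 ji2 E2]]] := k c2.
apply: (three_disc _ i0 j0 ji0 i1 j1 ji1 i2 j2 ji2) => [|s /regbox[]//].
rewrite -E0 -E1 -E2; have e c s : c.1.1 * s ^+ 2 + c.1.2 * t * s + c.2 * t ^+ 2 = qf c s t.
  by rewrite /qf; ring.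
apply/seteqP; split=> s /=; rewrite !e.
  by move=> /and3P[].
by move=> [[h1 h2] h3]; apply/and3P.
Qed.

Definition rowlen s := len [set t | reg s t].
Definition collen t := len [set s | reg s t].

Lemma rowlenE s : (rowlen s)%:E = (\int[mu]_t (reg s t)%:R%:E)%E.
Proof.
rewrite integral_bool; last exact: measurable_row.
apply: (@lenK R D D0); last by move=> t /regbox[].
exact: (measurable_boolset (measurable_row s)).
Qed.

Lemma collenE t : (collen t)%:E = (\int[mu]_s (reg s t)%:R%:E)%E.
Proof.
rewrite integral_bool; last exact: measurable_col.
apply: (@lenK R D D0); last by move=> s /regbox[].
exact: (measurable_boolset (measurable_col t)).
Qed.

Definition area : R := fine (\int[mu]_s \int[mu]_t (reg s t)%:R%:E)%E.

Let mregE : measurable_fun setT (fun p : R * R => ((reg p.1 p.2)%:R%:E : \bar R)).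
Proof. by apply: measurable_boolE; exact: measurable_reg. Qed.

Let bool_ge0 (b : bool) : (0 <= (b%:R%:E : \bar R))%E.
Proof. by rewrite lee_fin. Qed.

Lemma areaC : (\int[mu]_s \int[mu]_t (reg s t)%:R%:E = \int[mu]_t (collen t)%:E)%E.
Proof.
rewrite (tonelliC mregE) //; apply: eq_integral => t _; by rewrite collenE.
Qed.

Lemma measurable_collen : measurable_fun setT (fun t => (collen t)%:E).
Proof.
have m : measurable_fun setT (fun p : R * R => ((reg p.2 p.1)%:R%:E : \bar R)).
  apply: measurable_boolE; apply: (measurableT_comp measurable_reg (g := fun p : R * R => (p.2, p.1))).
  exact: measurable_fun_pair.
rewrite (_ : (fun _ => _) = fun x => (\int[mu]_y (fun p : R * R => ((reg p.2 p.1)%:R%:E : \bar R)) (x, y))%E).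
  exact: (measurable_tonelli1 m).
by apply/funext => t; rewrite collenE.
Qed.

Definition inbox (t : R) : bool := `|t| <= D.

Lemma mbox_bool : measurable_fun setT inbox.
Proof. by apply: measurable_fun_ler => //; apply: measurableT_comp. Qed.

Lemma int_box : (\int[mu]_t (inbox t)%:R%:E = (2 * D)%:E)%E.
Proof. by rewrite integral_bool; [exact: mu_box|exact: mbox_bool]. Qed.

Lemma int_collen_le : (\int[mu]_t (collen t)%:E <= (2 * D * (2 * D))%:E)%E.
Proof.
apply: le_trans (_ : _ <= \int[mu]_t ((2 * D)%:E * (inbox t)%:R%:E))%E _.
  apply: ge0_le_integral => //.
  - by move=> t _; rewrite lee_fin len_ge0.
  - exact: measurable_collen.
  - by apply: emeasurable_funM => //; apply: measurable_boolE; exact: mbox_bool.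
  move=> t _; have [tD|tD] := boolP (inbox t).
    rewrite mule1 collenE -int_box; apply: ge0_le_integral => //.
    + by apply: measurable_boolE; exact: measurable_col.
    + by apply: measurable_boolE; exact: mbox_bool.
    move=> s _; rewrite lee_fin ler_nat; case: (boolP (reg s t)) => // /regbox[h' _].
    by rewrite /inbox h'.
  rewrite mule0 collenE integral0_eq // => s _.
  by case: (boolP (reg s t)) => // /regbox[_ h']; rewrite /inbox h' in tD.
rewrite ge0_integralZl //; first by rewrite int_box -EFinM.
- by apply: measurable_boolE; exact: mbox_bool.
- by rewrite lee_fin mulr_ge0.
Qed.

(** [area] is defined through [fine]; the box bounds the integral, so it is finite and [fine] loses
    nothing. *)
Lemma areaE : (area%:E = \int[mu]_t (collen t)%:E)%E.
Proof.
rewrite -areaC /area fineK // ge0_fin_numE; last first.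
  by apply: integral_ge0 => s _; apply: integral_ge0.
by rewrite areaC; apply: le_lt_trans int_collen_le _; rewrite ltry.
Qed.

Lemma area_le : area <= 2 * D * (2 * D).
Proof. by rewrite -lee_fin areaE int_collen_le. Qed.

Lemma area_ge0 : 0 <= area.
Proof. by rewrite fine_ge0 // integral_ge0 // => s _; apply: integral_ge0. Qed.

Lemma cnt_col t : cnt L h s0 [set s | reg s t] =
  \sum_(s <- zr L) ((h%:Z %| s - s0)%Z && reg s%:~R t)%:R.
Proof.
by apply: eq_bigr => s _; congr (nat_of_bool (_ && _))%:R; apply/idP/idP; rewrite inE.
Qed.

Lemma cnt_row s : cnt L h t0 [set t | reg s t] =
  \sum_(t <- zr L) ((h%:Z %| t - t0)%Z && reg s t%:~R)%:R.
Proof.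
by apply: eq_bigr => t _; congr (nat_of_bool (_ && _))%:R; apply/idP/idP; rewrite inE.
Qed.

Let hR : (0 : R) < h%:R. Proof. by rewrite ltr0n. Qed.

(** Exchanging sum and integral, the sum of row lengths is the integral over [t] of the column
    counts. Each column count is within 8 of the column length over [h], and [t] runs over an
    interval of length [2 D]. *)
Lemma sum_rowlen :
  `|\sum_(s <- zr L) (h%:Z %| s - s0)%Z%:R * rowlen s%:~R - area / h%:R| <= 16 * D.
Proof.
set S := \sum_(s <- _) _.
pose c t : R := \sum_(s <- zr L) ((h%:Z %| s - s0)%Z && reg s%:~R t)%:R.
have mc : measurable_fun setT (fun t => (c t)%:E).
  apply/measurable_EFinP; apply: measurable_sum => s.
  apply: measurable_boolR; apply: measurable_and => //; exact: measurable_row.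
have c0' t : (0 <= (c t)%:E)%E by rewrite lee_fin sumr_ge0.
have intc : (\int[mu]_t (c t)%:E = S%:E)%E.
  rewrite /c /S -sumEFin.
  under eq_integral do rewrite -sumEFin.
  rewrite ge0_integral_sum //; last first.
    move=> s; apply: measurable_boolE; apply: measurable_and => //; exact: measurable_row.
  apply: eq_bigr => s _; case: (_ %| _)%Z; rewrite ?mul1r ?mul0r /=.
    by rewrite rowlenE.
  by rewrite integral0_eq.
have key t : `|c t - collen t / h%:R| <= 8 * (inbox t)%:R.
  have [tD|tD] := boolP (inbox t); first by rewrite mulr1 /c -cnt_col col_count.
  have r0 s : reg s t = false by apply/negP => /regbox[_ h']; rewrite /inbox h' in tD.
  have -> : c t = 0 by rewrite /c big1 // => s _; rewrite r0 andbF.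
  have -> : collen t = 0.
    by apply: EFin_inj; rewrite collenE integral0_eq // => s _; rewrite r0.
  by rewrite mul0r subr0 normr0 mulr0.
have m8 : measurable_fun setT (fun t : R => (8%:E * (inbox t)%:R%:E : \bar R)%E).
  by apply: emeasurable_funM => //; apply: measurable_boolE; exact: mbox_bool.
have i8 : (\int[mu]_t (8%:E * (inbox t)%:R%:E) = (16 * D)%:E)%E.
  rewrite ge0_integralZl //; first by rewrite int_box -EFinM; congr EFin; ring.
  by apply: measurable_boolE; exact: mbox_bool.
have mcol : measurable_fun setT (fun t : R => (h%:R^-1%:E * (collen t)%:E : \bar R)%E).
  by apply: emeasurable_funM => //; exact: measurable_collen.
have icol : (\int[mu]_t (h%:R^-1%:E * (collen t)%:E) = (area / h%:R)%:E)%E.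
  rewrite ge0_integralZl //; first by rewrite -areaE -EFinM mulrC.
  - exact: measurable_collen.
  - by move=> t _; rewrite lee_fin len_ge0.
have l0 t : (0 <= h%:R^-1%:E * (collen t)%:E)%E.
  by rewrite mule_ge0 // lee_fin ?invr_ge0 ?len_ge0.
have e0 t : (0 <= (8%:E : \bar R) * (inbox t)%:R%:E)%E.
  by rewrite mule_ge0 // lee_fin.
have u1 : S <= area / h%:R + 16 * D.
  rewrite -lee_fin EFinD -intc -icol -i8 -ge0_integralD //.
  apply: ge0_le_integral => //; first exact: emeasurable_funD.
  move=> t _; rewrite -!EFinM -EFinD lee_fin; have := key t; rewrite ler_norml; lra.
have u2 : area / h%:R <= S + 16 * D.
  rewrite -lee_fin EFinD -intc -icol -i8 -ge0_integralD //.
  apply: ge0_le_integral => //; first exact: emeasurable_funD.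
  move=> t _; rewrite -!EFinM -EFinD lee_fin; have := key t; rewrite ler_norml; lra.
by rewrite ler_norml; apply/andP; split; lra.
Qed.

(** Counting by rows costs 8 for each of the at most [2 D / h + 1] rows of the progression that meet
    the box; replacing the sum of row lengths by the area costs another [16 D / h]. *)
Lemma lattice_count :
  `|\sum_(s <- zr L) \sum_(t <- zr L)
      [&& (h%:Z %| s - s0)%Z, (h%:Z %| t - t0)%Z & reg s%:~R t%:~R]%:R
    - area / h%:R ^+ 2| <= 32 * D / h%:R + 8.
Proof.
set S := \sum_(s <- _) _.
have bcount : cnt L h s0 (box D) <= 2 * D / h%:R + 1.
  have := interval_count s0 h0 D0 DL box_interval (@subset_refl _ _).
  rewrite /len mu_box // ler_norml /= => /andP[_]; lra.
have p1 : `|S - \sum_(s <- zr L) (h%:Z %| s - s0)%Z%:R * rowlen s%:~R / h%:R|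
    <= 8 * cnt L h s0 (box D).
  rewrite /S -sumrB mulr_sumr; apply: le_trans (ler_norm_sum _ _ _) _.
  apply: ler_sum => s _; case: (_ %| _)%Z => /=; last first.
    by rewrite big1 // !mul0r subrr normr0 mulr0.
  rewrite mul1r -cnt_row.
  have [sB|sB] := boolP ((s%:~R : R) \in box D); first by rewrite mulr1 row_count.
  have r0 t : reg s%:~R t = false.
    by apply/negP => /regbox[h' _]; move/negP: sB; apply; rewrite inE.
  rewrite mulr0 normr_le0 subr_eq0 cnt_row big1; last by move=> t _; rewrite r0 andbF.
  have -> : rowlen s%:~R = 0.
    by apply: EFin_inj; rewrite rowlenE integral0_eq // => t _; rewrite r0.
  by rewrite mul0r.
have p2 := sum_rowlen; rewrite -mulr_suml in p1.
set T := \sum_(s <- _) _ * _ in p1 p2.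
have p3 : `|T / h%:R - area / h%:R ^+ 2| <= 16 * D / h%:R.
  have -> : T / h%:R - area / h%:R ^+ 2 = (T - area / h%:R) / h%:R by field; rewrite gt_eqF.
  by rewrite normrM [ `|h%:R^-1|]ger0_norm ?invr_ge0 // ler_wpM2r ?invr_ge0.
move: p1 p3; rewrite !ler_norml => /andP[? ?] /andP[? ?]; apply/andP; split; lra.
Qed.
End TwoDim.

(** * Moebius sums: for distinct primes, [sieve ps] lists the pairs [(mu k, k)] over products [k] of
    primes in [ps] *)

Fixpoint sieve (ps : seq nat) : seq (int * nat) :=
  if ps is p :: ps' then
    sieve ps' ++ [seq (- x.1, p * x.2)%N | x <- sieve ps']
  else [:: (1, 1%N)].

Lemma sieveP ps x : all prime ps -> x \in sieve ps ->
  [/\ `|x.1| = 1, (0 < x.2)%N & forall p, prime p -> (p %| x.2)%N -> p \in ps].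
Proof.
elim: ps x => [|p ps IH] x /=.
  move=> _; rewrite inE => /eqP->; split=> // p pp; rewrite dvdn1 => /eqP p1.
  by rewrite p1 in pp.
move=> /andP[pp ap]; rewrite mem_cat => /orP[/(IH _ ap)[h1 h2 h3]|/mapP[y /(IH _ ap)[h1 h2 h3] ->]] /=.
  by split=> // r rp /(h3 _ rp) h; rewrite inE h orbT.
split; [by rewrite normrN|by rewrite muln_gt0 prime_gt0|].
move=> r rp; rewrite Euclid_dvdM // => /orP[|/(h3 _ rp) h]; last by rewrite inE h orbT.
by rewrite dvdn_prime2 // => /eqP->; rewrite inE eqxx.
Qed.

Lemma sieve_coprime ps p x : all prime ps -> prime p -> p \notin ps -> x \in sieve ps ->
  coprime p x.2.
Proof.
move=> ap pp pn xs; have [_ _ h] := sieveP ap xs.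
by rewrite prime_coprime //; apply: contra pn => /(h _ pp).
Qed.

Lemma sieve_coprimeN ps n x : all prime ps -> all (coprime n) ps -> x \in sieve ps ->
  coprime n x.2.
Proof.
elim: ps x => [|p ps IH] x /=; first by move=> _ _; rewrite inE => /eqP->; rewrite coprimen1.
move=> /andP[pp ap] /andP[np an]; rewrite mem_cat => /orP[|/mapP[y ys ->] /=]; first exact: IH.
by rewrite coprimeMr np IH.
Qed.

Lemma sieve_uniq ps : all prime ps -> uniq ps -> uniq [seq x.2 | x <- sieve ps].
Proof.
elim: ps => //= p ps IH /andP[pp ap] /andP[pn un].
rewrite map_cat cat_uniq IH // -map_comp /=.
have -> : [seq ((fun x : int * nat => x.2) \o (fun x : int * nat => (- x.1, (p * x.2)%N))) i | i <- sieve ps]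
   = [seq (p * k)%N | k <- [seq x.2 | x <- sieve ps]] by rewrite -map_comp.
rewrite map_inj_uniq ?IH ?andbT //; last first.
  by move=> a b /eqP; rewrite eqn_pmul2l ?prime_gt0 // => /eqP.
apply/hasPn => k /mapP[_ /mapP[x xs ->] ->]; apply/negP => /mapP[y ys e].
have := sieve_coprime ap pp pn ys; rewrite -e prime_coprime // dvdn_mulr //.
Qed.

Lemma sieve_prod (R : comNzRingType) (f : nat -> R) ps : all prime ps -> uniq ps ->
  f 1%N = 1 -> (forall p k, prime p -> coprime p k -> f (p * k)%N = f p * f k) ->
  \sum_(x <- sieve ps) x.1%:~R * f x.2 = \prod_(p <- ps) (1 - f p).
Proof.
move=> + + f1 fM; elim: ps => [|p ps IH] /=.
  by rewrite big_seq1 big_nil f1 mulr1.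
move=> /andP[pp ap] /andP[pn un]; rewrite big_cons -IH // big_cat big_map /= mulrBl mul1r.
congr (_ + _); rewrite mulr_sumr -sumrN; apply: eq_big_seq => x xs /=.
by rewrite rmorphN /= fM ?(sieve_coprime ap) //; ring.
Qed.

Lemma sum_uniq_le (R : realDomainType) (r : seq nat) (M : nat) (F : nat -> R) :
  uniq r -> (forall k, k \in r -> (k < M)%N) -> (forall k, 0 <= F k) ->
  \sum_(k <- r) F k <= \sum_(0 <= k < M) F k.
Proof.
move=> ur rM F0.
have -> : \sum_(k <- r) F k = \sum_(0 <= k < M | k \in r) F k.
  rewrite -[RHS]big_filter; apply: perm_big; apply: uniq_perm => //.
    by rewrite filter_uniq // iota_uniq.
  by move=> k; rewrite mem_filter mem_index_iota /=; case: (boolP (k \in r)) => //= /rM ->.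
by rewrite big_mkcond; apply: ler_sum => k _; case: ifP.
Qed.

(** * Harmonic sums and tails of inverse squares *)

Section Series.
Variable R : realType.

(** Induction from [ln (k / (k + 1)) <= - 1 / (k + 1)], an instance of [ln (1 + x) <= x]. *)
Lemma harmonic_le (n : nat) : (0 < n)%N ->
  \sum_(1 <= k < n.+1) k%:R^-1 <= 1 + ln n%:R :> R.
Proof.
case: n => // n _; elim: n => [|n IH].
  by rewrite big_nat1 invr1 ln1 addr0.
rewrite big_nat_recr //=; apply: le_trans (lerD IH (lexx _)) _.
rewrite -addrA lerD2l.
have a0 : (0 : R) < n.+1%:R by rewrite ltr0n.
have b0 : (0 : R) < n.+2%:R by rewrite ltr0n.
have : ln (n.+1%:R / n.+2%:R) <= n.+1%:R / n.+2%:R - 1 :> R.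
  have := @le_ln1Dx R (n.+1%:R / n.+2%:R - 1); rewrite [1 + _]addrC subrK; apply.
  by rewrite ltrBrDr addNr divr_gt0.
rewrite ln_div ?posrE //.
have -> : n.+1%:R / n.+2%:R - 1 = - n.+2%:R^-1 :> R.
  have e : n.+2%:R = n.+1%:R + 1 :> R by rewrite natr1.
  move: e b0; move: (n.+1%:R : R) (n.+2%:R : R) => a b e b0.
  have -> : a = b - 1 by lra.
  by field; rewrite gt_eqF.
by move: (ln _) (ln _) (_^-1) => x y z; lra.
Qed.

(** Telescoping with [1 / k ^ 2 <= 1 / (k - 1) - 1 / k]. *)
Lemma tail_sq_le (m n : nat) : (0 < m)%N ->
  \sum_(m.+1 <= k < n) (k%:R ^+ 2)^-1 <= m%:R^-1 :> R.
Proof.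
move=> m0; have [mn|nm] := ltnP m n; last by rewrite big_geq 1?leqW // invr_ge0.
have : \sum_(m.+1 <= k < n) (k%:R ^+ 2)^-1 <= m%:R^-1 - n.-1%:R^-1 :> R.
  elim: n mn => // n IH; rewrite ltnS leq_eqVlt => /orP[/eqP<-|mn].
    by rewrite big_geq // subrr.
  rewrite big_nat_recr //=; apply: le_trans (lerD (IH mn) (lexx _)) _.
  have n1 : (1 < n)%N by apply: leq_trans mn.
  case: n {IH} n1 mn => // -[|n] // _ _ /=.
  have a0 : (0 : R) < n.+1%:R by rewrite ltr0n.
  have b0 : (0 : R) < n.+2%:R by rewrite ltr0n.
  have : (n.+2%:R ^+ 2)^-1 <= n.+1%:R^-1 - n.+2%:R^-1 :> R.
    have -> : n.+1%:R^-1 - n.+2%:R^-1 = (n.+1%:R * n.+2%:R)^-1 :> R.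
      have e : n.+2%:R = n.+1%:R + 1 :> R by rewrite natr1.
      move: e a0 b0; move: (n.+1%:R : R) (n.+2%:R : R) => a b -> a0 b0.
      by field; rewrite !gt_eqF.
    by rewrite lef_pV2 ?posrE ?mulr_gt0 ?exprn_gt0 // expr2 ler_wpM2r ?ler_nat // ltW.
  move: ((n.+2%:R ^+ 2)^-1 : R) (n.+1%:R^-1 : R) (n.+2%:R^-1 : R) (m%:R^-1 : R) => x y z w.
  by lra.
by move=> hh; apply: le_trans hh _; rewrite lerBlDr lerDl invr_ge0.
Qed.
End Series.

(** * Coprime lattice points of the region in prescribed residue classes *)

Section Sieve.
Variable R : realType.
Variables (c0 c1 c2 : R * R * R) (X D : R).
Notation reg := (reg c0 c1 c2 X).
Notation area := (area c0 c1 c2 X).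
Hypothesis D1 : 1 <= D.
Hypothesis regbox : forall s t, reg s t -> `|s| <= D /\ `|t| <= D.
Variables (L N0 la d : nat).
Hypotheses (DL : D <= L%:R) (N00 : (0 < N0)%N) (la0 : (0 < la)%N) (d0 : (0 < d)%N)
  (laN : (la %| N0)%N).
Variable cl : int -> int -> bool.
Hypothesis clper : forall s t s' t', (N0%:Z %| s - s')%Z -> (N0%:Z %| t - t')%Z ->
  cl s t = cl s' t'.
Hypothesis clprim : forall s t p, cl s t -> prime p -> (p %| N0)%N ->
  (p%:Z %| s)%Z -> (p%:Z %| t)%Z -> False.
Hypothesis clla : forall s t, cl s t -> (la%:Z %| d%:Z * s)%Z.

Let D0 : 0 <= D. Proof. exact: le_trans D1. Qed.
Let Dp : 0 < D. Proof. exact: lt_le_trans D1. Qed.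

Definition cG : nat := (\sum_(0 <= a < N0) \sum_(0 <= b < N0) cl a%:Z b%:Z)%N.
(** These counts feed the Moebius sum for [Np]. Keeping [s != 0] makes them vanish once [k] exceeds
    the box. *)
Definition Mk (k : nat) : R := \sum_(s <- zr L) \sum_(t <- zr L)
  [&& (k%:Z %| s)%Z, (k%:Z %| t)%Z, s != 0, cl s t & reg s%:~R t%:~R]%:R.
Definition Np : R := \sum_(s <- zr L) \sum_(t <- zr L)
  [&& coprime `|s| `|t|, s != 0, cl s t & reg s%:~R t%:~R]%:R.

(* la | d s amounts to divisibility of s by this number. *)
Definition lred (n : nat) := (n %/ gcdn n d)%N.

Lemma lredP n (s : int) : (0 < n)%N -> (n%:Z %| d%:Z * s)%Z = ((lred n)%:Z %| s)%Z.
Proof.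
move=> n0; rewrite !dvdzE /= abszM /= /lred; set g := gcdn n d.
have g0 : (0 < g)%N by rewrite gcdn_gt0 n0.
rewrite -{1}(divnK (dvdn_gcdl n d)) -/g -(divnK (dvdn_gcdr n d)) -/g.
rewrite mulnAC dvdn_pmul2r // Gauss_dvdr //.
rewrite /coprime -(eqn_pmul2r g0) muln_gcdl mul1n.
by rewrite !divnK ?dvdn_gcdl ?dvdn_gcdr.
Qed.

Lemma lred_gt0 n : (0 < n)%N -> (0 < lred n)%N.
Proof.
by move=> n0; rewrite divn_gt0 ?gcdn_gt0 ?n0 // dvdn_leq // dvdn_gcdl.
Qed.

Lemma lred_ge n : (0 < n)%N -> n%:R / d%:R <= (lred n)%:R :> R.
Proof.
move=> n0; rewrite ler_pdivrMr ?ltr0n // -natrM ler_nat.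
rewrite -{1}(divnK (dvdn_gcdl n d)) leq_pmul2l ?lred_gt0 //.
by rewrite dvdn_leq // dvdn_gcdr.
Qed.

(** As [la] divides [d a], the first residue is a multiple of [lred la], and the second is free. *)
Lemma cG_le : cG%:R <= N0%:R ^+ 2 * d%:R / la%:R :> R.
Proof.
set m := lred la; have m0 : (0 < m)%N := lred_gt0 la0.
have mN : (m %| N0)%N by apply: dvdn_trans laN; exact: dvdn_div (dvdn_gcdl _ _).
have c1' : (cG <= N0 * \sum_(0 <= a < N0) (m %| a))%N.
  rewrite big_distrr /=; apply: leq_sum => a _.
  have [ma|ma] := boolP (m %| a)%N.
    rewrite muln1; apply: leq_trans (_ : _ <= \sum_(0 <= b < N0) 1)%N _.
      by apply: leq_sum => b _; case: (cl _ _).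
    by rewrite sum_nat_const_nat subn0 muln1.
  rewrite muln0 leqn0 big1 // => b _; case: (boolP (cl _ _)) => // /clla.
  by rewrite lredP // dvdzE /= (negbTE ma).
have c2' : (\sum_(0 <= a < N0) (m %| a) <= N0 %/ m)%N.
  rewrite -[X in (_ <= X)%N](size_iota 0) -(size_map (muln m)).
  have -> : (\sum_(0 <= a < N0) (m %| a) = size [seq a <- index_iota 0 N0 | m %| a])%N.
    rewrite size_filter -sum1_count [RHS]big_mkcond /=.
    by apply: eq_bigr => a _; case: (_ %| _)%N.
  apply: uniq_leq_size; first by rewrite filter_uniq // iota_uniq.
  move=> a; rewrite mem_filter mem_index_iota /= => /andP[/dvdnP[j ->] h].
  apply/mapP; exists j; last by rewrite mulnC.
  by rewrite mem_iota add0n /= ltn_divRL.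
have c3' : (cG <= N0 * (N0 %/ m))%N by apply: leq_trans c1' _; rewrite leq_mul2l c2' orbT.
have mR : (0 : R) < m%:R by rewrite ltr0n.
have laR : (0 : R) < la%:R by rewrite ltr0n.
have dR : (0 : R) < d%:R by rewrite ltr0n.
apply: le_trans (_ : _ <= N0%:R * (N0%:R / m%:R)) _.
  apply: le_trans (_ : _ <= (N0 * (N0 %/ m))%N%:R) _; first by rewrite ler_nat.
  by rewrite natrM ler_wpM2l // ler_pdivlMr // -natrM divnK.
rewrite expr2 -!mulrA ler_wpM2l // ler_wpM2l //.
have h : la%:R / d%:R <= m%:R :> R by apply: lred_ge.
by rewrite -[d%:R / _]invf_div lef_pV2 ?posrE // divr_gt0.
Qed.

Lemma area_le4 : area <= 4 * D ^+ 2.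
Proof. by apply: le_trans (area_le D0 regbox) _; rewrite expr2; lra. Qed.

Let A0 : 0 <= area. Proof. exact: area_ge0. Qed.

Lemma mult_count (m : nat) (k0 : int) : (0 < m)%N ->
  \sum_(s <- zr L) ((m%:Z %| s - k0)%Z && (`|s%:~R| <= D))%:R <= 2 * D / m%:R + 1.
Proof.
move=> m0; have bi : is_interval (box D) := @box_interval R D.
have := interval_count k0 m0 D0 DL bi (@subset_refl _ _).
rewrite /len mu_box // ler_norml /= => /andP[_].
have -> : cnt L m k0 (box D) = \sum_(s <- zr L) ((m%:Z %| s - k0)%Z && (`|s%:~R| <= D))%:R.
  by apply: eq_bigr => s _; congr (nat_of_bool (_ && _))%:R; apply/idP/idP; rewrite inE.
lra.
Qed.

(** Both [k] and [la] divide [d s] and they are coprime, so [s] is a nonzero multiple of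
    [m = lred (k la)], which is at least [k la / d]. This leaves at most [3 D / m] values of [s],
    and at most [3 D / k] values of [t] when [k <= D]. *)
Lemma Mk_trivial k : (0 < k)%N -> coprime k N0 ->
  Mk k <= 9 * d%:R * D ^+ 2 / (k%:R ^+ 2 * la%:R) /\ (D < k%:R -> Mk k = 0).
Proof.
move=> k0 kN; pose n := (k * la)%N.
have n0 : (0 < n)%N by rewrite muln_gt0 k0.
have kla : coprime k la by apply: coprime_dvdr kN.
pose m := lred n; have m0 : (0 < m)%N := lred_gt0 n0.
have kR : (0 : R) < k%:R by rewrite ltr0n.
have mR : (0 : R) < m%:R by rewrite ltr0n.
have laR : (0 : R) < la%:R by rewrite ltr0n.
have dR : (0 : R) < d%:R by rewrite ltr0n.
have divm s t : (k%:Z %| s)%Z -> cl s t -> (m%:Z %| s)%Z.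
  move=> ks /clla h; rewrite -lredP // dvdzE /= Gauss_dvd //.
  by move: h ks; rewrite !dvdzE /= => -> h; rewrite abszM dvdn_mull.
have sm (j : nat) (s : int) : (j%:Z %| s)%Z -> s != 0 -> `|s%:~R : R| <= D -> j%:R <= D.
  move=> js s0 sD; apply: le_trans sD; rewrite -intr_norm -natr_absz ler_nat.
  by apply: dvdn_leq; rewrite ?absz_gt0.
have ub : Mk k <= (\sum_(s <- zr L) [&& (m%:Z %| s)%Z, s != 0 & (`|s%:~R : R| <= D)]%:R) *
    (\sum_(t <- zr L) ((k%:Z %| t - 0)%Z && (`|t%:~R| <= D))%:R).
  rewrite mulr_suml; apply: ler_sum => s _; rewrite mulr_sumr; apply: ler_sum => t _.
  rewrite -natrM mulnb ler_nat subr0; case: (boolP [&& _, _, _, _ & _]) => // /and5P[ks kt s0 c r].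
  by have [r1 r2] := regbox r; rewrite (divm _ _ ks c) kt s0 r1 r2.
have sD : \sum_(s <- zr L) [&& (m%:Z %| s)%Z, s != 0 & (`|s%:~R : R| <= D)]%:R <= 3 * D / m%:R.
  have [mD|Dm] := leP m%:R D.
    apply: le_trans (_ : _ <= 2 * D / m%:R + 1) _.
      apply: le_trans (mult_count 0 m0); apply: ler_sum => s _; rewrite ler_nat subr0.
      by case: (_ %| _)%Z => //=; case: (s != 0) => //=; case: (_ <= _).
    have : 1 <= D / m%:R by rewrite ler_pdivlMr // mul1r.
    lra.
  rewrite big1 ?divr_ge0 ?mulr_ge0 // => s _; case: (boolP [&& _, _ & _]) => // /and3P[h1 h2 h3].
  by have := sm _ _ h1 h2 h3; rewrite leNgt Dm.
have [kD|Dk] := leP k%:R D; last first.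
  have z : Mk k = 0.
    rewrite /Mk big1 // => s _; rewrite big1 // => t _.
    case: (boolP [&& _, _, _, _ & _]) => // /and5P[ks kt s0 c r].
    by have [r1 r2] := regbox r; have := sm _ _ ks s0 r1; rewrite leNgt Dk.
  by split=> //; rewrite z divr_ge0 ?mulr_ge0 ?exprn_ge0.
split; last by [].
have tD : \sum_(t <- zr L) ((k%:Z %| t - 0)%Z && (`|t%:~R| <= D))%:R <= 3 * D / k%:R.
  apply: le_trans (mult_count 0 k0) _.
  have : 1 <= D / k%:R by rewrite ler_pdivlMr // mul1r.
  lra.
apply: le_trans ub _; apply: le_trans (ler_pM _ _ sD tD) _; rewrite ?sumr_ge0 //.
have mg : m%:R^-1 <= d%:R / (k%:R * la%:R) :> R.
  rewrite -invf_div lef_pV2 ?posrE ?divr_gt0 ?mulr_gt0 //.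
  by have := lred_ge n0; rewrite natrM.
have : 3 * D * (3 * D / k%:R) * m%:R^-1 <= 3 * D * (3 * D / k%:R) * (d%:R / (k%:R * la%:R)).
  by rewrite ler_wpM2l // !mulr_ge0 // invr_ge0 ltW.
have -> : 3 * D / m%:R * (3 * D / k%:R) = 3 * D * (3 * D / k%:R) * m%:R^-1 by ring.
move=> h; apply: le_trans h _; rewrite le_eqVlt; apply/orP; left; apply/eqP.
by field; rewrite !gt_eqF.
Qed.

Lemma zr_sum_class (f : int -> int -> R) :
  (forall s t, 0 <= f s t) ->
  \sum_(s <- zr L) \sum_(t <- zr L) (cl s t)%:R * f s t =
  \sum_(0 <= a < N0) \sum_(0 <= b < N0) (cl a%:Z b%:Z)%:R *
    \sum_(s <- zr L) \sum_(t <- zr L) ((N0%:Z %| s - a%:Z)%Z && (N0%:Z %| t - b%:Z)%Z)%:R * f s t.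
Proof.
move=> f0.
have one (s : int) (g : nat -> R) :
   \sum_(0 <= a < N0) (N0%:Z %| s - a%:Z)%Z%:R * g a = g `|(s %% N0%:Z)%Z|%N.
  have N0z : N0%:Z != 0 by rewrite eqz_nat -lt0n.
  pose r := `|(s %% N0%:Z)%Z|%N.
  have rE : r%:Z = (s %% N0%:Z)%Z by rewrite gez0_abs // modz_ge0.
  have rN : (r < N0)%N by rewrite -ltz_nat rE ltz_pmod // ltz_nat.
  have dv (a : nat) : (a < N0)%N -> (N0%:Z %| s - a%:Z)%Z = (a == r).
    move=> aN; rewrite -eqz_mod_dvd -[in RHS]eqz_nat rE eq_sym.
    by rewrite [(a%:Z %% _)%Z]modz_small // ltz_nat aN.
  rewrite (bigD1_seq r) ?mem_index_iota ?iota_uniq //= dv // eqxx mul1r big_seq_cond big1 ?addr0 //.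
  by move=> a /andP[]; rewrite mem_index_iota /= => aN ar; rewrite dv // (negbTE ar) mul0r.
transitivity (\sum_(s <- zr L) \sum_(t <- zr L) \sum_(0 <= a < N0) \sum_(0 <= b < N0)
   (N0%:Z %| s - a%:Z)%Z%:R * ((N0%:Z %| t - b%:Z)%Z%:R * ((cl a%:Z b%:Z)%:R * f s t))).
  apply: eq_bigr => s _; apply: eq_bigr => t _.
  under eq_bigr do rewrite -mulr_sumr.
  rewrite one one; congr ((nat_of_bool _)%:R * _); apply: clper.
    by rewrite gez0_abs ?modz_ge0 ?eqz_nat -?lt0n // {1}(divz_eq s N0%:Z) addrK dvdz_mull // dvdzz.
  by rewrite gez0_abs ?modz_ge0 ?eqz_nat -?lt0n // {1}(divz_eq t N0%:Z) addrK dvdz_mull // dvdzz.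
under eq_bigr do rewrite exchange_big /=.
rewrite exchange_big /=; apply: eq_bigr => a _.
under eq_bigr do rewrite exchange_big /=.
rewrite exchange_big /=; apply: eq_bigr => b _.
rewrite mulr_sumr; apply: eq_bigr => s _; rewrite mulr_sumr; apply: eq_bigr => t _.
by rewrite -mulnb natrM; ring.
Qed.

(** By the Chinese remainder theorem, divisibility by [k] and a class modulo [N0] make one class
    modulo [h = k N0]. There [lattice_count] costs [32 D / h + 8] and the removal of the line
    [s = 0] costs [2 D / h + 1]; as [h <= D], the total is at most [43 D / h]. *)
Lemma Mk_main k : (0 < k)%N -> coprime k N0 -> (k * N0)%N%:R <= D ->
  `|Mk k - cG%:R * (area / (k * N0)%N%:R ^+ 2)| <= cG%:R * (43 * D / (k * N0)%N%:R).
Proof.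
move=> k0 kN; set h := (k * N0)%N => hD.
have h0 : (0 < h)%N by rewrite muln_gt0 k0.
have hR : (0 : R) < h%:R by rewrite ltr0n.
pose u (a : nat) := (chinese k N0 0 a)%:Z.
have uP (a : nat) (s : int) : ((N0%:Z %| s - a%:Z)%Z && (k%:Z %| s)%Z) = (h%:Z %| s - u a)%Z.
  have e1 : (k%:Z %| u a)%Z.
    by rewrite dvdzE /= /dvdn chinese_modl // mod0n.
  have e2 : (N0%:Z %| u a - a%:Z)%Z.
    by rewrite -eqz_mod_dvd !modz_nat eqz_nat chinese_modr.
  have -> : (h%:Z %| s - u a)%Z = (k%:Z %| s - u a)%Z && (N0%:Z %| s - u a)%Z.
    by rewrite !dvdzE /= Gauss_dvd.
  rewrite andbC; congr (_ && _).
    by apply/idP/idP => hh; [rewrite rpredB|rewrite -(subrK (u a) s) rpredD].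
  have -> : s - a%:Z = (s - u a) + (u a - a%:Z) by ring.
  apply/idP/idP => hh; last by rewrite rpredD.
  by have := rpredB hh e2; rewrite addrK.
pose f s t : R := [&& (k%:Z %| s)%Z, (k%:Z %| t)%Z, s != 0 & reg s%:~R t%:~R]%:R.
have f0 s t : 0 <= f s t by [].
have -> : Mk k = \sum_(s <- zr L) \sum_(t <- zr L) (cl s t)%:R * f s t.
  apply: eq_bigr => s _; apply: eq_bigr => t _; rewrite /f -natrM mulnb; congr (nat_of_bool _)%:R.
  by case: (cl s t); rewrite ?andbT ?andbF //= !andbF.
rewrite zr_sum_class //.
have -> : cG%:R = \sum_(0 <= a < N0) \sum_(0 <= b < N0) (cl a%:Z b%:Z)%:R :> R.
  by rewrite natr_sum; apply: eq_bigr => a _; rewrite natr_sum.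
rewrite !mulr_suml -sumrB; apply: le_trans (ler_norm_sum _ _ _) _; apply: ler_sum => a _.
rewrite !mulr_suml -sumrB; apply: le_trans (ler_norm_sum _ _ _) _; apply: ler_sum => b _.
rewrite -mulrBr normrM normr_nat ler_wpM2l //.
have lc := lattice_count D0 regbox (u a) (u b) h0 DL.
set S1 := \sum_(s <- _) _ in lc; set S2 := \sum_(s <- _) _.
have d12 : `|S1 - S2| <= 2 * D / h%:R + 1.
  apply: le_trans (mult_count (u b) h0); rewrite /S1 /S2 -sumrB.
  rewrite (bigD1_seq 0) ?mem_zr ?zr_uniq //= [X in _ + X]big1 ?addr0; last first.
    move=> s s0; rewrite -sumrB big1 // => t _; rewrite /f s0 /= -natrM mulnb -!uP.
    apply/eqP; rewrite subr_eq0; apply/eqP; congr (nat_of_bool _)%:R.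
    by case: (N0%:Z %| s - _)%Z; case: (k%:Z %| s)%Z; case: (N0%:Z %| t - _)%Z; case: (k%:Z %| t)%Z.
  rewrite -sumrB ger0_norm; last first.
    apply: sumr_ge0 => t _; rewrite /f eqxx /= !andbF mulr0 subr0 //.
  apply: ler_sum => t _; rewrite /f eqxx /= !andbF mulr0 subr0 ler_nat.
  case: (boolP [&& _, _ & _]) => // /and3P[_ -> r] /=.
  by have [_ ->] := regbox r.
have h1 : 1 <= D / h%:R by rewrite ler_pdivlMr // mul1r.
move: lc d12; rewrite !ler_norml => /andP[? ?] /andP[? ?]; apply/andP; split; lra.
Qed.

Let W : R := 43 * (N0%:R * d%:R / la%:R) * D.

(** Three ranges. For [k N0 <= D] the lattice count applies; for [k <= D < k N0] count and main term
    are both bounded trivially; for [k > D] the count is zero and only the main term is left. *)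
Lemma Mk_error k : (0 < k)%N -> coprime k N0 ->
  `|Mk k - cG%:R * area / N0%:R ^+ 2 * (k%:R ^+ 2)^-1| <=
  if (k%:R <= D) then W / k%:R else 4 * d%:R * D ^+ 2 / la%:R / k%:R ^+ 2.
Proof.
move=> k0 kN.
have kR : (0 : R) < k%:R by rewrite ltr0n.
have NR : (0 : R) < N0%:R by rewrite ltr0n.
have laR : (0 : R) < la%:R by rewrite ltr0n.
have dR : (0 : R) < d%:R by rewrite ltr0n.
have eM : cG%:R * area / N0%:R ^+ 2 * (k%:R ^+ 2)^-1 = cG%:R * (area / (k * N0)%N%:R ^+ 2) :> R.
  by rewrite natrM; field; rewrite !gt_eqF.
have cg := cG_le.
have mainle : cG%:R * area / N0%:R ^+ 2 * (k%:R ^+ 2)^-1 <= 4 * d%:R * D ^+ 2 / la%:R / k%:R ^+ 2.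
  have : cG%:R * area <= (N0%:R ^+ 2 * d%:R / la%:R) * (4 * D ^+ 2).
    by apply: ler_pM => //; exact: area_le4.
  move=> h; rewrite -mulrA -invfM ler_pdivrMr ?mulr_gt0 ?exprn_gt0 //.
  apply: le_trans h _; rewrite le_eqVlt; apply/orP; left; apply/eqP.
  by field; rewrite !gt_eqF.
have main0 : 0 <= cG%:R * area / N0%:R ^+ 2 * (k%:R ^+ 2)^-1.
  by rewrite !mulr_ge0 ?invr_ge0 ?exprn_ge0.
have M0 : 0 <= Mk k by apply: sumr_ge0 => s _; apply: sumr_ge0.
have [t1 t2] := Mk_trivial k0 kN.
case: (leP k%:R D) => [kD|Dk]; last by rewrite t2 // sub0r normrN ger0_norm.
have [hD|hD] := leP (k * N0)%N%:R D.
  rewrite eM; apply: le_trans (Mk_main k0 kN hD) _.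
  apply: le_trans (_ : _ <= N0%:R ^+ 2 * d%:R / la%:R * (43 * D / (k * N0)%N%:R)) _.
    by rewrite ler_wpM2r // divr_ge0 // mulr_ge0.
  rewrite /W natrM le_eqVlt; apply/orP; left; apply/eqP.
  by field; rewrite !gt_eqF.
have DN : D / k%:R <= N0%:R by rewrite ler_pdivrMr // -natrM mulnC ltW.
pose Z := d%:R * D ^+ 2 / (k%:R ^+ 2 * la%:R).
have ZW : Z <= d%:R * D * N0%:R / (k%:R * la%:R).
  have -> : Z = d%:R * D / (k%:R * la%:R) * (D / k%:R) by rewrite /Z; field; rewrite !gt_eqF.
  have -> : d%:R * D * N0%:R / (k%:R * la%:R) = d%:R * D / (k%:R * la%:R) * N0%:R by ring.
  by rewrite ler_wpM2l // divr_ge0 // ?mulr_ge0 // ltW // mulr_gt0.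
have eW : W / k%:R = 43 * (d%:R * D * N0%:R / (k%:R * la%:R)).
  by rewrite /W; field; rewrite !gt_eqF.
have Z0 : 0 <= Z by rewrite /Z divr_ge0 ?mulr_ge0 ?exprn_ge0.
have e1 : 9 * d%:R * D ^+ 2 / (k%:R ^+ 2 * la%:R) = 9 * Z by rewrite /Z; ring.
have e2 : 4 * d%:R * D ^+ 2 / la%:R / k%:R ^+ 2 = 4 * Z by rewrite /Z; field; rewrite !gt_eqF.
rewrite e1 in t1; rewrite e2 in mainle; rewrite eW.
rewrite ler_norml; apply/andP; split; lra.
Qed.

(** Primes dividing [N0] are left out because [clprim] already forbids them as common factors. *)
Definition ps (y : nat) := [seq p <- index_iota 0 y | prime p && ~~ (p %| N0)%N].

Lemma ps_prime y : all prime (ps y).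
Proof. by apply/allP => p; rewrite mem_filter => /andP[/andP[]]. Qed.

Lemma ps_uniq y : uniq (ps y).
Proof. by rewrite filter_uniq // iota_uniq. Qed.

Lemma ps_coprime y : all (coprime N0) (ps y).
Proof.
apply/allP => p; rewrite mem_filter => /andP[/andP[pp pN] _].
by rewrite coprime_sym prime_coprime.
Qed.

(** A common prime factor of [s] and [t] is at most [|s| <= L < y], as [s] is nonzero, and it does
    not divide [N0]. Hence the product of [1 - [p | s and p | t]] over [ps y] is the indicator of
    coprimality. *)
Lemma Np_sieve y : (L < y)%N -> Np = \sum_(x <- sieve (ps y)) x.1%:~R * Mk x.2.
Proof.
move=> Ly; rewrite /Np /Mk.
under [RHS]eq_bigr do rewrite mulr_sumr.
rewrite [RHS]exchange_big /= big_seq [RHS]big_seq; apply: eq_bigr => s sL.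
under [RHS]eq_bigr do rewrite mulr_sumr.
rewrite [RHS]exchange_big /=; apply: eq_bigr => t _.
case: (boolP [&& s != 0, cl s t & reg s%:~R t%:~R]) => [/and3P[s0 c r]|nc]; last first.
  by rewrite andbF big1 // => x _; rewrite !andbF mulr0.
rewrite andbT.
pose f (k : nat) : R := ((k%:Z %| s)%Z && (k%:Z %| t)%Z)%:R.
have fM p k : prime p -> coprime p k -> f (p * k)%N = f p * f k.
  move=> pp pk; rewrite /f -natrM mulnb; congr (nat_of_bool _)%:R.
  by rewrite !dvdzE /= !Gauss_dvd //; case: (p %| `|s|)%N; case: (k %| `|s|)%N; case: (p %| `|t|)%N.
have f1 : f 1%N = 1 by rewrite /f !dvdzE /= !dvd1n.
transitivity (\sum_(x <- sieve (ps y)) x.1%:~R * f x.2); last first.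
  by apply: eq_bigr => x _; rewrite /f !andbT.
rewrite (sieve_prod (ps_prime y) (ps_uniq y) f1 fM).
case: (boolP (has (fun p => (p %| `|s|)%N && (p %| `|t|)%N) (ps y))) => [/hasP[p pps /andP[h1 h2]]|/hasPn hn].
  have pp : prime p by apply: (allP (ps_prime y)).
  have -> : coprime `|s| `|t| = false.
    apply/negP => /eqP cst; have : (p %| gcdn `|s| `|t|)%N by rewrite dvdn_gcd h1 h2.
    by rewrite cst dvdn1 => /eqP p1; rewrite p1 in pp.
  by rewrite (bigD1_seq p) ?ps_uniq //= /f !dvdzE /= h1 h2 subrr mul0r.
have -> : coprime `|s| `|t|.
  apply/negPn/negP => ncop.
  pose g := gcdn `|s| `|t|.
  have g1 : (1 < g)%N by rewrite ltn_neqAle eq_sym ncop gcdn_gt0 absz_gt0 s0.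
  pose p := pdiv g; have pp : prime p := pdiv_prime g1.
  have ps' : (p %| `|s|)%N := dvdn_trans (pdiv_dvd g) (dvdn_gcdl _ _).
  have pt' : (p %| `|t|)%N := dvdn_trans (pdiv_dvd g) (dvdn_gcdr _ _).
  have : p \in ps y.
    rewrite mem_filter pp mem_index_iota /=; apply/andP; split.
      apply/negP => pN; exact: (clprim c pp pN ps' pt').
    apply: leq_ltn_trans Ly; move: sL; rewrite mem_zr; apply: leq_trans.
    by apply: dvdn_leq; rewrite ?absz_gt0.
  by move=> /hn; rewrite ps' pt'.
rewrite big_seq big1 // => p /hn; rewrite /f !dvdzE /= => /negbTE ->; by rewrite subr0.
Qed.

(** The errors for [k <= D] form a harmonic sum and the others a tail of inverse squares; the bound
    is uniform in [y]. *)
Lemma sieve_count y : (L < y)%N ->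
  `|Np - cG%:R * area / N0%:R ^+ 2 * \prod_(p <- ps y) (1 - (p%:R ^+ 2)^-1)| <=
  W * (1 + ln D) + 8 * d%:R * D / la%:R.
Proof.
move=> Ly; rewrite (Np_sieve Ly).
have NR : (0 : R) < N0%:R by rewrite ltr0n.
have laR : (0 : R) < la%:R by rewrite ltr0n.
rewrite -(@sieve_prod R (fun k => (k%:R ^+ 2)^-1)) ?ps_prime ?ps_uniq //; first last.
- by move=> p k _ _; rewrite natrM exprMn invfM.
- by rewrite expr1n invr1.
rewrite mulr_sumr -sumrB; apply: le_trans (ler_norm_sum _ _ _) _.
pose F (k : nat) : R := if k%:R <= D then W / k%:R else 4 * d%:R * D ^+ 2 / la%:R / k%:R ^+ 2.
have W0 : 0 <= W by rewrite /W !mulr_ge0 // invr_ge0 ltW.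
have F0 k : 0 <= F k.
  rewrite /F; case: ifP => _; first by rewrite divr_ge0.
  by rewrite !divr_ge0 ?mulr_ge0 ?exprn_ge0 // ltW.
apply: le_trans (_ : _ <= \sum_(x <- sieve (ps y)) F x.2) _.
  rewrite big_seq [X in _ <= X]big_seq; apply: ler_sum => x xs.
  have [x1 x0 _] := sieveP (ps_prime y) xs.
  have xN : coprime x.2 N0 by rewrite coprime_sym (sieve_coprimeN (ps_prime y) (ps_coprime y)).
  rewrite [X in _ - X]mulrCA -mulrBr normrM -intr_norm x1 mul1r.
  exact: Mk_error.
rewrite -(big_map snd xpredT F).
(* From [D < n + 1 <= 2 n] the tail bound [1 / n] becomes [2 / D]. *)
pose n := Num.truncn D.
have /andP[nD Dn] : n%:R <= D < n.+1%:R by rewrite truncn_itv.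
have n0 : (0 < n)%N by rewrite truncn_gt0.
have kD (k : nat) : (k%:R <= D) = (k <= n)%N.
  apply/idP/idP => h; last by apply: le_trans nD; rewrite ler_nat.
  by rewrite -ltnS -(ltr_nat R) (le_lt_trans h).
pose K := [seq x.2 | x <- sieve (ps y)].
pose M := (maxn n.+1 (\max_(k <- K) k).+1)%N.
apply: le_trans (@sum_uniq_le R K M F _ _ F0) _.
- exact: sieve_uniq (ps_prime y) (ps_uniq y).
- move=> k kK; apply: leq_trans (leq_maxr _ _); rewrite ltnS.
  exact: (@leq_bigmax_seq _ K xpredT id k).
have nM : (n.+1 <= M)%N by rewrite leq_maxl.
rewrite (@big_cat_nat _ _ _ n.+1 0 M) //= big_ltn // {1}/F kD /= invr0 mulr0 add0r; apply: lerD.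
  have -> : \sum_(1 <= k < n.+1) F k = W * \sum_(1 <= k < n.+1) k%:R^-1.
    rewrite mulr_sumr; apply: eq_big_nat => k /andP[_ kn]; by rewrite /F kD -ltnS kn.
  rewrite ler_wpM2l //; apply: le_trans (harmonic_le _ n0) _; rewrite lerD2l.
  by rewrite ler_ln ?posrE // ltr0n.
have -> : \sum_(n.+1 <= k < M) F k = 4 * d%:R * D ^+ 2 / la%:R * \sum_(n.+1 <= k < M) (k%:R ^+ 2)^-1.
  rewrite mulr_sumr; apply: eq_big_nat => k /andP[kn _].
  by rewrite /F kD leqNgt kn.
have dD : 0 <= 4 * d%:R * D ^+ 2 / la%:R.
  by rewrite !divr_ge0 ?mulr_ge0 ?exprn_ge0 // ltW.
apply: le_trans (_ : _ <= 4 * d%:R * D ^+ 2 / la%:R * (2 / D)) _.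
  rewrite ler_wpM2l //; apply: le_trans (tail_sq_le R M n0) _.
  rewrite -invf_div lef_pV2 ?posrE ?ltr0n ?divr_gt0 // ler_pdivrMr //.
  apply: le_trans (ltW Dn) _; rewrite -natr1.
  have : 1 <= n%:R :> R by rewrite ler1n.
  lra.
rewrite le_eqVlt; apply/orP; left; apply/eqP; field; rewrite !gt_eqF //.
Qed.
End Sieve.

(** * Sums over complete residue systems *)

Section Residues.
Variable R : realFieldType.
Implicit Types (f g : int -> R) (m n k : nat).

Definition sumP m f : R := \sum_(0 <= a < m) f a%:Z.
Definition periodic m f := forall x y : int, (m%:Z %| x - y)%Z -> f x = f y.

Lemma sumP_ext m f g : (forall x, f x = g x) -> sumP m f = sumP m g.
Proof. by move=> h; apply: eq_bigr => a _; rewrite h. Qed.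

Lemma sumP_le m f g : (forall x, f x <= g x) -> sumP m f <= sumP m g.
Proof. by move=> h; apply: ler_sum => a _. Qed.

Lemma sumP_ge0 m f : (forall x, 0 <= f x) -> 0 <= sumP m f.
Proof. by move=> h; apply: sumr_ge0. Qed.

Lemma sumP_scale m (c : R) f : sumP m (fun x => c * f x) = c * sumP m f.
Proof. by rewrite /sumP mulr_sumr. Qed.

Lemma sumP_add m f g : sumP m (fun x => f x + g x) = sumP m f + sumP m g.
Proof. by rewrite /sumP big_split. Qed.

Lemma sumP_sub m f g : sumP m (fun x => f x - g x) = sumP m f - sumP m g.
Proof. by rewrite /sumP sumrB. Qed.

Lemma sumP_cst m (c : R) : sumP m (fun=> c) = m%:R * c.
Proof. by rewrite /sumP sumr_const_nat subn0 mulr_natl. Qed.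

Lemma sumP_exchange m n (F : int -> int -> R) :
  sumP m (fun x => sumP n (F x)) = sumP n (fun y => sumP m (fun x => F x y)).
Proof. by rewrite /sumP exchange_big. Qed.

Lemma residue_uniq m (x y : nat) : (x < m)%N -> (y < m)%N -> (m%:Z %| x%:Z - y%:Z)%Z -> x = y.
Proof.
move=> xm ym; rewrite -eqz_mod_dvd !modz_nat eqz_nat !modn_small //.
by move/eqP.
Qed.

(** A map that is injective modulo [m] permutes the residues. *)
Lemma sumP_inj m f (g : int -> int) : (0 < m)%N -> periodic m f ->
  (forall x y : int, (m%:Z %| g x - g y)%Z -> (m%:Z %| x - y)%Z) ->
  sumP m (f \o g) = sumP m f.
Proof.
move=> m0 fp ginj; have mz : m%:Z != 0 by rewrite eqz_nat -lt0n.
pose r (x : nat) := `|(g x%:Z %% m%:Z)%Z|%N.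
have rE x : (r x)%:Z = (g x%:Z %% m%:Z)%Z by rewrite gez0_abs // modz_ge0.
have rm x : (r x < m)%N by rewrite -ltz_nat rE ltz_pmod // ltz_nat.
have rg x : (m%:Z %| g x%:Z - (r x)%:Z)%Z.
  by rewrite rE {1}(divz_eq (g x%:Z) m%:Z) addrK dvdz_mull // dvdzz.
rewrite /sumP; transitivity (\sum_(a <- [seq r x | x <- index_iota 0 m]) f a%:Z).
  by rewrite big_map; apply: eq_bigr => a _ /=; apply: fp.
apply: perm_big.
have ur : uniq [seq r x | x <- index_iota 0 m].
  rewrite map_inj_in_uniq ?iota_uniq // => x y; rewrite !mem_index_iota /= => xm ym e.
  apply: (@residue_uniq m) => //; apply: ginj.
  have -> : g x%:Z - g y%:Z = (g x%:Z - (r x)%:Z) - (g y%:Z - (r y)%:Z) by rewrite e; ring.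
  by rewrite rpredB.
apply: uniq_perm => //; first exact: iota_uniq.
have sub : {subset [seq r x | x <- index_iota 0 m] <= index_iota 0 m}.
  by move=> x /mapP[a _ ->]; rewrite mem_index_iota rm.
by case: (uniq_min_size ur sub); rewrite ?size_map.
Qed.

Lemma sumP_shift m f (c : int) : (0 < m)%N -> periodic m f ->
  sumP m (fun x => f (x + c)) = sumP m f.
Proof.
move=> m0 fp; apply: (sumP_inj (g := fun x => x + c)) => // x y.
by rewrite opprD addrACA subrr addr0.
Qed.

Lemma sumP_mul m f (c : int) : (0 < m)%N -> periodic m f -> coprimez m%:Z c ->
  sumP m (fun x => f (c * x)) = sumP m f.
Proof.
move=> m0 fp mc; apply: (sumP_inj (g := fun x => c * x)) => // x y.
by rewrite -mulrBr Gauss_dvdzr.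
Qed.

Lemma sumP_blocks n m f : sumP (n * m) f = sumP n (fun b => sumP m (fun a => f (a + m%:Z * b))).
Proof.
elim: n => [|n IH]; first by rewrite mul0n /sumP !big_geq.
rewrite [RHS]/sumP big_nat_recr //= -/(sumP n (fun b => sumP m (fun a => f (a + m%:Z * b)))) -IH.
rewrite /sumP mulSnr (@big_cat_nat _ _ _ (n * m)%N) ?leq_addr //=; congr (_ + _).
rewrite -{1}[(n * m)%N]add0n big_addn addnC addnK.
by apply: eq_bigr => a _; rewrite PoszD PoszM mulrC.
Qed.

Lemma sumP_periodic n m f : periodic m f -> sumP (n * m) f = n%:R * sumP m f.
Proof.
move=> fp; rewrite sumP_blocks -sumP_cst; apply: sumP_ext => b; apply: sumP_ext => a.
by apply: fp; rewrite addrAC subrr add0r dvdz_mulr.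
Qed.

Lemma sumP_mult p m f : (0 < p)%N ->
  sumP (m * p) (fun a => (p%:Z %| a)%Z%:R * f a) = sumP m (fun a => f (p%:Z * a)).
Proof.
move=> p0; rewrite sumP_blocks; apply: sumP_ext => b.
rewrite /sumP (big_ltn p0) add0r dvdz_mulr // mul1r big_nat_cond big1 ?addr0 //.
move=> a /andP[/andP[a1 ap] _]; rewrite rpredDr ?dvdz_mulr // dvdzE /=.
by rewrite gtnNdvd // mul0r.
Qed.

(** Write [x = a + m b]: the first factor sees only [a], and for fixed [a] the class of [x] modulo
    [n] runs over all classes with [b]. *)
Lemma sumP_crt m n (F G : int -> R) : (0 < m)%N -> (0 < n)%N -> coprime m n ->
  periodic m F -> periodic n G ->
  sumP (n * m) (fun x => F x * G x) = sumP m F * sumP n G.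
Proof.
move=> m0 n0 mn pF pG; rewrite sumP_blocks sumP_exchange.
rewrite /sumP mulr_suml; apply: eq_bigr => a _.
transitivity (sumP n (fun b => F a%:Z * G (a%:Z + m%:Z * b))).
  apply: eq_bigr => b _; congr (_ * _); apply: pF.
  by rewrite addrAC subrr add0r dvdz_mulr.
rewrite sumP_scale; congr (_ * _).
apply: (sumP_inj (g := fun b => a%:Z + m%:Z * b)) => // x y.
have -> : a%:Z + m%:Z * x - (a%:Z + m%:Z * y) = m%:Z * (x - y) by ring.
by rewrite Gauss_dvdzr // /coprimez /gcdz eqz_nat /= gcdnC.
Qed.

Lemma dvd_count m (c : int) : (0 < m)%N -> sumP m (fun x => (m%:Z %| x - c)%Z%:R) = 1.
Proof.
move=> m0.
have pf : periodic m (fun x => (m%:Z %| x)%Z%:R : R).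
  move=> x y xy; congr (nat_of_bool _)%:R.
  by apply/idP/idP => h; [rewrite -(subKr x y) rpredB|rewrite -(subrK y x) rpredD].
rewrite (@sumP_shift m (fun x => (m%:Z %| x)%Z%:R) (- c)) //.
rewrite /sumP (big_ltn m0) dvdz0 big_nat_cond big1 ?addr0 // => a /andP[/andP[a1 ap] _].
by rewrite dvdzE /= gtnNdvd.
Qed.

(** Dividing by [g], the gcd of [al] and [m], leaves a congruence modulo [m / g] with invertible
    coefficient; its only solution is repeated [g] times modulo [m]. *)
Lemma lincong m (al be : int) : (0 < m)%N ->
  sumP m (fun x => (m%:Z %| al * x + be)%Z%:R) =
  (gcdn `|al| m)%:R * ((gcdn `|al| m)%:Z %| be)%Z%:R.
Proof.
move=> m0; pose g := gcdn `|al| m.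
have g0 : (0 < g)%N by rewrite gcdn_gt0 m0 orbT.
have gz : g%:Z != 0 by rewrite eqz_nat -lt0n.
pose m' := (m %/ g)%N; pose al' := (al %/ g%:Z)%Z.
have mE : m = (g * m')%N by rewrite mulnC divnK // dvdn_gcdr.
have alE : al = g%:Z * al' by rewrite mulrC divzK // dvdzE /= dvdn_gcdl.
have m'0 : (0 < m')%N by move: m0; rewrite mE muln_gt0 => /andP[].
have cop : coprimez m'%:Z al'.
  rewrite /coprimez /gcdz eqz_nat /= -(eqn_pmul2l g0) muln_gcdr muln1 -mE.
  by rewrite -[X in (X * `|al'|)%N]/(`|g%:Z|%N) -abszM -alE gcdnC.
rewrite -/g; have [/dvdzP[be' beE]|nb] := boolP (g%:Z %| be)%Z; last first.
  rewrite mulr0 /sumP big1 // => x _; case: (boolP (_ %| _)%Z) => // h.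
  case/negP: nb; have := dvdz_trans (_ : (g%:Z %| m%:Z)%Z) h.
  rewrite dvdzE /= {1}mE dvdn_mulr // => /(_ isT) h2.
  by rewrite -(addKr (al * x%:Z) be) addrC rpredB // {1}alE -mulrA dvdz_mulr.
rewrite mulr1.
have E x : (m%:Z %| al * x + be)%Z = (m'%:Z %| al' * x + be')%Z.
  have -> : al * x + be = g%:Z * (al' * x + be') by rewrite alE beE; ring.
  by rewrite !dvdzE abszM /= mE dvdn_pmul2l.
have pf : periodic m' (fun x => (m'%:Z %| x + be')%Z%:R : R).
  move=> x y xy; congr (nat_of_bool _)%:R.
  have -> : x + be' = (x - y) + (y + be') by ring.
  apply/idP/idP => h; last by rewrite rpredD.
  by rewrite -(addKr (x - y) (y + be')) addrC rpredB.
have pf2 : periodic m' (fun x => (m'%:Z %| al' * x + be')%Z%:R : R).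
  by move=> x y xy; apply: pf; rewrite -mulrBr dvdz_mull.
transitivity (sumP (g * m') (fun x => (m'%:Z %| al' * x + be')%Z%:R)).
  by rewrite -mE; apply: sumP_ext => x; rewrite E.
rewrite sumP_periodic // (sumP_mul m'0 pf cop).
rewrite (@sumP_ext _ _ (fun x => (m'%:Z %| x - (- be'))%Z%:R)) => [|x]; last by rewrite opprK.
by rewrite dvd_count // mulr1.
Qed.
End Residues.

(** * Sums over pairs of residues *)

Section Sum2.
Variable R : realFieldType.
Definition sum2 M (f : int -> int -> R) : R := sumP M (fun s => sumP M (f s)).
Definition periodic2 M (f : int -> int -> R) := forall s t s' t' : int,
  (M%:Z %| s - s')%Z -> (M%:Z %| t - t')%Z -> f s t = f s' t'.

Lemma sum2_ext M f g : (forall s t, f s t = g s t) -> sum2 M f = sum2 M g.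
Proof. by move=> h; apply: sumP_ext => s; apply: sumP_ext => t. Qed.

Lemma sum2_le M f g : (forall s t, f s t <= g s t) -> sum2 M f <= sum2 M g.
Proof. by move=> h; apply: sumP_le => s; apply: sumP_le => t. Qed.

Lemma sum2_ge0 M f : (forall s t, 0 <= f s t) -> 0 <= sum2 M f.
Proof. by move=> h; apply: sumP_ge0 => s; apply: sumP_ge0 => t. Qed.

Lemma sum2_add M f g : sum2 M (fun s t => f s t + g s t) = sum2 M f + sum2 M g.
Proof. by rewrite /sum2 -sumP_add; apply: sumP_ext => s; rewrite sumP_add. Qed.

Lemma sum2_scale M (c : R) f : sum2 M (fun s t => c * f s t) = c * sum2 M f.
Proof. by rewrite /sum2 -sumP_scale; apply: sumP_ext => s; rewrite sumP_scale. Qed.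

Lemma sum2_periodic n M f : periodic2 M f -> sum2 (n * M) f = n%:R ^+ 2 * sum2 M f.
Proof.
move=> fp; rewrite /sum2.
have p1 s : periodic M (f s) by move=> t t' h; apply: fp; rewrite // subrr dvdz0.
transitivity (n%:R * sumP (n * M) (fun s => sumP M (f s))).
  by rewrite -sumP_scale; apply: sumP_ext => s; rewrite sumP_periodic.
rewrite sumP_periodic ?mulrA ?expr2 // => s s' h.
by apply: sumP_ext => t; apply: fp; rewrite // subrr dvdz0.
Qed.

Lemma sum2_crt m n F G : (0 < m)%N -> (0 < n)%N -> coprime m n ->
  periodic2 m F -> periodic2 n G ->
  sum2 (n * m) (fun s t => F s t * G s t) = sum2 m F * sum2 n G.
Proof.
move=> m0 n0 mn pF pG; rewrite /sum2.
rewrite -sumP_crt //.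
- apply: sumP_ext => s; rewrite sumP_crt // => t t' h; [apply: pF|apply: pG]; by rewrite ?subrr ?dvdz0.
- by move=> s s' h; apply: sumP_ext => t; apply: pF; rewrite ?subrr ?dvdz0.
- by move=> s s' h; apply: sumP_ext => t; apply: pG; rewrite ?subrr ?dvdz0.
Qed.

(** One step in extracting the common power of [p] from a pair: the pairs divisible by [p] are the
    [(p s, p t)]. *)
Lemma sum2_split p m f : (0 < p)%N ->
  sum2 (m * p) f = sum2 (m * p) (fun s t => (~~ ((p%:Z %| s)%Z && (p%:Z %| t)%Z))%:R * f s t)
   + sum2 m (fun s t => f (p%:Z * s) (p%:Z * t)).
Proof.
move=> p0; have -> : sum2 m (fun s t => f (p%:Z * s) (p%:Z * t)) =
    sum2 (m * p) (fun s t => (p%:Z %| s)%Z%:R * ((p%:Z %| t)%Z%:R * f s t)).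
  rewrite /sum2; transitivity (sumP (m * p) (fun s => (p%:Z %| s)%Z%:R * sumP m (fun t => f s (p%:Z * t)))).
    by rewrite (@sumP_mult R p m (fun s => sumP m (fun t => f s (p%:Z * t)))).
  by apply: sumP_ext => s; rewrite sumP_scale sumP_mult.
rewrite -sum2_add; apply: sum2_ext => s t.
by case: (_ %| s)%Z; case: (_ %| t)%Z; rewrite ?mul0r ?mul1r ?mulr0 ?add0r ?addr0.
Qed.
End Sum2.

Lemma sub_lt_false a b c : (c < b)%N -> (b + a - c < a)%N = false.
Proof. by lia. Qed.

(** * The density at a prime *)

Section Local.
Variable R : realType.
Variables (d A B C : int).
Hypotheses (d0 : 0 < d) (C0 : C != 0).
Notation q := (qq A B C).
Let N0 : nat := `|(d * C)%R|%N.

Let N00 : (0 < N0)%N. Proof. by rewrite absz_gt0 mulf_neq0 // gt_eqF. Qed.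

Lemma qq_scale (k s t : int) : q (k * s) (k * t) = k ^+ 2 * q s t.
Proof. by rewrite /qq; ring. Qed.

Lemma qq_mod (M : nat) (s t s' t' : int) : (M%:Z %| s - s')%Z -> (M%:Z %| t - t')%Z ->
  (M%:Z %| q s t - q s' t')%Z.
Proof.
move=> h1 h2.
have -> : q s t - q s' t' = (A * (s + s') + B * t) * (s - s') + (B * s' + C * (t + t')) * (t - t').
  by rewrite /qq; ring.
by rewrite rpredD // dvdz_mull.
Qed.

Lemma dvdz_congr (g : nat) (x y : int) : (g%:Z %| x - y)%Z -> (g%:Z %| x)%Z = (g%:Z %| y)%Z.
Proof.
move=> h; apply/idP/idP => h'; last by rewrite -(subrK y x) rpredD.
by rewrite -(subKr x y) rpredB.
Qed.

Lemma gcd_congr (M : nat) (x y : int) : (M%:Z %| x - y)%Z -> gcdn `|x| M = gcdn `|y| M.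
Proof.
have one (a b : int) : (M%:Z %| a - b)%Z -> (gcdn `|a| M %| gcdn `|b| M)%N.
  move=> h; rewrite dvdn_gcd dvdn_gcdr andbT -[X in (_ %| X)%N]/(`|b|%N).
  have h1 : ((gcdn `|a| M)%:Z %| a)%Z by rewrite dvdzE /= dvdn_gcdl.
  have h2 : ((gcdn `|a| M)%:Z %| a - b)%Z.
    by apply: dvdz_trans h; rewrite dvdzE /= dvdn_gcdr.
  by rewrite (dvdz_congr h2) dvdzE in h1.
move=> h; apply/eqP; rewrite eqn_dvd !one //.
by rewrite -opprB rpredN.
Qed.

(** The weight is the part of the denominator [gg a b] visible modulo [M]; for [M = N0] and coprime
    [a], [b] it is [gg a b] itself. *)
Definition gam1 (M : nat) (a b : int) : R :=
  (coprime (gcdn `|a| `|b|) M)%:R * (gcdn (gcdn `|q a b| `|(d * a)%R|) M)%:R.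
Definition Gam (M : nat) : R := sum2 M (gam1 M).

Lemma gcd2_congr (M : nat) (x y x' y' : int) : (M%:Z %| x - x')%Z -> (M%:Z %| y - y')%Z ->
  gcdn (gcdn `|x| `|y|) M = gcdn (gcdn `|x'| `|y'|) M.
Proof.
move=> h1 h2; have e (a b : nat) : gcdn (gcdn a b) M = gcdn (gcdn a M) (gcdn b M).
  by rewrite gcdnACA gcdnn.
by rewrite e (gcd_congr h1) (gcd_congr h2) -e.
Qed.

Lemma gam1_periodic M : periodic2 M (gam1 M).
Proof.
move=> s t s' t' h1 h2; rewrite /gam1 /coprime (gcd2_congr h1 h2).
congr (_ * _%:R); apply: gcd2_congr; first exact: qq_mod.
by rewrite -mulrBr dvdz_mull.
Qed.

Lemma Gam_mul m n : (0 < m)%N -> (0 < n)%N -> coprime m n -> Gam (n * m) = Gam m * Gam n.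
Proof.
move=> m0 n0 mn; rewrite /Gam -sum2_crt //; [|exact: gam1_periodic|exact: gam1_periodic].
apply: sum2_ext => s t; rewrite /gam1 coprimeMr.
have gM x : gcdn x (n * m) = (gcdn x n * gcdn x m)%N.
  have cop : coprime (gcdn x n) (gcdn x m).
    by apply: coprime_dvdl (dvdn_gcdr x n) _; apply: coprime_dvdr (dvdn_gcdr x m) _; rewrite coprime_sym.
  apply/eqP; rewrite eqn_dvd; apply/andP; split; last first.
    by rewrite dvdn_gcd Gauss_dvd // !dvdn_gcdl /= dvdn_mul // dvdn_gcdr.
  have g1 := dvdn_gcdl x (n * m); have g2 := dvdn_gcdr x (n * m).
  move: (gcdn x (n * m)) g1 g2 => g g1 g2.
  by rewrite muln_gcdl !muln_gcdr !dvdn_gcd g2 !(dvdn_mulr _ g1) !(dvdn_mull _ g1).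
by rewrite gM natrM -mulnb natrM; ring.
Qed.

Lemma Gam1 : Gam 1 = 1.
Proof.
rewrite /Gam /sum2 /sumP !big_nat1 /gam1 coprimen1 gcdn1 mulr1 //.
Qed.

Variable p : nat.
Hypothesis pp : prime p.
Let p0 : (0 < p)%N := prime_gt0 pp.
Let p1 : (1 < p)%N := prime_gt1 pp.

Definition prm (s t : int) : bool := ~~ ((p%:Z %| s)%Z && (p%:Z %| t)%Z).

Lemma pX_gt0 n : (0 < p ^ n)%N. Proof. by rewrite expn_gt0 p0. Qed.

(** The combinations of [gg_dvd], used locally: [s] or [t] is prime to [p]. *)
Lemma prim_dvd i s t : prm s t -> ((p ^ i)%N%:Z %| q s t)%Z -> ((p ^ i)%N%:Z %| d * s)%Z ->
  ((p ^ i)%N%:Z %| d * C)%Z.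
Proof.
move=> st h1 h2; set g := (p ^ i)%N in h1 h2 *.
have h3 : (g%:Z %| d * C * t ^+ 2)%Z.
  have -> : d * C * t ^+ 2 = d * q s t - (A * s + B * t) * (d * s) by rewrite /qq; ring.
  by rewrite rpredB // dvdz_mull.
have h4 : (g%:Z %| d * C * s ^+ 2)%Z.
  have -> : d * C * s ^+ 2 = C * s * (d * s) by ring.
  by rewrite dvdz_mull.
have k (u : int) : ~~ (p%:Z %| u)%Z -> (g%:Z %| d * C * u ^+ 2)%Z -> (g%:Z %| d * C)%Z.
  rewrite !dvdzE /= => pu; rewrite abszM abszX Gauss_dvdl //.
  by rewrite coprimeXl // coprimeXr // prime_coprime.
by move: st; rewrite /prm negb_and => /orP[/k|/k]; apply.
Qed.

Lemma prim_dvd_le i s t : prm s t -> ((p ^ i)%N%:Z %| q s t)%Z -> ((p ^ i)%N%:Z %| d * s)%Z ->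
  (p ^ i <= N0)%N.
Proof. by move=> h1 h2 h3; apply: dvdn_leq => //; have := prim_dvd h1 h2 h3; rewrite dvdzE. Qed.

Definition al N (s : int) : nat := gcdn `|(d * s)%R| (p ^ N).
(** By [lincong], the number of [x] modulo [p ^ N] for which [p ^ N] divides [d s x + p ^ j q(s,t)];
    the closed form shows how it depends on [N]. *)
Definition w N j (s t : int) : R :=
  (al N s)%:R * ((al N s)%:Z %| (p ^ j)%N%:Z * q s t)%Z%:R.

Lemma al_pow N s : exists2 i, (i <= N)%N & al N s = (p ^ i)%N.
Proof. by apply/dvdn_pfactor => //; rewrite dvdn_gcdr. Qed.

Lemma al_stable m N s : (m <= N)%N -> ~~ ((p ^ m)%N%:Z %| d * s)%Z -> al N s = al m s.
Proof.
move=> mN nd; apply/eqP; rewrite eqn_dvd; apply/andP; split.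
  rewrite dvdn_gcd dvdn_gcdl /=; have [i iN e] := al_pow N s; rewrite e.
  rewrite dvdn_exp2l // leqNgt; apply: contra nd => mi.
  rewrite dvdzE /=; apply: dvdn_trans (dvdn_gcdl _ (p ^ N)); rewrite -/(al N s) e.
  by rewrite dvdn_exp2l // ltnW.
by rewrite dvdn_gcd dvdn_gcdl /=; apply: dvdn_trans (dvdn_gcdr _ _) _; rewrite dvdn_exp2l.
Qed.

(** If [p ^ m] does not divide [d s], then [al] is the same at levels [m] and [N]. If it does, a
    nonzero value would make [p ^ (m - j)] divide both [q(s,t)] and [d s], hence be at most [N0];
    but [m - j >= N0] and a power of [p] exceeds its exponent. *)
Lemma w_stable K m N j s t : m = (K + N0)%N -> (j < K)%N -> (m <= N)%N -> prm s t ->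
  w N j s t = w m j s t.
Proof.
move=> mE jK mN st; have [h|h] := boolP ((p ^ m)%N%:Z %| d * s)%Z; last first.
  by rewrite /w (al_stable mN h).
have z M : (m <= M)%N -> w M j s t = 0.
  move=> mM; rewrite /w; case: (boolP (_ %| _ * _)%Z) => [h2|]; last by rewrite mulr0.
  have pm : ((p ^ m)%N%:Z %| (p ^ j)%N%:Z * q s t)%Z.
    apply: dvdz_trans h2; rewrite dvdzE /= dvdn_gcd dvdn_exp2l // andbT.
    by move: h; rewrite dvdzE.
  have mj : (m = j + (m - j))%N.
    by rewrite subnKC // mE; apply: leq_trans (ltnW jK) (leq_addr _ _).
  have q1 : ((p ^ (m - j))%N%:Z %| q s t)%Z.
    by move: pm; rewrite !dvdzE abszM /= {1}mj expnD dvdn_pmul2l ?pX_gt0.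
  have q2 : ((p ^ (m - j))%N%:Z %| d * s)%Z.
    by apply: dvdz_trans h; rewrite dvdzE /= dvdn_exp2l // leq_subr.
  have hh := leq_trans (ltn_expl (m - j) p1) (prim_dvd_le st q1 q2).
  by rewrite mE sub_lt_false in hh.
by rewrite !z.
Qed.

Lemma w_periodic m j : periodic2 (p ^ m) (w m j).
Proof.
move=> s t s' t' h1 h2; rewrite /w.
have e : al m s = al m s' by apply: gcd_congr; rewrite -mulrBr dvdz_mull.
rewrite e; congr (_ * (nat_of_bool _)%:R); apply: dvdz_congr.
rewrite -mulrBr dvdz_mull //; apply: dvdz_trans (qq_mod h1 h2).
by rewrite dvdzE /= dvdn_gcdr.
Qed.

Lemma prm_periodic m : (0 < m)%N -> forall s t s' t' : int,
  ((p ^ m)%N%:Z %| s - s')%Z -> ((p ^ m)%N%:Z %| t - t')%Z -> prm s t = prm s' t'.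
Proof.
move=> m0 s t s' t' h1 h2; rewrite /prm.
have pd x : ((p ^ m)%N%:Z %| x)%Z -> (p%:Z %| x)%Z.
  by apply: dvdz_trans; rewrite dvdzE /= dvdn_exp.
by rewrite (dvdz_congr (pd _ h1)) (dvdz_congr (pd _ h2)).
Qed.

(** The fibre over [(y, z)] of the count [Nstar], in normal coordinates. *)
Definition Rc n (y z : int) : R := sumP (p ^ n) (fun x =>
  (((p ^ n)%N%:Z %| d * y * x + q y z)%Z && ~~ [&& (p%:Z %| x)%Z, (p%:Z %| y)%Z & (p%:Z %| z)%Z])%:R).

Lemma Rc0 n y z : prm y z -> Rc n y z = w n 0 y z.
Proof.
move=> st; rewrite /w expn0 mul1r -lincong ?pX_gt0 //; apply: sumP_ext => x.
by rewrite (_ : [&& _, _ & _] = false) ?andbT //; apply/negbTE; move: st; rewrite /prm; apply: contra => /and3P[_ -> ->].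
Qed.

(** A factor [p ^ k] cancels from the congruence, which then depends only on [x] modulo
    [p ^ (n - k)]. Primitivity now requires [x] to be prime to [p]: the solutions divisible by [p],
    counted after cancelling one more [p], are subtracted. *)
Lemma Rck n k s t : (0 < k)%N -> (k < n)%N ->
  Rc n ((p ^ k)%N%:Z * s) ((p ^ k)%N%:Z * t) =
  (p ^ k)%N%:R * (w (n - k) k s t - w (n - k).-1 k.-1 s t).
Proof.
move=> k0 kn; pose N' := (n - k)%N; have N'0 : (0 < N')%N by rewrite subn_gt0.
pose h (x : int) : bool := ((p ^ N')%N%:Z %| d * s * x + (p ^ k)%N%:Z * q s t)%Z.
have nE : (p ^ n = p ^ k * p ^ N')%N by rewrite -expnD subnKC // ltnW.
have hp (u : int) : (p%:Z %| (p ^ k)%N%:Z * u)%Z by rewrite dvdz_mulr // dvdzE /= dvdn_exp.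
have pk0 : (p ^ k)%N%:Z != 0 by rewrite eqz_nat -lt0n pX_gt0.
have E x : ((p ^ n)%N%:Z %| d * ((p ^ k)%N%:Z * s) * x + q ((p ^ k)%N%:Z * s) ((p ^ k)%N%:Z * t))%Z = h x.
  have -> : d * ((p ^ k)%N%:Z * s) * x + q ((p ^ k)%N%:Z * s) ((p ^ k)%N%:Z * t) =
     (p ^ k)%N%:Z * (d * s * x + (p ^ k)%N%:Z * q s t) by rewrite qq_scale; ring.
  by rewrite /h !dvdzE abszM /= nE dvdn_pmul2l ?pX_gt0.
rewrite /Rc nE.
have hper : periodic (p ^ N') (fun x => (h x && ~~ (p%:Z %| x)%Z)%:R : R).
  move=> x y xy; congr (nat_of_bool (_ && ~~ _))%:R.
    apply: dvdz_congr; rewrite (_ : _ - _ = d * s * (x - y)) ?dvdz_mull //; ring.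
  by apply: dvdz_congr; apply: dvdz_trans xy; rewrite dvdzE /= dvdn_exp.
transitivity (sumP (p ^ k * p ^ N') (fun x => (h x && ~~ (p%:Z %| x)%Z)%:R : R)).
  by apply: sumP_ext => x; rewrite -nE E !hp !andbT.
rewrite sumP_periodic //; congr (_ * _).
have sp (x : int) : (h x && ~~ (p%:Z %| x)%Z)%:R = (h x)%:R - (p%:Z %| x)%Z%:R * (h x)%:R :> R.
  by case: (h x); case: (_ %| _)%Z; rewrite ?mulr1 ?mulr0 ?subr0 ?subrr.
rewrite (sumP_ext _ sp) sumP_sub; congr (_ - _).
  by rewrite /w -lincong ?pX_gt0.
have NE : (p ^ N' = p ^ N'.-1 * p)%N by rewrite -expnSr prednK.
rewrite NE sumP_mult // /w -lincong ?pX_gt0 //; apply: sumP_ext => x.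
congr (nat_of_bool _)%:R; rewrite /h.
have kE : (p ^ k = p * p ^ k.-1)%N by rewrite -expnS prednK.
have -> : d * s * (p%:Z * x) + (p ^ k)%N%:Z * q s t = p%:Z * (d * s * x + (p ^ k.-1)%N%:Z * q s t).
  by rewrite kE PoszM; ring.
by rewrite NE mulnC !dvdzE abszM /= dvdn_pmul2l.
Qed.

(** The contribution to the count of the pairs [(y, z)] divisible by [p ^ k]; in [Pk] the power is
    exact. *)
Definition Sk n k : R := sum2 (p ^ (n - k)) (fun s t => Rc n ((p ^ k)%N%:Z * s) ((p ^ k)%N%:Z * t)).
Definition Pk n k : R := sum2 (p ^ (n - k))
  (fun s t => (prm s t)%:R * Rc n ((p ^ k)%N%:Z * s) ((p ^ k)%N%:Z * t)).

Lemma Sk_rec n k : (k < n)%N -> Sk n k = Pk n k + Sk n k.+1.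
Proof.
move=> kn; rewrite /Sk /Pk.
have -> : (p ^ (n - k) = p ^ (n - k.+1) * p)%N by rewrite -expnSr -subSn.
rewrite sum2_split //; congr (_ + _); apply: sum2_ext => s t.
by rewrite expnSr PoszM !mulrA.
Qed.

Lemma Sk_sum n K : (K <= n)%N -> Sk n 0 = \sum_(0 <= k < K) Pk n k + Sk n K.
Proof.
elim: K => [|K IH] Kn; first by rewrite big_geq // add0r.
by rewrite IH ?(ltnW Kn) // big_nat_recr //= -addrA -Sk_rec.
Qed.

Definition avg m (f : int -> int -> R) : R :=
  sum2 (p ^ m) (fun s t => (prm s t)%:R * f s t) / (p%:R ^+ m) ^+ 2.

Let pR : (0 : R) < p%:R. Proof. by rewrite ltr0n. Qed.

Lemma avg_stable m n f : (0 < m)%N -> (m <= n)%N -> periodic2 (p ^ m) f -> avg n f = avg m f.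
Proof.
move=> m0 mn fp; rewrite /avg.
have -> : (p ^ n = p ^ (n - m) * p ^ m)%N by rewrite -expnD subnK.
rewrite sum2_periodic; last first.
  by move=> s t s' t' h1 h2; rewrite (fp _ _ _ _ h1 h2) (prm_periodic m0 h1 h2).
have -> : p%:R ^+ n = p%:R ^+ (n - m) * p%:R ^+ m :> R by rewrite -exprD subnK.
by rewrite natrX; field; rewrite !expf_neq0 // gt_eqF.
Qed.

Lemma avg_add m f g : avg m (fun s t => f s t + g s t) = avg m f + avg m g.
Proof.
rewrite /avg -mulrDl -sum2_add; congr (_ / _); apply: sum2_ext => s t; by rewrite mulrDr.
Qed.

Lemma avg_scale m c f : avg m (fun s t => c * f s t) = c * avg m f.
Proof.
by rewrite /avg mulrA -sum2_scale; congr (_ / _); apply: sum2_ext => s t; rewrite mulrCA.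
Qed.

(** Normalised by [p ^ (2 n)], the contribution of the exact power [p ^ k] no longer depends on [n]:
    [w_stable] freezes the counts at level [m], and having [p ^ (2 k)] times fewer pairs against the
    factor [p ^ k] of [Rck] leaves [p ^ - k]. *)
Lemma Pk_avg K m n k : m = (K + N0)%N -> (k < K)%N -> (m + K < n)%N ->
  Pk n k / (p%:R ^+ n) ^+ 2 =
  if k == 0%N then avg m (w m 0) else
  p%:R ^- k * avg m (fun s t => w m k s t - w m k.-1 s t).
Proof.
move=> mE kK mn.
have m0 : (0 < m)%N by rewrite mE addn_gt0 N00 orbT.
case: k kK => [|k] kK /=.
  rewrite /Pk subn0 expn0.
  transitivity (avg n (w m 0)); last first.
    by apply: avg_stable => //; [lia|exact: w_periodic].
  rewrite /avg; congr (_ / _); apply: sum2_ext => s t; rewrite !mul1r.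
  have [st|_] := boolP (prm s t); last by rewrite !mul0r.
  by rewrite Rc0 // (w_stable mE) //; lia.
transitivity (p%:R ^- k.+1 * avg (n - k.+1) (fun s t => w m k.+1 s t - w m k s t)); last first.
  congr (_ * _); apply: avg_stable => //; first lia.
  by move=> s t s' t' h1 h2; rewrite (w_periodic _ h1 h2) (w_periodic k h1 h2).
rewrite /avg /Pk.
transitivity (sum2 (p ^ (n - k.+1)) (fun s t => (p ^ k.+1)%N%:R * ((prm s t)%:R * (w m k.+1 s t - w m k s t))) / (p%:R ^+ n) ^+ 2).
  congr (_ / _); apply: sum2_ext => s t.
  have [st|_] := boolP (prm s t); last by rewrite !mul0r mulr0.
  rewrite Rck //; last lia.
  by rewrite !mul1r (w_stable mE _ _ st) ?(@w_stable K m (n - k.+1).-1 k s t) //; lia.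
rewrite sum2_scale natrX.
have -> : p%:R ^+ n = p%:R ^+ k.+1 * p%:R ^+ (n - k.+1) :> R by rewrite -exprD subnKC //; lia.
by field; rewrite !expf_neq0 // gt_eqF.
Qed.

Lemma pow_cancel i (j : nat) (x : int) : ((p ^ (j + i))%N%:Z %| (p ^ j)%N%:Z * x)%Z = ((p ^ i)%N%:Z %| x)%Z.
Proof. by rewrite !dvdzE abszM /= expnD dvdn_pmul2l ?pX_gt0. Qed.

Definition gq m (s t : int) : R := (gcdn (al m s) `|q s t|)%:R.

(** As [k] grows, [w m k] jumps once, from 0 to [al = p ^ i], at the first [k] for which [p ^ i]
    divides [p ^ k q(s,t)]. Weighted by [p ^ - k] the jump is [p ^ (i - k)], the gcd of [al] and
    [q(s,t)]. *)
Lemma w_telescope m K s t : (0 < K)%N ->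
  w m 0 s t + \sum_(1 <= k < K) p%:R ^- k * (w m k s t - w m k.-1 s t) =
  gq m s t * ((al m s)%:Z %| (p ^ K.-1)%N%:Z * q s t)%Z%:R.
Proof.
case: K => // K _; elim: K => [|K IH].
  rewrite big_geq // addr0 /= /w /gq expn0 mul1r.
  case: (boolP (_ %| q s t)%Z) => [h|]; last by rewrite !mulr0.
  by congr (_%:R * _); apply/esym/gcdn_idPl; rewrite dvdzE in h.
rewrite big_nat_recr //= addrA IH /= /w /gq.
have [i im e] := al_pow m s; rewrite e.
case: (boolP ((p ^ i)%N%:Z %| (p ^ K)%N%:Z * q s t)%Z) => [h1|h1].
  have -> : ((p ^ i)%N%:Z %| (p ^ K.+1)%N%:Z * q s t)%Z.
    by rewrite expnS PoszM -mulrA dvdz_mull.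
  by rewrite subrr mulr0 addr0.
case: (boolP ((p ^ i)%N%:Z %| (p ^ K.+1)%N%:Z * q s t)%Z) => [h2|h2]; last first.
  by rewrite !mulr0 subrr mulr0 addr0.
rewrite !mulr0 !mulr1 subr0 add0r.
have Ki : (K < i)%N.
  rewrite ltnNge; apply: contra h1 => iK; rewrite dvdz_mulr // dvdzE /= dvdn_exp2l //.
have iE : i = (K.+1 + (i - K.+1))%N by rewrite subnKC.
have q1 : ((p ^ (i - K.+1))%N%:Z %| q s t)%Z by rewrite -(pow_cancel _ K.+1) -iE.
have q2 : ~~ ((p ^ (i - K))%N%:Z %| q s t)%Z by rewrite -(pow_cancel _ K) subnKC // ltnW.
have g : gcdn (p ^ i) `|q s t| = (p ^ (i - K.+1))%N.
  have [j ji je] : exists2 j, (j <= i)%N & gcdn (p ^ i) `|q s t| = (p ^ j)%N.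
    by apply/dvdn_pfactor => //; rewrite dvdn_gcdl.
  apply/eqP; rewrite eqn_dvd; apply/andP; split; last first.
    by rewrite dvdn_gcd dvdn_exp2l ?leq_subr //=; move: q1; rewrite dvdzE.
  rewrite je dvdn_exp2l //; have := leqnn (i - K.+1); rewrite leqNgt => _.
  rewrite leqNgt; apply: contra q2 => hj; rewrite dvdzE /=.
  apply: dvdn_trans (dvdn_gcdr (p ^ i) _); rewrite je dvdn_exp2l //.
  by rewrite -subSS subSn.
rewrite g !natrX {1}iE exprD mulKf // expf_neq0 // gt_eqF //.
Qed.

Lemma avg_ext m f g : (forall s t, f s t = g s t) -> avg m f = avg m g.
Proof. by move=> h; rewrite /avg; congr (_ / _); apply: sum2_ext => s t; rewrite h. Qed.

Lemma sum_Pk K m n : m = (K + N0)%N -> (0 < K)%N -> (m + K < n)%N ->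
  (\sum_(0 <= k < K) Pk n k) / (p%:R ^+ n) ^+ 2 =
  avg m (fun s t => gq m s t * ((al m s)%:Z %| (p ^ K.-1)%N%:Z * q s t)%Z%:R).
Proof.
move=> mE K0 mn.
have -> : avg m (fun s t => gq m s t * ((al m s)%:Z %| (p ^ K.-1)%N%:Z * q s t)%Z%:R) =
   avg m (fun s t => w m 0 s t + \sum_(1 <= k < K) p%:R ^- k * (w m k s t - w m k.-1 s t)).
  by apply: avg_ext => s t; rewrite w_telescope.
have avs (r : seq nat) (G : nat -> int -> int -> R) :
   avg m (fun s t => \sum_(k <- r) G k s t) = \sum_(k <- r) avg m (G k).
  elim: r => [|k r IHr].
    rewrite big_nil; rewrite (@avg_ext m _ (fun s t => 0 * 0)) => [|s t]; last by rewrite big_nil mulr0.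
    by rewrite avg_scale mul0r.
  rewrite big_cons -IHr -avg_add; apply: avg_ext => s t; by rewrite big_cons.
rewrite avg_add avs mulr_suml big_ltn // (Pk_avg mE) //= ; congr (_ + _).
apply: eq_big_nat => k /andP[k1 kK]; rewrite (Pk_avg mE) // gtn_eqF //.
by rewrite avg_scale.
Qed.

Let de : nat := logn p `|d|.

(** Here [p ^ K] divides [y] and [z], so [x] is prime to [p]. For fixed [x] and [t], cancelling
    [p ^ K] leaves a polynomial in [s] whose difference at two solutions is [s - s1] times a factor
    of valuation exactly [de], because [de < K]; hence at most [p ^ de] solutions. *)
Lemma SK_le n K : (de < K)%N -> (K + de <= n)%N -> Sk n K <= `|d|%N%:R * (p%:R ^+ n) ^+ 2 / p%:R ^+ K.
Proof.
move=> dK Kn; rewrite /Sk /Rc /sum2.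
have K0 : (0 < K)%N by apply: leq_ltn_trans dK.
pose N' := (n - K)%N.
pose h (s t x : int) : bool := ((p ^ n)%N%:Z %| d * ((p ^ K)%N%:Z * s) * x + q ((p ^ K)%N%:Z * s) ((p ^ K)%N%:Z * t))%Z.
have step t x : ~~ (p%:Z %| x)%Z -> sumP (p ^ N') (fun s => (h s t x)%:R) <= (p ^ de)%N%:R :> R.
  move=> px; case: (pselect (exists s1 : int, h s1 t x)) => [[s1 h1]|ne]; last first.
    rewrite (@sumP_ext _ _ _ (fun=> 0)) => [|s]; first by rewrite sumP_cst mulr0.
    by case: (boolP (h s t x)) => // hs; case: ne; exists s.
  have imp s : h s t x -> ((p ^ (N' - de))%N%:Z %| s - s1)%Z.
    move=> h2; pose u := d * x + (p ^ K)%N%:Z * (A * (s + s1) + B * t).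
    have : ((p ^ n)%N%:Z %| (p ^ K)%N%:Z * ((s - s1) * u))%Z.
      have -> : (p ^ K)%N%:Z * ((s - s1) * u) =
         (d * ((p ^ K)%N%:Z * s) * x + q ((p ^ K)%N%:Z * s) ((p ^ K)%N%:Z * t))
        - (d * ((p ^ K)%N%:Z * s1) * x + q ((p ^ K)%N%:Z * s1) ((p ^ K)%N%:Z * t)).
        by rewrite /u /qq; ring.
      exact: rpredB.
    have nE : n = (K + N')%N by rewrite subnKC //; apply: leq_trans (leq_addr _ _) Kn.
    rewrite {1}nE pow_cancel => h3.
    have dE : `|d|%N = (p ^ de * (`|d| %/ p ^ de))%N by rewrite mulnC divnK // pfactor_dvdnn.
    have d'p : ~~ (p %| `|d| %/ p ^ de)%N.
      apply/negP => /dvdnP[c cE]; have : (p ^ de.+1 %| `|d|)%N.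
        by rewrite dE cE expnSr dvdn_mul // dvdn_mull.
      by rewrite pfactor_dvdn ?absz_gt0 ?gt_eqF // ltnn.
    have [v uE pv] : exists2 v : int, u = (p ^ de)%N%:Z * v & ~~ (p%:Z %| v)%Z.
      have dzE : d = (p ^ de)%N%:Z * (`|d| %/ p ^ de)%N%:Z by rewrite -PoszM -dE gtz0_abs.
      have KE : (p ^ K = p ^ de * p ^ (K - de))%N by rewrite -expnD subnKC // ltnW.
      exists ((`|d| %/ p ^ de)%N%:Z * x + (p ^ (K - de))%N%:Z * (A * (s + s1) + B * t)).
        by rewrite /u {1}dzE KE PoszM; ring.
      rewrite rpredDr; last by rewrite dvdz_mulr // dvdzE /= dvdn_exp // subn_gt0.
      by rewrite dvdzE abszM /= Euclid_dvdM // negb_or d'p; move: px; rewrite dvdzE.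
    have N'E : N' = (de + (N' - de))%N by rewrite subnKC // /N' leq_subRL // (leq_trans (leq_addr _ _) Kn).
    move: h3; rewrite uE mulrCA {1}N'E pow_cancel !dvdzE abszM /= Gauss_dvdl //.
    by rewrite coprimeXl // prime_coprime.
  have N'E : (p ^ N' = p ^ de * p ^ (N' - de))%N.
    by rewrite -expnD subnKC // /N' leq_subRL // (leq_trans (leq_addr _ _) Kn).
  rewrite N'E.
  apply: le_trans (_ : _ <= sumP (p ^ de * p ^ (N' - de)) (fun s => ((p ^ (N' - de))%N%:Z %| s - s1)%Z%:R)) _.
    by apply: sumP_le => s; rewrite ler_nat; case: (boolP (h s t x)) => // /imp ->.
  rewrite sumP_periodic ?dvd_count ?pX_gt0 ?mulr1 // => x' y' xy; congr (nat_of_bool _)%:R.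
  by apply: dvdz_congr; rewrite opprB addrA subrK.
rewrite sumP_exchange -/N'.
apply: le_trans (_ : _ <= sumP (p ^ N') (fun t => sumP (p ^ n) (fun x => (p ^ de)%N%:R))) _.
  apply: sumP_le => t; rewrite sumP_exchange; apply: sumP_le => x.
  have pK (u : int) : (p%:Z %| (p ^ K)%N%:Z * u)%Z by rewrite dvdz_mulr // dvdzE /= dvdn_exp.
  have [px|px] := boolP (p%:Z %| x)%Z.
    rewrite (@sumP_ext _ _ _ (fun=> 0)) => [|s]; first by rewrite sumP_cst mulr0.
    by rewrite !pK /= andbF.
  apply: le_trans (step t x px); apply: sumP_le => s; rewrite ler_nat /h.
  by rewrite /= andbT.
rewrite !sumP_cst.
have pd : (p ^ de)%N%:R <= `|d|%N%:R :> R.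
  by rewrite ler_nat; apply: dvdn_leq; rewrite ?absz_gt0 ?gt_eqF // pfactor_dvdnn.
have e : (p ^ N')%N%:R * ((p ^ n)%N%:R * (p ^ de)%N%:R) = (p ^ de)%N%:R * ((p%:R ^+ n) ^+ 2 / p%:R ^+ K) :> R.
  have -> : p%:R ^+ n = p%:R ^+ N' * p%:R ^+ K :> R.
    by rewrite -exprD subnK // (leq_trans (leq_addr _ _) Kn).
  have nE : (p ^ n)%N%:R = p%:R ^+ N' * p%:R ^+ K :> R.
    by rewrite natrX -exprD subnK // (leq_trans (leq_addr _ _) Kn).
  by rewrite nE !natrX; field; rewrite !expf_neq0 // gt_eqF.
by rewrite e -mulrA ler_wpM2r // divr_ge0 // ?exprn_ge0 // ?exprn_ge0.
Qed.

Lemma gq_le m s t : prm s t -> gq m s t <= N0%:R.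
Proof.
move=> st; rewrite ler_nat /=.
have [i im e] : exists2 i, (i <= m)%N & gcdn (al m s) `|q s t| = (p ^ i)%N.
  by apply/dvdn_pfactor => //; apply: dvdn_trans (dvdn_gcdl _ _) (dvdn_gcdr _ _).
rewrite e; apply: (prim_dvd_le st); rewrite dvdzE /= -e ?dvdn_gcdr //.
exact: dvdn_trans (dvdn_gcdl _ _) (dvdn_gcdl _ _).
Qed.

(** Only pairs with [p ^ K] dividing [al], hence [d s], contribute to the difference. They form a
    proportion at most [|d| / p ^ K], and [gq] is at most [N0] on primitive pairs. *)
Lemma avg_diff m K : (0 < K)%N -> (K <= m)%N ->
  0 <= avg m (gq m) - avg m (fun s t => gq m s t * ((al m s)%:Z %| (p ^ K.-1)%N%:Z * q s t)%Z%:R)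
    <= N0%:R * `|d|%N%:R / p%:R ^+ K.
Proof.
move=> K0 Km.
have -> : avg m (gq m) - avg m (fun s t => gq m s t * ((al m s)%:Z %| (p ^ K.-1)%N%:Z * q s t)%Z%:R) =
  avg m (fun s t => gq m s t * (~~ ((al m s)%:Z %| (p ^ K.-1)%N%:Z * q s t)%Z)%:R).
  rewrite -mulN1r -avg_scale -avg_add; apply: avg_ext => s t.
  by case: (_ %| _)%Z; rewrite /= ?mulr1 ?mulr0 ?addr0 ?mulN1r ?subrr.
have pm0 : (0 : R) < (p%:R ^+ m) ^+ 2 by rewrite !exprn_gt0.
apply/andP; split.
  by rewrite /avg divr_ge0 ?exprn_ge0 //; apply: sum2_ge0 => s t; rewrite !mulr_ge0.
rewrite /avg ler_pdivrMr //.
apply: le_trans (_ : _ <= sum2 (p ^ m) (fun s t => N0%:R * ((p ^ K)%N%:Z %| d * s)%Z%:R)) _.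
  apply: sum2_le => s t; have [st|_] := boolP (prm s t); last by rewrite mul0r mulr_ge0.
  rewrite mul1r; apply: ler_pM => //; first exact: gq_le.
  rewrite ler_nat; case: (boolP (_ %| _ * q s t)%Z) => //= nd.
  have [i im e] := al_pow m s; rewrite e in nd.
  have Ki : (K <= i)%N.
    rewrite leqNgt; apply: contra nd => iK; rewrite dvdz_mulr // dvdzE /= dvdn_exp2l //.
    by rewrite -ltnS prednK.
  suff -> : ((p ^ K)%N%:Z %| d * s)%Z by [].
  rewrite dvdzE /=; apply: dvdn_trans (dvdn_gcdl _ (p ^ m)); rewrite -/(al m s) e.
  by rewrite dvdn_exp2l.
rewrite sum2_scale /sum2 -mulrA -mulrA ler_wpM2l //.
rewrite (@sumP_ext _ _ _ (fun s => (p ^ m)%N%:R * ((p ^ K)%N%:Z %| d * s)%Z%:R)) => [|s]; last by rewrite sumP_cst.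
rewrite sumP_scale.
have -> : sumP (p ^ m) (fun s => ((p ^ K)%N%:Z %| d * s)%Z%:R) = (p ^ (m - K))%N%:R * (gcdn `|d| (p ^ K))%:R :> R.
  have mE : (p ^ m = p ^ (m - K) * p ^ K)%N by rewrite -expnD subnK.
  rewrite mE sumP_periodic; last first.
    by move=> x y xy; congr (nat_of_bool _)%:R; apply: dvdz_congr; rewrite -mulrBr dvdz_mull.
  congr (_ * _); rewrite (@sumP_ext _ _ _ (fun s => ((p ^ K)%N%:Z %| d * s + 0)%Z%:R)) => [|s]; last by rewrite addr0.
  by rewrite lincong ?pX_gt0 // dvdz0 mulr1.
have gd : (gcdn `|d| (p ^ K))%:R <= `|d|%N%:R :> R.
  by rewrite ler_nat; apply: dvdn_leq; rewrite ?absz_gt0 ?gt_eqF // dvdn_gcdl.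
have e : (p ^ m)%N%:R * (p ^ (m - K))%N%:R = (p%:R ^+ m) ^+ 2 / p%:R ^+ K :> R.
  have -> : p%:R ^+ m = p%:R ^+ (m - K) * p%:R ^+ K :> R by rewrite -exprD subnK.
  have -> : (p ^ m)%N%:R = p%:R ^+ (m - K) * p%:R ^+ K :> R by rewrite natrX -exprD subnK.
  by rewrite !natrX; field; rewrite !expf_neq0 // gt_eqF.
rewrite mulrA e.
have -> : `|d|%N%:R / p%:R ^+ K * (p%:R ^+ m) ^+ 2 = (p%:R ^+ m) ^+ 2 / p%:R ^+ K * `|d|%N%:R :> R by ring.
by rewrite ler_wpM2l // divr_ge0 // ?exprn_ge0 // exprn_ge0.
Qed.

(** On primitive pairs the gcd of [q(s,t)], [d s] and [p ^ m] already divides [p ^ v], by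
    [prim_dvd], and the average of a periodic function does not depend on the level. *)
Lemma avg_gam v m : (0 < v)%N -> (logn p N0 <= v)%N -> (v <= m)%N ->
  avg m (gq m) = Gam (p ^ v) / (p%:R ^+ v) ^+ 2.
Proof.
move=> v0 Nv vm.
have -> : Gam (p ^ v) / (p%:R ^+ v) ^+ 2 = avg v (gam1 (p ^ v)).
  rewrite /avg /Gam; congr (_ / _); apply: sum2_ext => s t; rewrite /gam1.
  have -> : coprime (gcdn `|s| `|t|) (p ^ v) = prm s t.
    by rewrite coprime_pexpr // coprime_sym prime_coprime // dvdn_gcd /prm !dvdzE.
  by case: (prm _ _); rewrite ?mul1r ?mul0r.
rewrite -(@avg_stable v m) //; last exact: gam1_periodic.
rewrite /avg; congr (_ / _); apply: sum2_ext => s t.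
have [st|_] := boolP (prm s t); last by rewrite !mul0r.
congr (_ * _); rewrite /gam1 /gq.
have -> : coprime (gcdn `|s| `|t|) (p ^ v).
  by rewrite coprime_pexpr // coprime_sym prime_coprime // dvdn_gcd; move: st; rewrite /prm !dvdzE.
rewrite mul1r; congr _%:R; rewrite /al.
have -> : gcdn (gcdn `|(d * s)%R| (p ^ m)) `|q s t| = gcdn (gcdn `|q s t| `|(d * s)%R|) (p ^ m).
  by rewrite gcdnC gcdnA.
set g := gcdn `|q s t| _.
have [i im e] : exists2 i, (i <= m)%N & gcdn g (p ^ m) = (p ^ i)%N.
  by apply/dvdn_pfactor => //; rewrite dvdn_gcdr.
apply/eqP; rewrite eqn_dvd; apply/andP; split; last first.
  by rewrite dvdn_gcd dvdn_gcdl /=; apply: dvdn_trans (dvdn_gcdr _ _) _; rewrite dvdn_exp2l.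
rewrite dvdn_gcd dvdn_gcdl /= e dvdn_exp2l //.
apply: leq_trans Nv; rewrite -(@pfactor_dvdn p i N0) //.
have h1 : (p ^ i %| g)%N by rewrite -e dvdn_gcdl.
have := @prim_dvd i s t st; rewrite !dvdzE /=; apply.
  by apply: dvdn_trans h1 (dvdn_gcdl _ _).
by apply: dvdn_trans h1 (dvdn_gcdr _ _).
Qed.

(** Powers below [K] give the average of [gq] up to [avg_diff], and the rest is bounded by [SK_le].
    Both errors are [O(p ^ - K)] uniformly in large [n], so [K] is fixed first. *)
Lemma local_limit v : (0 < v)%N -> (logn p N0 <= v)%N ->
  (Sk n 0 / (p%:R ^+ n) ^+ 2 @[n --> \oo] --> Gam (p ^ v) / (p%:R ^+ v) ^+ 2)%classic.
Proof.
move=> v0 Nv; apply/cvgrPdist_le => e e0.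
pose c : R := (1 + N0%:R) * `|d|%N%:R.
have c0 : 0 <= c by rewrite mulr_ge0 // addr_ge0.
(* [c] gathers the constants of [avg_diff] and [SK_le]; since [p ^ K > K], the last entry makes
   [c / p ^ K <= e]. *)
pose K := (maxn de.+1 (maxn v (Num.truncn (c / e)).+1))%N.
have Kde : (de < K)%N by rewrite leq_maxl.
have Kv : (v <= K)%N by rewrite /K !leq_max leqnn orbT.
have Kc : c / p%:R ^+ K <= e.
  rewrite ler_pdivrMr ?exprn_gt0 // mulrC -ler_pdivrMr //.
  apply: le_trans (ltW (truncnS_gt (c / e))) _; rewrite -natrX ler_nat.
  by apply: leq_trans (ltnW (ltn_expl K p1)); rewrite /K !leq_max leqnn !orbT.
pose m := (K + N0)%N.
near=> n.
have mn : (m + K < n)%N by near: n; exists (m + K).+1.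
have K0 : (0 < K)%N by apply: leq_ltn_trans Kde.
have Kn : (K + de <= n)%N.
  apply: leq_trans (ltnW mn); rewrite addnC leq_add2r /m.
  by apply: leq_trans (ltnW Kde) (leq_addr _ _).
rewrite (@Sk_sum n K) ?(leq_trans (leq_addr de K) Kn) // mulrDl (sum_Pk (erefl m)) //.
have vm : (v <= m)%N by apply: leq_trans Kv (leq_addr _ _).
rewrite -(avg_gam v0 Nv vm).
have /andP[a1 a2] := avg_diff K0 (leq_addr N0 K : (K <= m)%N).
have pn0 : (0 : R) < (p%:R ^+ n) ^+ 2 by rewrite !exprn_gt0.
have s1 : 0 <= Sk n K / (p%:R ^+ n) ^+ 2.
  by rewrite divr_ge0 ?(ltW pn0) //; apply: sum2_ge0 => s t; apply: sumP_ge0.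
have s2 : Sk n K / (p%:R ^+ n) ^+ 2 <= `|d|%N%:R / p%:R ^+ K.
  rewrite ler_pdivrMr //; apply: le_trans (SK_le Kde Kn) _.
  by rewrite le_eqVlt; apply/orP; left; apply/eqP; rewrite mulrAC.
have cE : c / p%:R ^+ K = N0%:R * `|d|%N%:R / p%:R ^+ K + `|d|%N%:R / p%:R ^+ K.
  by rewrite /c; ring.
rewrite opprD addrA.
set u := avg m (gq m) - _ in a1 a2 *.
rewrite ler_norml; move: a1 a2 s1 s2 Kc; rewrite cE.
move: (N0%:R * `|d|%N%:R / p%:R ^+ K) (`|d|%N%:R / p%:R ^+ K) (Sk n K / _) u => x y z u.
by move=> *; apply/andP; split; lra.
Unshelve. all: by end_near.
Qed.
End Local.

(** * Sums over triples of residues and their invariance under shears *)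

Section Sum3.
Variable R : realFieldType.
Implicit Types f : int * int * int -> R.
Definition sum3P M f : R := sumP M (fun x => sumP M (fun y => sumP M (fun z => f (x, y, z)))).
Definition periodic3 M f := forall v w : int * int * int,
  (M%:Z %| v.1.1 - w.1.1)%Z -> (M%:Z %| v.1.2 - w.1.2)%Z -> (M%:Z %| v.2 - w.2)%Z -> f v = f w.

Lemma sum3P_ext M f g : (forall v, f v = g v) -> sum3P M f = sum3P M g.
Proof. by move=> h; do 3!apply: sumP_ext => ?. Qed.

Lemma sum3P_rot M f : sum3P M f = sumP M (fun y => sumP M (fun z => sumP M (fun x => f (x, y, z)))).
Proof. by rewrite /sum3P sumP_exchange; apply: sumP_ext => y; rewrite sumP_exchange. Qed.

Lemma periodic3_shear M f o : periodic3 M f -> periodic3 M (fun v => f (shear1 o v)).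
Proof.
move=> pf v w h1 h2 h3.
have k (a b x y x' y' : int) : (M%:Z %| x - x')%Z -> (M%:Z %| y - y')%Z ->
    (M%:Z %| (a * x + b * y) - (a * x' + b * y'))%Z.
  move=> hx hy; have -> : (a * x + b * y) - (a * x' + b * y') = a * (x - x') + b * (y - y') by ring.
  by rewrite rpredD // dvdz_mull.
have kk (x x' u u' : int) : (M%:Z %| x - x')%Z -> (M%:Z %| u - u')%Z -> (M%:Z %| x + u - (x' + u'))%Z.
  by move=> hx hu; rewrite opprD addrACA rpredD.
by apply: pf; case: o => a b //=; apply: kk => //; apply: k.
Qed.

Lemma sum3P_shear M f o : (0 < M)%N -> periodic3 M f -> sum3P M (fun v => f (shear1 o v)) = sum3P M f.
Proof.
move=> M0 pf; case: o => a b /=.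
- rewrite !sum3P_rot; apply: sumP_ext => y; apply: sumP_ext => z /=.
  rewrite (@sumP_shift R M (fun x => f (x, y, z))) // => x x' h.
  by apply: pf; rewrite //= subrr dvdz0.
- apply: sumP_ext => x; rewrite sumP_exchange [RHS]sumP_exchange; apply: sumP_ext => z /=.
  rewrite (@sumP_shift R M (fun y => f (x, y, z))) // => y y' h.
  by apply: pf; rewrite //= subrr dvdz0.
- apply: sumP_ext => x; apply: sumP_ext => y /=.
  rewrite (@sumP_shift R M (fun z => f (x, y, z))) // => z z' h.
  by apply: pf; rewrite //= subrr dvdz0.
Qed.

Lemma sum3P_act M f l : (0 < M)%N -> periodic3 M f -> sum3P M (fun v => f (act l v)) = sum3P M f.
Proof.
move=> M0; elim: l f => [|o l IH] f pf //.
rewrite -(sum3P_shear o M0 pf) -(IH (fun v => f (shear1 o v))) //.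
exact: periodic3_shear.
Qed.
End Sum3.

Definition FQ (Q : Ternary.polyZ) : qform int :=
  Form (Coefs.coef Q Coefs.i0 Coefs.i0) (Coefs.coef Q Coefs.i1 Coefs.i1) (Coefs.coef Q Coefs.i2 Coefs.i2)
    (Coefs.coef Q Coefs.i1 Coefs.i2) (Coefs.coef Q Coefs.i0 Coefs.i2) (Coefs.coef Q Coefs.i0 Coefs.i1).

Definition trip (S : Type) (x : 'cV[S]_3) : S * S * S := (x Coefs.i0 0, x Coefs.i1 0, x Coefs.i2 0).

Lemma eval_FQ (S : comNzRingType) (Q : Ternary.polyZ) (x : 'cV[S]_3) :
  Ternary.quadratic_form Q -> Ternary.eval Q x = ev (castF S (FQ Q)) (trip x).
Proof. by move=> hQ; rewrite Coefs.evalE // /ev /castF /trip /=; ring. Qed.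

Lemma eval_FQz (Q : Ternary.polyZ) (x : 'cV[int]_3) :
  Ternary.quadratic_form Q -> Ternary.eval Q x = ev (FQ Q) (trip x).
Proof. by move=> hQ; rewrite eval_FQ // /ev /castF /= !intz. Qed.

Lemma ev_mod (F : qform int) (M : nat) (v w : int * int * int) :
  (M%:Z %| v.1.1 - w.1.1)%Z -> (M%:Z %| v.1.2 - w.1.2)%Z -> (M%:Z %| v.2 - w.2)%Z ->
  (M%:Z %| ev F v - ev F w)%Z.
Proof.
move=> h1 h2 h3.
have -> : ev F v - ev F w =
  (fa F * (v.1.1 + w.1.1) + fg F * v.2 + fh F * v.1.2) * (v.1.1 - w.1.1)
  + (fb F * (v.1.2 + w.1.2) + ff F * v.2 + fh F * w.1.1) * (v.1.2 - w.1.2)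
  + (fc F * (v.2 + w.2) + ff F * w.1.2 + fg F * w.1.1) * (v.2 - w.2).
  by rewrite /ev; ring.
by rewrite !rpredD // dvdz_mull.
Qed.

(** * The product of the densities at the primes *)

Section LocalFactors.
Variables (R : realType) (Q : Ternary.polyZ) (l : seq shear) (d A B C : int).
Hypotheses (hQ : Ternary.quadratic_form Q) (d0 : 0 < d) (C0 : C != 0).
Hypothesis nfE : forall v, ev (FQ Q) (act l v) =
  d * v.1.1 * v.1.2 + A * v.1.2 ^+ 2 + B * v.1.2 * v.2 + C * v.2 ^+ 2.
Let N0 : nat := `|(d * C)%R|%N.
Let N00 : (0 < N0)%N. Proof. by rewrite absz_gt0 mulf_neq0 // gt_eqF. Qed.

Lemma Nstar_sum3 p n : prime p -> (Nstar Q p n)%:R = sum3P (p ^ n) (fun v =>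
  (((p ^ n)%N%:Z %| ev (FQ Q) v)%Z && ~~ (p %| gcd3 v)%N)%:R) :> R.
Proof.
move=> pp; set M := (p ^ n)%N.
pose b (v : int * int * int) : bool := (M%:Z %| ev (FQ Q) v)%Z && ~~ (p %| gcd3 v)%N.
rewrite /Nstar -/M -sum1_card natr_sum big_mkcond /=.
pose mk (q : 'I_M * ('I_M * 'I_M)) : 'cV['I_M]_3 :=
  \col_i (if i == Coefs.i0 then q.1 else if i == Coefs.i1 then q.2.1 else q.2.2).
pose un (x : 'cV['I_M]_3) := (x Coefs.i0 0, (x Coefs.i1 0, x Coefs.i2 0)).
rewrite (reindex mk) /=; last first.
  exists un => [q _|x _].
    by rewrite /un /mk !mxE /= !Coefs.eqI !eqxx; case: q => ? [].
  apply/matrixP => i j; rewrite mxE ord1; have [->|->|->] := Coefs.ord3 i;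
  by rewrite ?Coefs.eqI ?eqxx.
rewrite /sum3P /sumP big_mkord.
under [RHS]eq_bigr => i _ do rewrite big_mkord.
under [RHS]eq_bigr => i _ do under eq_bigr => j _ do rewrite big_mkord.
under [RHS]eq_bigr => i _ do rewrite pair_bigA /=.
rewrite pair_bigA /=; apply: eq_bigr => q _.
rewrite inE eval_FQz // /trip !mxE !Coefs.eqI !eqxx.
have -> : [forall i, (p %| mk q i 0%R)%N] = (p %| gcd3 ((q.1 : nat)%:Z, (q.2.1 : nat)%:Z, (q.2.2 : nat)%:Z))%N.
  rewrite dvdn_gcd3 /= !dvdzE /=; apply/forallP/and3P => [h|[h1 h2 h3] i].
    have := h Coefs.i0; have := h Coefs.i1; have := h Coefs.i2.
    by rewrite !mxE !Coefs.eqI !eqxx.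
  by rewrite mxE; have [->|->|->] := Coefs.ord3 i; rewrite ?Coefs.eqI ?eqxx.
by rewrite andbC; case: (_ && _).
Qed.

(** Shears permute the triples modulo [p ^ n] and respect primitivity, so the count may be made in
    normal coordinates. The case [n = 0] is separate: modulo 1, divisibility by [p] is not
    visible. *)
Lemma Nstar_Sk p n : prime p -> (Nstar Q p n)%:R = Sk R d A B C p n 0 :> R.
Proof.
move=> pp; have p0 := prime_gt0 pp; have M0 : (0 < p ^ n)%N by rewrite expn_gt0 p0.
rewrite Nstar_sum3 //; have [->|n0] := posnP n.
  rewrite /Sk /Rc /sum2 /sum3P /sumP ?subn0 !expn0 !big_nat1 /=; congr (nat_of_bool _)%:R.
  by rewrite !mul1r !dvd1z /= dvdn_gcd3 /= .
rewrite -(sum3P_act l M0); last first.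
  move=> v w h1 h2 h3; congr (nat_of_bool _)%:R; congr (_ && ~~ _).
    by apply: dvdz_congr; exact: ev_mod.
  have pd x : ((p ^ n)%N%:Z %| x)%Z -> (p%:Z %| x)%Z.
    by apply: dvdz_trans; rewrite dvdzE /= dvdn_exp.
  by rewrite !dvdn_gcd3 (dvdz_congr (pd _ h1)) (dvdz_congr (pd _ h2)) (dvdz_congr (pd _ h3)).
rewrite sum3P_rot /Sk subn0 /sum2; apply: sumP_ext => y; apply: sumP_ext => z.
rewrite expn0 !mul1r /Rc; apply: sumP_ext => x.
rewrite nfE gcd3_act dvdn_gcd3 /=; congr (nat_of_bool ((_ %| _)%Z && _))%:R.
by rewrite /qq; ring.
Qed.

Lemma sigma_Gam p v : prime p -> (0 < v)%N -> (logn p N0 <= v)%N ->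
  sigma R Q p = Gam R d A B C (p ^ v) / (p%:R ^+ v) ^+ 2.
Proof.
move=> pp v0 Nv; apply: cvg_lim => //.
have := @local_limit R d A B C d0 C0 p pp v v0 Nv; under eq_fun => n do rewrite -Nstar_Sk // -exprM [(n * 2)%N]mulnC.
by [].
Qed.

(** A prime outside [N0] cannot divide both [q(s,t)] and [d s] for a primitive pair, so all weights
    are 1 and every pair but [(0, 0)] counts. *)
Lemma Gam_prime p : prime p -> ~~ (p %| N0)%N -> Gam R d A B C p = p%:R ^+ 2 - 1.
Proof.
move=> pp pN; have p0 := prime_gt0 pp.
have -> : Gam R d A B C p = sum2 (1 * p) (fun s t => (~~ ((p%:Z %| s)%Z && (p%:Z %| t)%Z))%:R * 1).
  rewrite mul1n; apply: sum2_ext => s t; rewrite /gam1 mulr1.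
  have e : coprime (gcdn `|s| `|t|) p = ~~ ((p%:Z %| s)%Z && (p%:Z %| t)%Z).
    by rewrite coprime_sym prime_coprime // dvdn_gcd !dvdzE.
  rewrite e; case: (boolP (~~ _)) => st; last by rewrite mul0r.
  rewrite mul1r; have -> : gcdn (gcdn `|qq A B C s t| `|(d * s)%R|) p = 1%N; last by [].
  apply/eqP; rewrite -/(coprime _ _) coprime_sym prime_coprime //; apply: contra pN.
  rewrite dvdn_gcd => /andP[h1 h2].
  by have := @prim_dvd d A B C p pp 1 s t st; rewrite expn1 !dvdzE /=; apply.
have := @sum2_split R p 1 (fun _ _ => 1) p0.
rewrite [sum2 1 _]/sum2 /sumP !big_nat1 -/(sumP _ _) => h.
have e1 : sum2 (1 * p) (fun _ _ => 1) = p%:R ^+ 2 :> R by rewrite /sum2 !sumP_cst mul1n mulr1 expr2.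
by rewrite e1 in h; rewrite h addrK.
Qed.

(** It plays two roles: the value of the Moebius sum in [sieve_count], and the product of the
    densities at the primes not dividing [N0]. *)
Definition tailprod (y : nat) : R := \prod_(p <- ps N0 y) (1 - (p%:R ^+ 2)^-1).

Lemma fac01 p : prime p -> 0 <= (1 - (p%:R ^+ 2)^-1 : R) <= 1.
Proof.
move=> pp; have p1 : (1 : R) <= p%:R ^+ 2 by rewrite exprn_ege1 // ler1n prime_gt0.
have p0 : (0 : R) < p%:R ^+ 2 by apply: lt_le_trans p1.
by rewrite subr_ge0 invf_le1 // p1 /= gerBl invr_ge0 ltW.
Qed.

Lemma tailprod_cvg : exists T : R, tailprod y @[y --> \oo] --> T.
Proof.
exists (limn tailprod); apply: nonincreasing_is_cvgn.
  apply/nonincreasing_seqP => n; rewrite /tailprod /ps /index_iota !subn0 -addn1 iotaD filter_cat big_cat /= add0n.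
  case: ifP => [/andP[pp _]|_]; rewrite ?big_nil ?mulr1 // big_seq1 ler_piMr //.
  by rewrite big_seq prodr_ge0 // => p; rewrite mem_filter => /andP[/andP[/fac01/andP[]]].
exists 0 => _ [n _ <-]; rewrite /tailprod big_seq prodr_ge0 // => p.
by rewrite mem_filter => /andP[/andP[/fac01/andP[]]].
Qed.

Lemma Gam_prod k : Gam R d A B C (\prod_(0 <= p < k) p ^ logn p N0) =
  \prod_(0 <= p < k) Gam R d A B C (p ^ logn p N0).
Proof.
have pos p : (0 < p ^ logn p N0)%N.
  by rewrite expn_gt0; case: (posnP p) => [->|//]; rewrite lognE.
elim: k => [|k IH]; first by rewrite !big_geq // Gam1.
rewrite !big_nat_recr //= mulrC -IH -Gam_mul //.
- by rewrite big_seq; apply: (big_ind (fun x => 0 < x)%N) => // x y hx hy; rewrite muln_gt0 hx.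
rewrite big_seq; apply: (big_ind (fun x => coprime (k ^ logn k N0) x)) => [|x y|p].
- by rewrite coprimen1.
- by move=> hx hy; rewrite coprimeMr hx.
rewrite mem_index_iota => /= pk.
have [->|lk] := posnP (logn k N0); first by rewrite expn0 coprime1n.
have [->|lp] := posnP (logn p N0); first by rewrite expn0 coprimen1.
rewrite coprimeXl // coprimeXr //.
move: lk lp; rewrite !logn_gt0 !mem_primes => /andP[kp _] /andP[pp _].
by rewrite prime_coprime // dvdn_prime2 // gtn_eqF.
Qed.

(** At [p | N0] the level [v] may be the valuation of [N0], and multiplicativity gathers these
    factors into [Gam N0 / N0 ^ 2]; every other prime gives [1 - p ^ -2]. *)
Lemma prod_sigma n : (N0 < n)%N ->
  \prod_(p < n | prime p) sigma R Q p = Gam R d A B C N0 / N0%:R ^+ 2 * tailprod n.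
Proof.
move=> Nn.
have N0E : (\prod_(0 <= p < n) p ^ logn p N0)%N = N0.
  case: n Nn => // n Nn; have Nn' : (N0 <= n)%N by []. 
  rewrite -[RHS]partnT // (widen_partn _ Nn').
  by apply: eq_bigl => p.
have sqE : N0%:R ^+ 2 = \prod_(0 <= p < n) (p ^ logn p N0)%N%:R ^+ 2 :> R.
  by rewrite -{1}N0E natr_prod prodrXl.
rewrite -{1}N0E Gam_prod sqE -prodf_div /tailprod /ps big_filter [X in _ * X]big_mkcond /= -big_split /=.
rewrite -(big_mkord prime (fun p => sigma R Q p)) big_mkcond /=; apply: eq_bigr => p _.
case: (boolP (prime p)) => pp /=; last first.
  by rewrite lognE (negbTE pp) /= expn0 Gam1 expr1n divr1 mulr1.
have [pN|pN] := boolP (p %| N0)%N.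
  have l0 : (0 < logn p N0)%N by rewrite logn_gt0 mem_primes pp N00.
  by rewrite /= mulr1 (sigma_Gam pp l0 (leqnn _)) natrX.
have l0 : logn p N0 = 0%N by apply/eqP; rewrite -leqn0 leqNgt logn_gt0 mem_primes pp N00.
rewrite l0 expn0 Gam1 expr1n divr1 mul1r (@sigma_Gam p 1) ?l0 // expn1 expr1 Gam_prime //.
rewrite mulrBl mul1r divff // expf_neq0 // pnatr_eq0 -lt0n prime_gt0 //.
Qed.

Lemma local_product (T : R) : tailprod y @[y --> \oo] --> T ->
  lim ((\prod_(p < n | prime p) sigma R Q p) @[n --> \oo]) = Gam R d A B C N0 / N0%:R ^+ 2 * T.
Proof.
move=> cT; apply: cvg_lim => //.
have c2 : Gam R d A B C N0 / N0%:R ^+ 2 * tailprod n @[n --> \oo] --> Gam R d A B C N0 / N0%:R ^+ 2 * T.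
  by apply: cvgM => //; exact: cvg_cst.
apply: cvg_trans c2; apply: near_eq_cvg; exists N0.+1 => // n /= Nn.
by rewrite prod_sigma.
Qed.
End LocalFactors.

Lemma fine_scale (R : realType) (r : R) (x : \bar R) : 0 < r -> fine (r%:E * x)%E = r * fine x.
Proof.
move=> r0; case: x => [x| |] //=; first by rewrite gt0_muley ?lte_fin //= mulr0.
by rewrite gt0_muleNy ?lte_fin //= mulr0.
Qed.

(** * Integrals for the real density *)

Section IntegralTools.
Variable R : realType.
Notation mu := (@leb1 R).

Lemma measurable_inbox (D : R) : measurable_fun setT (fun y : R => (inbox D y)%:R%:E : \bar R).
Proof. by apply: measurable_boolE; exact: mbox_bool. Qed.

Lemma measurable_abs (dd : measure_display) (T : measurableType dd) (f : T -> R) :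
  measurable_fun setT f -> measurable_fun setT (fun x => `|f x|).
Proof.
by move=> mf; apply: (measurableT_comp _ mf); apply: continuous_measurable_fun; exact: norm_continuous.
Qed.

Lemma measurable_hyperbola (a c : R) :
  measurable_fun setT (fun y : R => (`|y| * (`|y * (y + a)| <= c)%R%:R)%:E : \bar R).
Proof.
apply/measurable_EFinP; apply: measurable_funM; first exact: measurable_abs.
apply: measurable_boolR; apply: measurable_fun_ler => //; apply: measurable_abs.
by apply: measurable_funM => //; apply: measurable_funD.
Qed.

Lemma measurable_absbox (r : R) :
  measurable_fun setT (fun s : R => (`|s| * (inbox r s)%:R)%:E : \bar R).
Proof.
apply/measurable_EFinP; apply: measurable_funM; first by apply: continuous_measurable_fun; exact: norm_continuous.
by apply: measurable_boolR; exact: mbox_bool.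
Qed.

Lemma int_box_lt (x : R) : 0 <= x -> (\int[mu]_s (`|s| < x)%R%:R%:E = (2 * x)%:E)%E.
Proof.
move=> x0; rewrite integral_bool; last by apply: measurable_fun_ltr => //; apply: measurableT_comp.
have -> : [set s : R | `|s| < x] = [set` `]- x, x[].
  by apply/seteqP; split=> s /=; rewrite in_itv /= ltr_norml.
rewrite /leb1 /= lebesgue_measure_itv /= lte_fin; case: ifP => [_|h].
  by rewrite -EFinD; congr EFin; ring.
by have -> : x = 0 by [move: h; rewrite ltNge => /negbFE; lra]; rewrite mulr0.
Qed.

(* The square of side 2r is cut by |x| <= |s| into two pieces of equal area. *)
Lemma int_abs_le (r : R) : 0 <= r ->
  (\int[mu]_s (`|s| * (inbox r s)%:R)%R%:E = (r ^+ 2)%:E)%E.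
Proof.
move=> r0.
pose f1 (p : R * R) : \bar R := ((`|p.1| <= `|p.2|) && (inbox r p.2))%:R%:E.
pose f2 (p : R * R) : \bar R := ((`|p.2| < `|p.1|) && (inbox r p.1))%:R%:E.
have mi1 : measurable_fun setT (fun p : R * R => inbox r p.1).
  by apply: measurable_fun_ler => //; apply: measurableT_comp.
have mi2 : measurable_fun setT (fun p : R * R => inbox r p.2).
  by apply: measurable_fun_ler => //; apply: measurableT_comp.
have m1 : measurable_fun setT f1.
  apply: measurable_boolE; apply: measurable_and => //.
  by apply: measurable_fun_ler; apply: measurableT_comp.
have m2 : measurable_fun setT f2.
  apply: measurable_boolE; apply: measurable_and => //.
  by apply: measurable_fun_ltr; apply: measurableT_comp.
have f10 p : (0 <= f1 p)%E by rewrite lee_fin.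
have f20 p : (0 <= f2 p)%E by rewrite lee_fin.
pose j (s : R) : \bar R := (`|s| * (inbox r s)%:R)%R%:E.
have j0 s : (0 <= j s)%E by rewrite lee_fin mulr_ge0.
have mj : measurable_fun setT j by exact: measurable_absbox.
have k1 s : (\int[mu]_x f1 (x, s) = 2%:E * j s)%E.
  rewrite /f1 /j /=; case: (inbox r s); last first.
    by rewrite mulr0 mule0; under eq_integral do rewrite andbF; rewrite integral0.
  rewrite mulr1 -EFinM -int_box //; apply: eq_integral => x _; by rewrite andbT.
have k2 x : (\int[mu]_s f2 (x, s) = 2%:E * j x)%E.
  rewrite /f2 /j /=; case: (inbox r x); last first.
    by rewrite mulr0 mule0; under eq_integral do rewrite andbF; rewrite integral0.
  rewrite mulr1 -EFinM -int_box_lt //; apply: eq_integral => s _; by rewrite andbT.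
have J1 : (\int[mu]_x \int[mu]_s f1 (x, s) = 2%:E * \int[mu]_s j s)%E.
  rewrite tonelliC // -ge0_integralZl_EFin //; apply: eq_integral => s _; exact: k1.
have J2 : (\int[mu]_x \int[mu]_s f2 (x, s) = 2%:E * \int[mu]_s j s)%E.
  rewrite -ge0_integralZl_EFin //; apply: eq_integral => s _; exact: k2.
have J3 : (\int[mu]_x \int[mu]_s f1 (x, s) + \int[mu]_x \int[mu]_s f2 (x, s) = (4 * r ^+ 2)%:E)%E.
  rewrite -ge0_integralD //; first last.
  - exact: measurable_tonelli1.
  - by move=> x _; apply: integral_ge0.
  - exact: measurable_tonelli1.
  - by move=> x _; apply: integral_ge0.
  transitivity (\int[mu]_x ((2 * r)%:E * (inbox r x)%:R%:E))%E; last first.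
    rewrite ge0_integralZl_EFin ?mulr_ge0 //; last exact: measurable_inbox.
    by rewrite int_box // -EFinM; congr EFin; ring.
  apply: eq_integral => x _.
  have mx (f : R * R -> \bar R) : measurable_fun setT f -> measurable_fun setT (fun s => f (x, s)).
    by move=> mf; apply: (measurableT_comp mf); apply: measurable_fun_pair.
  rewrite -ge0_integralD //; [|exact: mx|exact: mx].
  rewrite muleC -int_box // -ge0_integralZl_EFin //; last exact: measurable_inbox.
  apply: eq_integral => s _; rewrite /f1 /f2 /inbox /= -EFinD -EFinM -natrD -natrM; congr (_%:R%:E).
  case: (leP `|x| `|s|) => h1 /=; last case: (leP `|x| r) => h2 /=.
  - case: (leP `|s| r) => h2 /=; last by rewrite muln0.
    by rewrite (le_trans h1 h2).
  - by rewrite (le_trans (ltW h1) h2).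
  - by [].
move: J3; rewrite J1 J2 -/(\int[mu]_s j s)%E.
case: (\int[mu]_s j s)%E => [v| |].
- by rewrite -!EFinM -EFinD => -[h]; congr EFin; lra.
- by rewrite gt0_muley ?lte_fin.
- by rewrite gt0_muleNy ?lte_fin.
Qed.

Lemma int_two (c r1 r2 : R) : 0 <= c -> 0 <= r1 -> 0 <= r2 ->
  (\int[mu]_y (c * ((inbox r1 y)%:R + (inbox r2 y)%:R))%:E = (c * (2 * r1 + 2 * r2))%:E)%E.
Proof.
move=> c0 h1 h2.
transitivity (\int[mu]_y (c%:E * ((inbox r1 y)%:R%:E + (inbox r2 y)%:R%:E)))%E.
  by apply: eq_integral => y _.
rewrite ge0_integralZl_EFin //; first last.
- by apply: emeasurable_funD; exact: measurable_inbox.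
- by move=> y _; rewrite adde_ge0 // lee_fin.
rewrite ge0_integralD //; [|exact: measurable_inbox|exact: measurable_inbox].
by rewrite !int_box.
Qed.

Lemma measurable_two (c r1 r2 : R) :
  measurable_fun setT (fun y : R => (c * ((inbox r1 y)%:R + (inbox r2 y)%:R))%:E : \bar R).
Proof.
apply/measurable_EFinP; apply: measurable_funM => //.
by apply: measurable_funD; apply: measurable_boolR; exact: mbox_bool.
Qed.

Lemma measurable_tonelli2 (h : R * R -> \bar R) : measurable_fun setT h ->
  (forall p, 0 <= h p)%E -> measurable_fun setT (fun y => \int[mu]_x h (x, y))%E.
Proof. by move=> mh h0; exact: (@measurable_fun_fubini_tonelli_G _ _ _ _ R (leb1 R) h mh h0). Qed.

Lemma measurable_tonelli3 (h : R * (R * R) -> \bar R) : measurable_fun setT h ->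
  (forall p, 0 <= h p)%E -> measurable_fun setT (fun p : R * R => \int[mu]_x h (x, p))%E.
Proof. by move=> mh h0; exact: (@measurable_fun_fubini_tonelli_G _ _ _ _ R (leb1 R) h mh h0). Qed.

Lemma ae_eq_neq0 (f g : R -> \bar R) : (forall y, y != 0 -> f y = g y) -> ae_eq mu setT f g.
Proof.
move=> fg; exists [set 0]; split; first exact: measurable_set1.
  by rewrite /leb1 /= lebesgue_measure_set1.
move=> y /= h; apply: contrapT => /eqP y0; apply: h => _; exact: fg.
Qed.

(** If [|y| <= |y + a|] then [|y| <= r]. Otherwise [|y + a| <= r] and [|y + a| |a| <= 2 r ^ 2],
    while [|y| <= |y + a| + |a|]. The three majorants integrate to [r ^ 2], [r ^ 2] and at most
    [4 r ^ 2]. *)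
Lemma int_hyperbola (a r : R) : 0 <= r ->
  (\int[mu]_y (`|y : R| * (`|(y : R) * (y + a)| <= r ^+ 2)%R%:R)%R%:E <= (6 * r ^+ 2)%R%:E)%E.
Proof.
move=> r0.
pose j (s : R) : \bar R := (`|s| * (inbox r s)%:R)%R%:E.
have j0 s : (0 <= j s)%E by rewrite lee_fin mulr_ge0.
have mj : measurable_fun setT j by exact: measurable_absbox.
have mja : measurable_fun setT (fun y : R => j (y + a)).
  by apply: (measurableT_comp mj); apply: measurable_funD.
pose b (y : R) : \bar R := (`|a| * (`|y + a| * `|a| <= 2 * r ^+ 2)%R%:R)%:E.
have b0 s : (0 <= b s)%E by rewrite lee_fin mulr_ge0.
have mb : measurable_fun setT b.
  rewrite /b; apply/measurable_EFinP; apply: measurable_funM => //; apply: measurable_boolR.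
  apply: measurable_fun_ler => //; apply: measurable_funM => //; apply: measurableT_comp => //.
  exact: measurable_funD.
have ib : (\int[mu]_y b y <= (4 * r ^+ 2)%:E)%E.
  have [az|a0] := eqVneq a 0.
    by rewrite (@eq_integral _ _ _ _ _ (cst 0%E)) ?integral0 ?lee_fin ?mulr_ge0 ?exprn_ge0 // => y _; rewrite /b az normr0 mul0r.
  have an : 0 < `|a| by rewrite normr_gt0.
  rewrite (_ : \int[mu]_y b y = \int[mu]_y (`|a|%:E * (inbox (2 * r ^+ 2 / `|a|) (y + a))%:R%:E))%E; last first.
    by apply: eq_integral => y _; rewrite /b /inbox -EFinM -ler_pdivlMr.
  rewrite ge0_integralZl_EFin //; last first.
    by apply: (measurableT_comp (measurable_inbox _)); apply: measurable_funD.
  rewrite (@integral_shift R (fun y => (inbox _ y)%:R%:E)) //; last exact: measurable_inbox.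
  rewrite int_box ?divr_ge0 ?mulr_ge0 ?exprn_ge0 // -EFinM lee_fin le_eqVlt; apply/orP; left.
  by apply/eqP; field; rewrite gt_eqF.
apply: (@le_trans _ _ (\int[mu]_y (j y + (j (y + a)%R + b y))%E)%E).
  refine (@ge0_le_integral _ _ R mu setT measurableT _ _ _ (measurable_hyperbola a (r ^+ 2)) _ _).
  - by move=> y _; rewrite lee_fin mulr_ge0.
  - by apply: emeasurable_funD => //; apply: emeasurable_funD.
  move=> y _; rewrite -!EFinD lee_fin.
  have [h|_] := leP `|y * (y + a)| (r ^+ 2); last by rewrite mulr0 !addr_ge0 ?mulr_ge0.
  rewrite mulr1; rewrite normrM in h.
  have v0 := normr_ge0 (y + a); have y0 := normr_ge0 y.
  have [h1|h1] := leP `|y| `|y + a|.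
    have -> : inbox r y.
      by rewrite /inbox -(@ler_pXn2r _ 2) ?nnegrE // (le_trans _ h) // expr2 ler_wpM2l.
    by rewrite mulr1 lerDl addr_ge0 ?mulr_ge0.
  have -> : inbox r (y + a).
    by rewrite /inbox -(@ler_pXn2r _ 2) ?nnegrE // (le_trans _ h) // expr2 ler_wpM2r // ltW.
  have a2 : `|a| <= 2 * `|y|.
    have -> : a = (y + a) - y by ring.
    by apply: le_trans (ler_normB _ _) _; lra.
  have -> : `|y + a| * `|a| <= 2 * r ^+ 2.
    apply: (@le_trans _ _ (`|y + a| * (2 * `|y|))); first by rewrite ler_wpM2l.
    by have -> : `|y + a| * (2 * `|y|) = 2 * (`|y| * `|y + a|) by [ring]; rewrite ler_wpM2l.
  rewrite !mulr1.
  have : `|y| <= `|y + a| + `|a|.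
    have {1}-> : y = (y + a) - a by ring.
    exact: ler_normB.
  have : 0 <= `|y| * (inbox r y)%:R by rewrite mulr_ge0.
  lra.
rewrite ge0_integralD //; first last.
- exact: emeasurable_funD.
- by move=> y _; rewrite adde_ge0.
rewrite ge0_integralD // (@integral_shift R j) // int_abs_le //.
have -> : (6 * r ^+ 2)%:E = ((r ^+ 2)%:E + ((r ^+ 2)%:E + (4 * r ^+ 2)%:E))%E :> \bar R.
  by rewrite -!EFinD; congr EFin; ring.
by rewrite leeD2l // leeD2l.
Qed.

Lemma integrable_oneDsqrV (K : R) : 0 <= K ->
  mu.-integrable setT (fun t : R => (K * (1 + t ^+ 2)^-1)%:E).
Proof.
move=> K0.
have p (t : R) : 0 < 1 + t ^+ 2 by rewrite ltr_pwDl // sqr_ge0.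
have cf : continuous (fun t : R => (1 + t ^+ 2)^-1).
  move=> t; apply: cvgV; first by rewrite gt_eqF.
  by apply: cvgD; [exact: cvg_cst|exact: exprn_continuous].
have mf : measurable_fun setT (fun t : R => ((1 + t ^+ 2)^-1)%:E : \bar R).
  by apply/measurable_EFinP; apply: continuous_measurable_fun.
have I : (\int[mu]_t ((1 + t ^+ 2)^-1)%:E = pi%:E :> \bar R)%E.
  rewrite [LHS](@ge0_symfun_integralT R (fun t => (1 + t ^+ 2)^-1)) //; first last.
  - by move=> x; rewrite /= sqrrN.
  - by move=> x; rewrite invr_ge0 ltW.
  have -> : [set x : R | 0 <= x] = `[0%R, +oo[%classic.
    by apply/seteqP; split=> x /=; rewrite in_itv /= andbT.
  have := @integral0y_oneDsqr R; rewrite /oneDsqr => ->.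
  by rewrite -EFinM; congr EFin; field.
apply/integrableP; split.
  by apply/measurable_EFinP; apply: measurable_funM => //; apply: continuous_measurable_fun.
rewrite (_ : \int[mu]_x _ = \int[mu]_t (K%:E * ((1 + t ^+ 2)^-1)%:E))%E; last first.
  by apply: eq_integral => t _; rewrite gee0_abs ?EFinM // lee_fin mulr_ge0 // invr_ge0 ltW.
by rewrite ge0_integralZl_EFin // ?I ?ltry // => t _; rewrite lee_fin invr_ge0 ltW.
Qed.
End IntegralTools.

(** * The real density and the area of the region *)

Section RealDensity.
Variable R : realType.
Notation mu := (@leb1 R).
Variables (d A B C kap : R) (m : R * R * R -> R).
Hypotheses (d1 : 1 <= d) (C1 : 1 <= `|C|) (k0 : 0 < kap).
Hypothesis mZ : forall k v, m (k * v.1.1, k * v.1.2, k * v.2) = `|k| * m v.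
Hypothesis mD : forall u v, m (u.1.1 + v.1.1, u.1.2 + v.1.2, u.2 + v.2) <= m u + m v.
Hypothesis mS : forall v, sup3 v <= kap * m v.
Hypothesis mM : measurable_fun setT (fun p : R * (R * R) => m (p.1, p.2.1, p.2.2)).

Let d0 : 0 < d. Proof. exact: lt_le_trans d1. Qed.
Let dn : d != 0. Proof. by rewrite gt_eqF. Qed.

Definition q1 (t : R) : R := A + B * t + C * t ^+ 2.
(** The norm of the zero with [y = d] and slope [z / y = t]; the parametrised zero with parameters
    [s], [s t] has norm [s ^ 2 nn t]. *)
Definition nn (t : R) : R := m (- q1 t, d, d * t).
Let M : R := m (1, 0, 0).

Lemma m_ge0 v : 0 <= m v.
Proof. by rewrite -(pmulr_rge0 _ k0); apply: le_trans (mS v); exact: sup3_ge0. Qed.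

Lemma nn_gt0 t : 0 < nn t.
Proof.
rewrite -(pmulr_rgt0 _ k0); apply: lt_le_trans (mS _).
by have [_ h _] := sup3_ge (- q1 t, d, d * t); apply: lt_le_trans h; rewrite /= gtr0_norm.
Qed.

Lemma M_comp (dd : measure_display) (T : measurableType dd) (f g h : T -> R) :
  measurable_fun setT f -> measurable_fun setT g -> measurable_fun setT h ->
  measurable_fun setT (fun x => m (f x, g x, h x)).
Proof.
move=> mf mg mh; apply: (measurableT_comp mM (g := fun x => (f x, (g x, h x)))).
by apply: measurable_fun_pair => //; apply: measurable_fun_pair.
Qed.


Lemma measurable_q1 (dd : measure_display) (T : measurableType dd) (f : T -> R) :
  measurable_fun setT f -> measurable_fun setT (fun x => q1 (f x)).
Proof.
move=> mf; apply: measurable_funD; first by apply: measurable_funD => //; apply: measurable_funM.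
by apply: measurable_funM => //; apply: measurable_funX.
Qed.

(** The condition defining the volume after the substitution [z = y t], whose Jacobian is the factor
    [|y|] of [inn]. *)
Definition ind e t x y : bool := (`|d * x * y + y ^+ 2 * q1 t| <= e) && (m (x, y, y * t) <= 1).
Definition inn e t y : \bar R := (\int[mu]_x (`|y| * (ind e t x y)%:R)%R%:E)%E.
Definition Wf e t : \bar R := (\int[mu]_y inn e t y)%E.

Lemma measurable_ind (dd : measure_display) (T : measurableType dd) e (f g h : T -> R) :
  measurable_fun setT f -> measurable_fun setT g -> measurable_fun setT h ->
  measurable_fun setT (fun x => (`|h x| * (ind e (f x) (g x) (h x))%:R)%:E : \bar R).
Proof.
move=> mf mg mh; apply/measurable_EFinP; apply: measurable_funM; first exact: measurable_abs.
apply: measurable_boolR; apply: measurable_and.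
  apply: measurable_fun_ler => //; apply: measurable_abs; apply: measurable_funD.
    by apply: measurable_funM => //; apply: measurable_funM.
  by apply: measurable_funM; [apply: measurable_funX|apply: measurable_q1].
by apply: measurable_fun_ler => //; apply: M_comp => //; apply: measurable_funM.
Qed.

Lemma ind_ge0 e t x y : (0 <= (`|y| * (ind e t x y)%:R)%:E)%E.
Proof. by rewrite lee_fin mulr_ge0. Qed.

Lemma inn_ge0 e t y : (0 <= inn e t y)%E.
Proof. by apply: integral_ge0 => x _; exact: ind_ge0. Qed.

Lemma Wf_ge0 e t : (0 <= Wf e t)%E.
Proof. by apply: integral_ge0 => x _; exact: inn_ge0. Qed.

Lemma measurable_inn e t : measurable_fun setT (inn e t).
Proof.
apply: (@measurable_tonelli1 R (fun p => (`|p.1| * (ind e t p.2 p.1)%:R)%:E)).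
  by apply: measurable_ind.
by move=> p; exact: ind_ge0.
Qed.

Definition vec t y u : R * R * R := (- (y / d) * q1 t + u / (d * y), y, y * t).

(** The new variable [u = d x y + y ^ 2 q1 t] is the value of the form; the Jacobian [d |y|] cancels
    the factor [|y|]. *)
Lemma inn_u e t y : y != 0 -> (inn e t y =
  \int[mu]_u (d^-1 * ((`|u : R| <= e)%R && (m (vec t y u) <= 1)%R)%:R)%R%:E)%E.
Proof.
move=> y0; have dy : (d * y)^-1 != 0 by rewrite invr_neq0 // mulf_neq0.
rewrite /inn (@integral_affine R (d * y)^-1 (- (y / d) * q1 t)) //; last first.
  exact: measurable_ind.
rewrite -ge0_integralZl_EFin //; last first.
  by apply: measurable_ind => //; apply: measurable_funD => //; apply: measurable_funM.
apply: eq_integral => u _; rewrite -EFinM; congr EFin; rewrite /ind /vec.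
have -> : d * ((d * y)^-1 * u + - (y / d) * q1 t) * y + y ^+ 2 * q1 t = u.
  by field; rewrite dn y0.
have -> : (d * y)^-1 * u + - (y / d) * q1 t = - (y / d) * q1 t + u / (d * y) by rewrite addrC [_^-1 * u]mulrC.
rewrite mulrA; congr (_ * _); rewrite normfV normrM (gtr0_norm d0).
by field; rewrite dn normr_eq0.
Qed.

Lemma mvec y k t : m (- (y / d) * q1 t + k, y, y * t) <= `|y| / d * nn t + `|k| * M /\
  `|y| / d * nn t <= m (- (y / d) * q1 t + k, y, y * t) + `|k| * M.
Proof.
have E1 : m (- (y / d) * q1 t, y, y * t) = `|y| / d * nn t.
  have := mZ (y / d) (- q1 t, d, d * t) => /=.
  have -> : y / d * - q1 t = - (y / d) * q1 t by ring.
  have -> : y / d * d = y by rewrite divfK.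
  have -> : y / d * (d * t) = y * t by rewrite mulrA divfK.
  by move=> ->; rewrite normrM normfV (gtr0_norm d0).
have E2 (c : R) : m (c, 0, 0) = `|c| * M by have := mZ c (1, 0, 0); rewrite /= mulr1 mulr0.
split; first by have := mD (- (y / d) * q1 t, y, y * t) (k, 0, 0); rewrite /= !addr0 E1 E2.
have := mD (- (y / d) * q1 t + k, y, y * t) (- k, 0, 0).
by rewrite /= !addr0 addrK E1 E2 normrN.
Qed.

Lemma inn0 e t : inn e t 0 = 0%E.
Proof. by rewrite /inn (@eq_integral _ _ _ _ _ (cst 0%E)) ?integral0 // => x _; rewrite normr0 mul0r. Qed.

Lemma measurable_vec e t y :
  measurable_fun setT (fun u : R => (d^-1 * ((`|u| <= e)%R && (m (vec t y u) <= 1)%R)%:R)%:E : \bar R).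
Proof.
apply/measurable_EFinP; apply: measurable_funM => //; apply: measurable_boolR.
apply: measurable_and; first by apply: measurable_fun_ler => //; apply: measurable_abs.
apply: measurable_fun_ler => //; apply: M_comp => //.
by apply: measurable_funD => //; apply: measurable_funM.
Qed.

Lemma measurable_cbox (c e : R) : measurable_fun setT (fun u : R => (c * (inbox e u)%:R)%:E : \bar R).
Proof. by apply/measurable_EFinP; apply: measurable_funM => //; apply: measurable_boolR; exact: mbox_bool. Qed.

Lemma int_cbox (c e : R) : 0 <= c -> 0 <= e -> (\int[mu]_u (c * (inbox e u)%:R)%R%:E = (c * (2 * e))%R%:E)%E.
Proof.
move=> c0 e0; rewrite -[RHS]addr0 EFinM -int_box // -ge0_integralZl_EFin ?addr0 //.
exact: measurable_inbox.
Qed.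

Lemma inn_le (b : bool) e t y : 0 <= e -> y != 0 ->
  (forall u, `|u| <= e -> m (vec t y u) <= 1 -> b) -> (inn e t y <= (2 * e / d * b%:R)%:E)%E.
Proof.
move=> e0 y0 H; rewrite inn_u //.
apply: (@le_trans _ _ (\int[mu]_u (d^-1 * b%:R * (inbox e u)%:R)%R%:E)%E).
  apply: ge0_le_integral => //.
  - by move=> u _; rewrite lee_fin mulr_ge0 // invr_ge0 ltW.
  - exact: measurable_vec.
  - exact: measurable_cbox.
  move=> u _; rewrite lee_fin -mulrA ler_wpM2l ?invr_ge0 ?(ltW d0) // /inbox -natrM ler_nat mulnb.
  by case: (boolP (`|u| <= e)) => //= ue; case: (boolP (m _ <= 1)) => //= /(H _ ue) ->.
rewrite int_cbox // ?mulr_ge0 ?invr_ge0 ?(ltW d0) // lee_fin.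
by rewrite le_eqVlt; apply/orP; left; apply/eqP; ring.
Qed.

Lemma inn_ge e t y : 0 <= e -> y != 0 ->
  (forall u, `|u| <= e -> m (vec t y u) <= 1) -> ((2 * e / d)%:E <= inn e t y)%E.
Proof.
move=> e0 y0 H; rewrite inn_u //.
apply: (@le_trans _ _ (\int[mu]_u (d^-1 * (inbox e u)%:R)%R%:E)%E).
  rewrite int_cbox // ?invr_ge0 ?(ltW d0) // lee_fin.
  by rewrite le_eqVlt; apply/orP; left; apply/eqP; ring.
apply: ge0_le_integral => //.
- by move=> u _; rewrite lee_fin mulr_ge0 // invr_ge0 ltW.
- exact: measurable_cbox.
- exact: measurable_vec.
move=> u _; rewrite lee_fin ler_wpM2l ?invr_ge0 ?(ltW d0) // /inbox ler_nat.
by case: (boolP (`|u| <= e)) => //= ue; rewrite H.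
Qed.

(** Outside [|y| <= sqrt e] the fibre moves only by [O(sqrt e)] along the first axis; the short
    interval left out contributes [O(e sqrt e)]. *)
Lemma small_shift e y u : 0 < e -> Num.sqrt e < `|y| -> `|u| <= e -> `|u / (d * y)| <= Num.sqrt e / d.
Proof.
move=> e0 ye ue; have y0 : 0 < `|y| by apply: le_lt_trans ye; rewrite sqrtr_ge0.
rewrite normrM normfV normrM (gtr0_norm d0) ler_pdivrMr ?mulr_gt0 //.
apply: le_trans ue _; rewrite -{1}(sqr_sqrtr (ltW e0)) expr2.
have -> : Num.sqrt e / d * (d * `|y|) = Num.sqrt e * `|y| by field.
by rewrite ler_wpM2l ?sqrtr_ge0 // ltW.
Qed.

(** Every fibre has measure at most [2 e / d]. Beyond [|y| = sqrt e] a nonempty fibre forces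
    [|y| <= r1], a slight enlargement of [|y| nn t <= d]. *)
Lemma W_up e t : 0 < e ->
  (Wf e t <= (2 * e / d * (2 * (d * (1 + Num.sqrt e * M / d) / nn t) + 2 * Num.sqrt e))%:E)%E.
Proof.
move=> e0; set r1 := d * _ / _; set r2 := Num.sqrt e.
have M0 : 0 <= M by exact: m_ge0.
have n0 := nn_gt0 t.
have r20 : 0 <= r2 by rewrite sqrtr_ge0.
have c0 : 0 <= 2 * e / d by rewrite divr_ge0 ?mulr_ge0 // ltW.
have r10 : 0 <= r1.
  by rewrite divr_ge0 ?mulr_ge0 ?(ltW d0) ?(ltW n0) // addr_ge0 // divr_ge0 ?mulr_ge0 // ltW.
rewrite -int_two //; apply: ge0_le_integral => //.
- by move=> y _; exact: inn_ge0.
- exact: measurable_inn.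
- exact: measurable_two.
move=> y _; have [->|y0] := eqVneq y 0; first by rewrite inn0 lee_fin mulr_ge0.
have [yr|yr] := leP `|y| r2.
  apply: le_trans (@inn_le true e t y (ltW e0) y0 _) _ => //.
  by rewrite lee_fin ler_wpM2l // [inbox r2 y]yr lerDr.
apply: le_trans (@inn_le (inbox r1 y) e t y (ltW e0) y0 _) _ => [u ue mu1|]; last first.
  by rewrite lee_fin ler_wpM2l // lerDl.
have [_ h] := mvec y (u / (d * y)) t; rewrite -/(vec t y u) in h.
have sh := small_shift e0 yr ue.
have h2 : `|y| / d * nn t <= 1 + r2 / d * M.
  by apply: le_trans h _; rewrite lerD // ler_wpM2r.
rewrite /inbox /r1 ler_pdivlMr //.
have -> : `|y| * nn t = d * (`|y| / d * nn t) by field.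
by rewrite ler_wpM2l ?(ltW d0) //; apply: le_trans h2 _; rewrite lerD2l mulrAC.
Qed.

Lemma W_low e t : 0 < e -> 0 <= 1 - Num.sqrt e * M / d ->
  ((2 * e / d * (2 * (d * (1 - Num.sqrt e * M / d) / nn t)))%:E <=
   Wf e t + (2 * e / d * (2 * Num.sqrt e))%:E)%E.
Proof.
move=> e0 z0; set r1 := d * _ / _; set r2 := Num.sqrt e.
have M0 : 0 <= M by exact: m_ge0.
have n0 := nn_gt0 t.
have r20 : 0 <= r2 by rewrite sqrtr_ge0.
have c0 : 0 <= 2 * e / d by rewrite divr_ge0 ?mulr_ge0 // ltW.
have r10 : 0 <= r1 by rewrite divr_ge0 ?mulr_ge0 ?(ltW d0) ?(ltW n0).
(* An interval of radius zero is inserted to fit the shape of [int_two]. *)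
have e1 r : 0 <= r -> (2 * e / d * (2 * r))%:E = (\int[mu]_y (2 * e / d * ((inbox r y)%:R + (inbox 0 y)%:R))%R%:E)%E.
  by move=> hr; rewrite int_two // mulr0 addr0.
rewrite !e1 // /Wf -ge0_integralD //; first last.
- exact: measurable_two.
- by move=> y _; rewrite lee_fin mulr_ge0.
- exact: measurable_inn.
- by move=> y _; exact: inn_ge0.
apply: ge0_le_integral => //.
- by move=> y _; rewrite lee_fin mulr_ge0.
- exact: measurable_two.
- by apply: emeasurable_funD; [exact: measurable_inn|exact: measurable_two].
move=> y _; have [yr|yr] := leP `|y| r2.
  apply: le_trans (leeDr _ (inn_ge0 e t y)); rewrite lee_fin ler_wpM2l // lerD2r [inbox r2 y]yr.
  by case: (inbox r1 y).
have yp : 0 < `|y| by apply: le_lt_trans yr.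
have y0 : y != 0 by rewrite -normr_gt0.
have [yr1|_] := boolP (inbox r1 y); last first.
  rewrite add0r; apply: le_trans (leeDr _ (inn_ge0 e t y)); rewrite lee_fin ler_wpM2l // lerDr //.
apply: le_trans (leeDl _ _); last by rewrite lee_fin mulr_ge0.
have -> : inbox 0 y = false by apply/negbTE; rewrite /inbox -ltNge.
rewrite addr0 mulr1; apply: inn_ge => // [|u ue]; first exact: ltW.
have [h _] := mvec y (u / (d * y)) t; apply: le_trans h _.
have sh := small_shift e0 yr ue.
move: yr1; rewrite /inbox /r1 ler_pdivlMr // => h1.
have h2 : `|y| / d * nn t <= 1 - r2 * M / d.
  by rewrite mulrAC ler_pdivrMr // mulrC [X in _ <= X]mulrC mulrC.
have h3 : `|u / (d * y)| * M <= r2 / d * M by rewrite ler_wpM2r.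
have e3 : r2 / d * M = r2 * M / d by rewrite mulrAC.
by rewrite e3 in h3; lra.
Qed.

(** The norm condition confines [y] to [|y| <= kap]. This bound is uniform in [t]; the next one
    supplies the decay. *)
Lemma W_bd1 e t : 0 < e -> (Wf e t <= (2 * e / d * (2 * kap))%:E)%E.
Proof.
move=> e0; have c0 : 0 <= 2 * e / d by rewrite divr_ge0 ?mulr_ge0 // ltW.
rewrite -[2 * kap]addr0 -[X in _ + X](mulr0 2) -int_two ?(ltW k0) //; apply: ge0_le_integral => //.
- by move=> y _; exact: inn_ge0.
- exact: measurable_inn.
- exact: measurable_two.
move=> y _; have [->|y0] := eqVneq y 0; first by rewrite inn0 lee_fin mulr_ge0.
apply: le_trans (@inn_le (inbox kap y) e t y (ltW e0) y0 _) _ => [u ue mu1|]; last first.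
  by rewrite lee_fin ler_wpM2l // lerDl.
have [_ h _] := sup3_ge (vec t y u); apply: le_trans h _; apply: le_trans (mS _) _.
by rewrite -[X in _ <= X]mulr1 ler_wpM2l // ltW.
Qed.

(** In the other order of integration, for fixed [x] with [|x| <= kap], the condition on [y] reads
    [|y (y + d x / q1 t)| <= e / |q1 t|], which is the situation of [int_hyperbola]. *)
Lemma W_bd2 e t : 0 < e -> q1 t != 0 -> (Wf e t <= (12 * kap * e / `|q1 t|)%:E)%E.
Proof.
move=> e0 q0; have qp : 0 < `|q1 t| by rewrite normr_gt0.
rewrite /Wf /inn (@tonelliC R (fun p => (`|p.1| * (ind e t p.2 p.1)%:R)%:E)) //=; last exact: measurable_ind.
pose r := Num.sqrt (e / `|q1 t|).
have r2 : r ^+ 2 = e / `|q1 t| by rewrite sqr_sqrtr // divr_ge0 // ltW.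
have -> : 12 * kap * e / `|q1 t| = 6 * r ^+ 2 * (2 * kap) by rewrite r2; ring.
rewrite -int_cbox ?mulr_ge0 ?exprn_ge0 ?sqrtr_ge0 ?(ltW k0) //.
apply: ge0_le_integral => //.
- by move=> x _; apply: integral_ge0 => y _; exact: ind_ge0.
- apply: (@measurable_tonelli1 R (fun p => (`|p.2| * (ind e t p.1 p.2)%:R)%:E)); first exact: measurable_ind.
  by move=> p; exact: ind_ge0.
- exact: measurable_cbox.
move=> x _; have [xk|xk] := boolP (inbox kap x); last first.
  rewrite mulr0 (@eq_integral _ _ _ _ _ (cst 0%E)) ?integral0 // => y _ /=.
  have -> : ind e t x y = false; last by rewrite mulr0.
  apply/negbTE; apply: contra xk => /andP[_ h]; rewrite /inbox.
  have [h2 _ _] := sup3_ge (x, y, y * t); apply: le_trans h2 _; apply: le_trans (mS _) _.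
  by rewrite -[X in _ <= X]mulr1 ler_wpM2l // ltW.
rewrite mulr1; apply: le_trans (@int_hyperbola R (d * x / q1 t) r (sqrtr_ge0 _)).
refine (@ge0_le_integral _ _ R mu setT measurableT _ _ _ _ (measurable_hyperbola _ _) _).
- by move=> y _; exact: ind_ge0.
- exact: measurable_ind.
move=> y _; rewrite lee_fin ler_wpM2l // ler_nat /ind.
case: (boolP (_ <= e)) => //= h.
suff -> : `|y * (y + d * x / q1 t)| <= r ^+ 2 by case: (_ <= 1).
rewrite r2 ler_pdivlMr // -normrM.
by have -> : y * (y + d * x / q1 t) * q1 t = d * x * y + y ^+ 2 * q1 t by [field].
Qed.

Definition wn e t : R := (2 * e)^-1 * fine (Wf e t).

Lemma Wf_fin e t : 0 < e -> Wf e t \is a fin_num.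
Proof.
move=> e0; rewrite ge0_fin_numE ?Wf_ge0 //; apply: le_lt_trans (W_bd1 t e0) _; exact: ltry.
Qed.

Lemma wn_ge0 e t : 0 < e -> 0 <= wn e t.
Proof. by move=> e0; rewrite mulr_ge0 ?invr_ge0 ?mulr_ge0 ?(ltW e0) // fine_ge0 // Wf_ge0. Qed.

Lemma Wf_wn e t : 0 < e -> Wf e t = (2 * e * wn e t)%:E.
Proof.
move=> e0; rewrite /wn mulVKf ?fineK ?Wf_fin // mulf_neq0 // gt_eqF //.
Qed.

Lemma wn_dist e t : 0 < e ->
  `|2 / nn t - wn e t| <= Num.sqrt e * ((2 * M / nn t + 2) / d).
Proof.
move=> e0; have n0 := nn_gt0 t; have nn0 : nn t != 0 by rewrite gt_eqF.
have en : e != 0 by rewrite gt_eqF.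
set r := Num.sqrt e; have rr0 : 0 <= r by rewrite sqrtr_ge0.
have M0 : 0 <= M by exact: m_ge0.
have up : wn e t <= 2 / nn t + r * ((2 * M / nn t + 2) / d).
  have := W_up t e0; rewrite Wf_wn // lee_fin -/r => h.
  rewrite -(ler_pM2l (_ : 0 < 2 * e)) ?mulr_gt0 //; apply: le_trans h _.
  by rewrite le_eqVlt; apply/orP; left; apply/eqP; field; rewrite dn nn0.
have lo : 2 / nn t - r * ((2 * M / nn t + 2) / d) <= wn e t.
  have [z0|z0] := leP 0 (1 - r * M / d).
    have := W_low t e0 z0; rewrite Wf_wn // -EFinD lee_fin -/r => h.
    rewrite -(ler_pM2l (_ : 0 < 2 * e)) ?mulr_gt0 //.
    have -> : 2 * e * (2 / nn t - r * ((2 * M / nn t + 2) / d)) =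
        2 * e / d * (2 * (d * (1 - r * M / d) / nn t)) - 2 * e / d * (2 * r).
      by field; rewrite dn nn0.
    by rewrite lerBlDr.
  (* In this case the claimed lower bound is nonpositive. *)
  apply: le_trans (wn_ge0 t e0).
  have -> : 2 / nn t - r * ((2 * M / nn t + 2) / d) = 2 / nn t * (1 - r * M / d) - 2 * r / d.
    by field; rewrite dn nn0.
  have : 2 / nn t * (1 - r * M / d) <= 0 by rewrite pmulr_rle0 ?divr_gt0 // ltW.
  have : 0 <= 2 * r / d by rewrite divr_ge0 ?mulr_ge0 // ltW.
  lra.
by rewrite ler_norml; apply/andP; split; lra.
Qed.

Definition K1 : R := 2 * kap * (1 + 2 * `|A| + B ^+ 2) + 12 * kap.

(** As [|C| >= 1], [t ^ 2 <= 2 |q1 t| + 2 |A| + B ^ 2]; [W_bd1] handles the constants and [W_bd2]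
    the term in [|q1 t|]. *)
Lemma wn_dom e t : 0 < e -> wn e t <= K1 * (1 + t ^+ 2)^-1.
Proof.
move=> e0; have p : 0 < 1 + t ^+ 2 by rewrite ltr_pwDl // sqr_ge0.
rewrite -[_ * _^-1]/(_ / _) ler_pdivlMr //.
have w0 := wn_ge0 t e0; have e2 : 0 < 2 * e by rewrite mulr_gt0.
have b1 : wn e t <= 2 * kap.
  have h := W_bd1 t e0; rewrite Wf_wn // lee_fin in h.
  rewrite -(ler_pM2l e2); apply: le_trans h _.
  have -> : 2 * e / d * (2 * kap) = 2 * e * (2 * kap) / d by ring.
  by rewrite ler_pdivrMr // ler_peMr // !mulr_ge0 // ltW.
have b2 : wn e t * `|q1 t| <= 6 * kap.
  have [q0|q0] := eqVneq (q1 t) 0; first by rewrite q0 normr0 mulr0 mulr_ge0 // ltW.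
  have qp : 0 < `|q1 t| by rewrite normr_gt0.
  have := W_bd2 e0 q0; rewrite Wf_wn // lee_fin ler_pdivlMr // => h.
  by rewrite -(ler_pM2l e2) mulrA; apply: le_trans h _; rewrite le_eqVlt; apply/orP; left; apply/eqP; ring.
have tq : t ^+ 2 <= 2 * `|q1 t| + 2 * `|A| + B ^+ 2.
  have c2 : t ^+ 2 <= `|C * t ^+ 2| by rewrite normrM [ `|t ^+ 2|]ger0_norm ?sqr_ge0 // ler_peMl ?sqr_ge0.
  have : `|C * t ^+ 2| <= `|q1 t| + (`|A| + `|B * t|).
    have -> : C * t ^+ 2 = q1 t - (A + B * t) by rewrite /q1; ring.
    apply: le_trans (ler_normB _ _) _; rewrite lerD2l; exact: ler_normD.
  have : 2 * `|B * t| <= B ^+ 2 + t ^+ 2.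
    rewrite normrM -[B ^+ 2](real_normK (num_real _)) -[t ^+ 2](real_normK (num_real _)).
    have := sqr_ge0 (`|B| - `|t|); rewrite sqrrB; lra.
  lra.
apply: le_trans (_ : _ <= wn e t * (1 + 2 * `|A| + B ^+ 2) + 2 * (wn e t * `|q1 t|)) _.
  have -> : wn e t * (1 + 2 * `|A| + B ^+ 2) + 2 * (wn e t * `|q1 t|) = wn e t * (1 + (2 * `|q1 t| + 2 * `|A| + B ^+ 2)) by ring.
  by rewrite ler_wpM2l // lerD2l.
rewrite /K1 lerD //; last lra.
by rewrite ler_wpM2r // addr_ge0 ?sqr_ge0 // addr_ge0 // mulr_ge0.
Qed.

Lemma int_level (X t : R) : 0 <= X ->
  (\int[mu]_s (`|s : R| * (s ^+ 2 * nn t <= X)%R%:R)%R%:E = (X / nn t)%:E)%E.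
Proof.
move=> X0; have n0 := nn_gt0 t; have Xn : 0 <= X / nn t by rewrite divr_ge0 // ltW.
rewrite -[X / nn t](sqr_sqrtr Xn) -int_abs_le ?sqrtr_ge0 //; apply: eq_integral => s _.
congr (EFin (_ * _)); congr (nat_of_bool _)%:R; rewrite /inbox -ler_pdivlMr //.
by rewrite -[s ^+ 2 <= _]ler_sqrt // sqrtr_sqr.
Qed.

Lemma measurable_nn (dd : measure_display) (T : measurableType dd) (f : T -> R) :
  measurable_fun setT f -> measurable_fun setT (fun x => nn (f x)).
Proof.
move=> mf; apply: M_comp => //; last exact: measurable_funM.
by apply: (@measurable_funN _ _ _ setT (fun x => q1 (f x))); exact: measurable_q1.
Qed.

Lemma measurable_level X : measurable_fun setT
  (fun p : R * R => (`|p.2| * (p.2 ^+ 2 * nn p.1 <= X)%R%:R)%:E : \bar R).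
Proof.
apply/measurable_EFinP; apply: measurable_funM; first exact: measurable_abs.
apply: measurable_boolR; apply: measurable_fun_ler => //; apply: measurable_funM.
  exact: measurable_funX.
exact: measurable_nn.
Qed.

(** [int_level] writes the quotient as an integral over [s], and Tonelli makes such an integral
    measurable in [t]. *)
Lemma measurable_nnV (X : R) : 0 <= X -> measurable_fun setT (fun t : R => (X / nn t)%:E : \bar R).
Proof.
move=> X0; rewrite (_ : (fun t => _) = fun t => (\int[mu]_s (`|s : R| * (s ^+ 2 * nn t <= X)%R%:R)%R%:E)%E); last first.
  by apply/funext => t; rewrite int_level.
apply: (@measurable_tonelli1 R (fun p => (`|p.2| * (p.2 ^+ 2 * nn p.1 <= X)%R%:R)%:E)).
  exact: measurable_level.
by move=> p; rewrite lee_fin mulr_ge0.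
Qed.

(** The integral common to both sides: the real density is [2 V] and the area of the region is
    [X V]. *)
Definition V : R := fine (\int[mu]_t ((nn t)^-1)%:E)%E.

Definition hh e (p : R * (R * R)) : bool :=
  (`|d * p.1 * p.2.1 + A * p.2.1 ^+ 2 + B * p.2.1 * p.2.2 + C * p.2.2 ^+ 2| <= e)
  && (m (p.1, p.2.1, p.2.2) <= 1).
Definition Vol e : \bar R := I3 (fun p => (hh e p)%:R%:E).

Lemma measurable_hh e : measurable_fun setT (fun p => (hh e p)%:R%:E : \bar R).
Proof.
have m1 : measurable_fun setT (fun p : R * (R * R) => p.2.1) by exact: measurableT_comp.
have m2 : measurable_fun setT (fun p : R * (R * R) => p.2.2) by exact: measurableT_comp.
apply: measurable_boolE; apply: measurable_and; last by apply: measurable_fun_ler.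
apply: measurable_fun_ler => //; apply: measurable_abs.
apply: measurable_funD; last by apply: measurable_funM => //; apply: measurable_funX.
apply: measurable_funD; last by apply: measurable_funM => //; apply: measurable_funM.
apply: measurable_funD; last by apply: measurable_funM => //; apply: measurable_funX.
by apply: measurable_funM => //; apply: measurable_funM.
Qed.

(** Tonelli moves [x] to the innermost place, and [z = y t] is substituted for each [y] outside the
    null set [y = 0]. *)
Lemma Vol_W e : (Vol e = \int[mu]_t Wf e t)%E.
Proof.
have mh := measurable_hh e.
have h0 p : (0 <= (hh e p)%:R%:E :> \bar R)%E by rewrite lee_fin.
rewrite /Vol (I3E mh h0) [LHS](tonelli3 mh h0).
pose Ph (p : R * R) : \bar R := (\int[mu]_x (hh e (x, p))%:R%:E)%E.
have mPh : measurable_fun setT Ph by exact: (measurable_tonelli3 mh h0).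
have Ph0 p : (0 <= Ph p)%E by apply: integral_ge0.
transitivity (\int[mu]_y \int[mu]_z Ph (y, z))%E; first exact: (tonelli2 mPh Ph0).
pose h2 (p : R * (R * R)) : \bar R := (`|p.2.1| * (ind e p.2.2 p.1 p.2.1)%:R)%:E.
have mh2 : measurable_fun setT h2.
  by apply: measurable_ind => //; exact: measurableT_comp.
have h20 p : (0 <= h2 p)%E by exact: ind_ge0.
pose P2 (p : R * R) : \bar R := (\int[mu]_x h2 (x, p))%E.
have mP2 : measurable_fun setT P2 by exact: (measurable_tonelli3 mh2 h20).
have P20 p : (0 <= P2 p)%E by apply: integral_ge0.
transitivity (\int[mu]_y \int[mu]_t P2 (y, t))%E; last exact: (tonelliC mP2 P20).
apply: ge0_ae_eq_integral => //.
- exact: measurable_tonelli1.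
- exact: measurable_tonelli1.
- by move=> y _; apply: integral_ge0.
- by move=> y _; apply: integral_ge0.
apply: ae_eq_neq0 => y y0.
rewrite (@integral_affine R y 0) //; last first.
  by apply: (measurableT_comp mPh); apply: measurable_fun_pair.
rewrite -ge0_integralZl_EFin //; last first.
  apply: (measurableT_comp mPh (g := fun x : R => (y, y * x + 0))); apply: measurable_fun_pair => //.
  by apply: measurable_funD => //; apply: measurable_funM.
apply: eq_integral => t _; rewrite /Ph /P2 -ge0_integralZl_EFin //; last first.
  by apply: (measurableT_comp mh (g := fun x : R => (x, (y, y * t + 0)))); apply: measurable_fun_pair.
apply: eq_integral => x _; rewrite /h2 /hh /ind /= -EFinM addr0; congr (EFin (_ * (nat_of_bool (_ && _))%:R)).
by congr (`|_| <= e); rewrite /q1; ring.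
Qed.

Lemma measurable_Wf e : measurable_fun setT (Wf e).
Proof.
pose h2 (p : R * (R * R)) : \bar R := (`|p.2.1| * (ind e p.2.2 p.1 p.2.1)%:R)%:E.
have mh2 : measurable_fun setT h2.
  by apply: measurable_ind => //; exact: measurableT_comp.
have h20 p : (0 <= h2 p)%E by exact: ind_ge0.
pose P2 (p : R * R) : \bar R := (\int[mu]_x h2 (x, p))%E.
have mP2 : measurable_fun setT P2 by exact: (measurable_tonelli3 mh2 h20).
have P20 p : (0 <= P2 p)%E by apply: integral_ge0.
exact: (measurable_tonelli2 mP2 P20).
Qed.

Lemma K1_ge0 : 0 <= K1.
Proof.
apply: addr_ge0; last by rewrite mulr_ge0 // ltW.
apply: mulr_ge0; first by rewrite mulr_ge0 // ltW.
have := normr_ge0 A; have := sqr_ge0 B; lra.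
Qed.

(** Dominated convergence works along sequences; [real_density] recovers the one-sided limit from
    them. *)
Lemma dct (u : R ^nat) : (forall n, 0 < u n) -> (u n @[n --> \oo] --> 0) ->
  mu.-integrable setT (fun t => (2 / nn t)%:E) /\
  ((\int[mu]_t (((2 * u n)^-1)%:E * Wf (u n) t))%E @[n --> \oo] --> (\int[mu]_t (2 / nn t)%:E)%E).
Proof.
move=> u0 uc.
have E n t : (((2 * u n)^-1)%:E * Wf (u n) t)%E = (wn (u n) t)%:E.
  by rewrite Wf_wn // -EFinM mulKf // mulf_neq0 // gt_eqF.
have [] := @dominated_convergence _ _ R mu setT measurableT
  (fun n t => (((2 * u n)^-1)%:E * Wf (u n) t)%E) (fun t => (2 / nn t)%:E) (fun t => (K1 * (1 + t ^+ 2)^-1)%:E).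
- by move=> n; apply: measurable_funeM; exact: measurable_Wf.
- exact: measurable_nnV.
- apply: aeW => t _ /=.
  rewrite [X in X @ _ --> _](_ : _ = (fun n => (wn (u n) t)%:E)); last by apply/funext => n; exact: E.
  apply/fine_cvgP; split; first exact: nearW.
  apply/cvgrPdist_le => eps eps0 /=.
  have n0 := nn_gt0 t; pose c := (2 * M / nn t + 2) / d.
  have c0 : 0 < c.
    by rewrite divr_gt0 // ltr_wpDl // divr_ge0 ?(ltW n0) // mulr_ge0 // m_ge0.
  have del0 : 0 < (eps / c) ^+ 2 by rewrite exprn_gt0 // divr_gt0.
  move/cvgrPdist_le: uc => /(_ _ del0); apply: filterS => n.
  rewrite sub0r normrN gtr0_norm // => hu.
  apply: le_trans (wn_dist t (u0 n)) _; rewrite -/c -ler_pdivlMr //.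
  have ec : 0 <= eps / c by rewrite divr_ge0 // ltW.
  by rewrite -(@ler_pXn2r _ 2) ?nnegrE ?sqrtr_ge0 // sqr_sqrtr // ltW.
- by apply: integrable_oneDsqrV; exact: K1_ge0.
- apply: aeW => t n _; rewrite E gee0_abs ?lee_fin ?wn_ge0 //; exact: wn_dom.
by move=> h1 _ h3; split.
Qed.

(** Finiteness of the integral is a by-product of dominated convergence, run on the sequence
    [1 / (n + 1)]. *)
Lemma int_nnV : (\int[mu]_t ((nn t)^-1)%:E = V%:E)%E /\ forall X, 0 <= X ->
  (\int[mu]_t (X / nn t)%:E = (X * V)%:E)%E.
Proof.
have i0 t : (0 <= ((nn t)^-1)%:E :> \bar R)%E by rewrite lee_fin invr_ge0 ltW // nn_gt0.
have mi : measurable_fun setT (fun t : R => ((nn t)^-1)%:E : \bar R).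
  by have := measurable_nnV (ler01 : 0 <= 1 :> R); under eq_fun do rewrite div1r.
have sc X : 0 <= X -> (\int[mu]_t (X / nn t)%:E = X%:E * \int[mu]_t ((nn t)^-1)%:E)%E.
  by move=> X0; rewrite -ge0_integralZl_EFin //.
have u0 (n : nat) : 0 < n.+1%:R^-1 :> R by rewrite invr_gt0 ltr0n.
have [/integrableP[_ fin] _] := @dct (fun n => n.+1%:R^-1) u0 (@cvg_harmonic R).
have f : (\int[mu]_t ((nn t)^-1)%:E \is a fin_num)%E.
  rewrite ge0_fin_numE; last exact: integral_ge0.
  apply: le_lt_trans fin; apply: ge0_le_integral => //.
    by apply: measurableT_comp => //; exact: measurable_nnV.
  move=> t _; rewrite gee0_abs ?lee_fin ?divr_ge0 ?(ltW (nn_gt0 t)) //.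
  by rewrite ler_peMl ?invr_ge0 ?(ltW (nn_gt0 t)) // ler1n.
split; first by rewrite /V fineK.
by move=> X X0; rewrite sc // -[in LHS](fineK f) EFinM.
Qed.

Lemma real_density : (2 * e)^-1 * fine (Vol e) @[e --> 0^'+] --> 2 * V.
Proof.
apply/cvg_at_rightP => u [u0 uc]; have [_ c] := dct u0 uc.
have [_ iv] := int_nnV; rewrite iv // in c.
apply: cvg_trans (@fine_cvg R nat \oo _ _ _ c); apply: near_eq_cvg; apply: nearW => n /=.
rewrite Vol_W ge0_integralZl_EFin //.
- by rewrite fine_scale // invr_gt0 mulr_gt0.
- by move=> t _; exact: Wf_ge0.
- exact: measurable_Wf.
by rewrite invr_ge0 mulr_ge0 // ltW.
Qed.

(** For [s] nonzero, replacing [t] by [s t] turns the norm into [s ^ 2 nn t] with Jacobian [|s|];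
    [int_level] then integrates over [s]. *)
Lemma real_area (X : R) : 0 <= X -> (\int[mu]_s \int[mu]_t
   (m (- (A * s ^+ 2 + B * s * t + C * t ^+ 2), d * s ^+ 2, d * s * t) <= X)%R%:R%:E = (X * V)%:E)%E.
Proof.
move=> X0; pose k (p : R * R) : \bar R :=
  (m (- (A * p.1 ^+ 2 + B * p.1 * p.2 + C * p.2 ^+ 2), d * p.1 ^+ 2, d * p.1 * p.2) <= X)%R%:R%:E.
have mk : measurable_fun setT k.
  apply: measurable_boolE; apply: measurable_fun_ler => //; apply: M_comp.
  - apply: (@measurable_funN _ _ _ setT (fun p : R * R => A * p.1 ^+ 2 + B * p.1 * p.2 + C * p.2 ^+ 2)).
    apply: measurable_funD; last by apply: measurable_funM => //; apply: measurable_funX.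
    apply: measurable_funD; last by apply: measurable_funM => //; apply: measurable_funM.
    by apply: measurable_funM => //; apply: measurable_funX.
  - by apply: measurable_funM => //; apply: measurable_funX.
  - by apply: measurable_funM => //; apply: measurable_funM.
have k00 p : (0 <= k p)%E by rewrite lee_fin.
have [_ <- //] := int_nnV.
pose l (p : R * R) : \bar R := (`|p.1| * (p.1 ^+ 2 * nn p.2 <= X)%R%:R)%:E.
have ml : measurable_fun setT l.
  apply/measurable_EFinP; apply: measurable_funM; first exact: measurable_abs.
  apply: measurable_boolR; apply: measurable_fun_ler => //; apply: measurable_funM.
    exact: measurable_funX.
  exact: measurable_nn.
have l0 p : (0 <= l p)%E by rewrite lee_fin mulr_ge0.
transitivity (\int[mu]_s \int[mu]_t l (s, t))%E; last first.
  by rewrite tonelliC //; apply: eq_integral => t _; rewrite int_level.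
apply: ge0_ae_eq_integral => //.
- exact: (measurable_tonelli1 mk).
- exact: measurable_tonelli1.
- by move=> s _; apply: integral_ge0 => t _; exact: (k00 (s, t)).
- by move=> s _; apply: integral_ge0.
apply: ae_eq_neq0 => s s0.
rewrite (@integral_affine R s 0 (fun t => k (s, t))) //; last first.
  by apply: (measurableT_comp mk); apply: measurable_fun_pair.
rewrite -ge0_integralZl_EFin //; last first.
  apply: (measurableT_comp mk (g := fun t : R => (s, s * t + 0))); apply: measurable_fun_pair => //.
  by apply: measurable_funD => //; apply: measurable_funM.
apply: eq_integral => t _; rewrite /k /l /= addr0 -EFinM; congr (EFin (_ * (nat_of_bool (_ <= _))%:R)).
have := mZ (s ^+ 2) (- q1 t, d, d * t); rewrite /= [ `|s ^+ 2|]ger0_norm ?sqr_ge0 // => <-.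
by congr m; congr (_, _, _); rewrite /q1; ring.
Qed.
End RealDensity.

Import Coefs.

Definition col3 (S : Type) (v : S * S * S) : 'cV[S]_3 :=
  \col_i (if i == i0 then v.1.1 else if i == i1 then v.1.2 else v.2).

Lemma col3K (S : Type) (v : S * S * S) : trip (col3 v) = v.
Proof. by case: v => [[x y] z]; rewrite /trip !mxE !eqI !eqxx. Qed.

Lemma tripK (S : Type) (x : 'cV[S]_3) : col3 (trip x) = x.
Proof.
apply/matrixP => i j; rewrite mxE ord1; have [->|->|->] := ord3 i; by rewrite ?eqI ?eqxx.
Qed.

(** * The norm in normal coordinates *)

Section NormData.
Variables (R : realType) (nrm : 'cV[R]_3 -> R) (g : 'M[R]_3).
Hypotheses (hn : is_norm nrm) (ug : g \in unitmx) (ng : forall x, nrm x = `|g *m x|).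

Lemma mxnorm_sup3 (x : 'cV[R]_3) : `|x| = sup3 (trip x).
Proof.
have h : `|x| = \big[Num.max/0]_ij `|x ij.1 ij.2| by exact: mx_normrE.
apply/eqP; rewrite eq_le; apply/andP; split.
  rewrite h; apply: bigmax_le => [|[i j] _ /=]; first exact: sup3_ge0.
  have [a b c] := sup3_ge (trip x); rewrite ord1; by have [->|->|->] := ord3 i.
have k i : `|x i 0| <= `|x| by rewrite h; exact: (@le_bigmax _ _ _ 0 (fun ij => `|x ij.1 ij.2|) (i, 0)).
by rewrite sup3_le !k.
Qed.

Definition n3 (v : R * R * R) : R := nrm (col3 v).
Definition phi (i : 'I_3) (v : R * R * R) : R := g i i0 * v.1.1 + g i i1 * v.1.2 + g i i2 * v.2.

Lemma n3E v : n3 v = sup3 (phi i0 v, phi i1 v, phi i2 v).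
Proof.
rewrite /n3 ng mxnorm_sup3; congr sup3; rewrite /trip /phi.
by congr (_, _, _); rewrite mxE sum3 !mxE !eqI !eqxx.
Qed.

Lemma n3Z k v : n3 (k * v.1.1, k * v.1.2, k * v.2) = `|k| * n3 v.
Proof.
case: hn => _ h _; rewrite /n3 -h; congr nrm; apply/matrixP => i j; rewrite !mxE.
by case: ifP => // _; case: ifP.
Qed.

Lemma n3D u v : n3 (u.1.1 + v.1.1, u.1.2 + v.1.2, u.2 + v.2) <= n3 u + n3 v.
Proof.
case: hn => _ _ h; apply: le_trans (h _ _); rewrite /n3 le_eqVlt; apply/orP; left; apply/eqP.
congr nrm; apply/matrixP => i j; rewrite !mxE; by case: ifP => // _; case: ifP.
Qed.

Lemma mulmx_le (h : 'M[R]_3) (y : 'cV[R]_3) : `|h *m y| <= (\sum_i \sum_j `|h i j|) * `|y|.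
Proof.
have y0 := normr_ge0 y.
have e (i : 'I_3) : `|y i 0| <= `|y|.
  rewrite mxnorm_sup3; have [a b c] := sup3_ge (trip y); by have [->|->|->] := ord3 i.
have k (i : 'I_3) : `|(h *m y) i 0| <= (\sum_i \sum_j `|h i j|) * `|y|.
  rewrite mxE; apply: le_trans (ler_norm_sum _ _ _) _.
  apply: le_trans (_ : _ <= (\sum_j `|h i j|) * `|y|) _.
    by rewrite mulr_suml; apply: ler_sum => j _; rewrite normrM ler_wpM2l.
  rewrite ler_wpM2r // [X in _ <= X](bigD1 i) //= lerDl; apply: sumr_ge0 => a _; exact: sumr_ge0.
by rewrite mxnorm_sup3 sup3_le !k.
Qed.

(** A crude constant read off the inverse of [g]; it gives positivity of [nrm] and boundedness of
    the set in [K0], while the final estimates use [K0]. *)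
Definition kap0 : R := 1 + \sum_i \sum_j `|invmx g i j|.

Lemma kap0_ge1 : 1 <= kap0.
Proof. by rewrite lerDl; apply: sumr_ge0 => i _; exact: sumr_ge0. Qed.

Lemma norm_kap (x : 'cV[R]_3) : `|x| <= kap0 * nrm x.
Proof.
rewrite -{1}[x](mulKmx ug) ng; apply: le_trans (mulmx_le _ _) _.
by rewrite ler_wpM2r // lerDr.
Qed.

Lemma nrm_gt0 x : x != 0 -> 0 < nrm x.
Proof.
move=> x0; have h : 0 < kap0 * nrm x by apply: lt_le_trans (norm_kap x); rewrite normr_gt0.
by move: h; rewrite pmulr_rgt0 // (lt_le_trans ltr01 kap0_ge1).
Qed.

(** [sup] of an unbounded set is a default value; [K0] becomes an upper bound through this. *)
Lemma K0_ub : has_ubound [set `|x| / nrm x | x in [set x : 'cV[R]_3 | x != 0]].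
Proof.
exists kap0 => _ [x /= x0 <-]; rewrite ler_pdivrMr ?nrm_gt0 //; exact: norm_kap.
Qed.

Lemma K0_bound x : `|x| <= K0 nrm * nrm x.
Proof.
have [->|x0] := eqVneq x 0.
  by rewrite normr0 ng mulmx0 normr0 mulr0.
rewrite -ler_pdivrMr ?nrm_gt0 // /K0; apply: le_trans (_ : _ <= sup [set `|x| / nrm x | x in [set x : 'cV[R]_3 | x != 0]]) _.
  by apply: (ub_le_sup K0_ub); exists x.
by rewrite lerDr.
Qed.

Lemma K0_ge1 : 1 <= K0 nrm.
Proof.
have x0 : (const_mx 1 : 'cV[R]_3) != 0.
  by apply/eqP => /matrixP/(_ i0 0); rewrite !mxE => /eqP; rewrite oner_eq0.
rewrite lerDl; apply: le_trans (_ : `|const_mx 1 : 'cV[R]_3| / nrm (const_mx 1) <= _).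
  by rewrite divr_ge0 // ltW // nrm_gt0.
by apply: (ub_le_sup K0_ub); exists (const_mx 1).
Qed.

Lemma sup3_K0 v : sup3 v <= K0 nrm * n3 v.
Proof. by rewrite -{1}(col3K v) -mxnorm_sup3; exact: K0_bound. Qed.

Lemma act_sup3 l : exists K : R, 0 < K /\ forall v : R * R * R, sup3 (act l v) <= K * sup3 v.
Proof.
elim: l => [|o l [K [Kp IH]]]; first by exists 1; split=> // v; rewrite mul1r.
have sh : exists K : R, 0 < K /\ forall v : R * R * R, sup3 (shear1 o v) <= K * sup3 v.
  have k (a b : int) (x y z m : R) : 0 <= m -> `|x| <= m -> `|y| <= m -> `|z| <= m ->
      `|x + (a%:~R * y + b%:~R * z)| <= (1 + `|a%:~R| + `|b%:~R|) * m.
    move=> m0 hx hy hz; apply: le_trans (ler_normD _ _) _.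
    have := ler_normD (a%:~R * y) (b%:~R * z); rewrite !normrM => h.
    have h1 : `|a%:~R| * `|y| <= `|a%:~R| * m by rewrite ler_wpM2l.
    have h2 : `|b%:~R| * `|z| <= `|b%:~R| * m by rewrite ler_wpM2l.
    by rewrite !mulrDl mul1r; lra.
  have k1 (a b : int) (x m : R) : 0 <= m -> `|x| <= m -> `|x| <= (1 + `|a%:~R| + `|b%:~R|) * m.
    by move=> m0 hx; apply: le_trans hx _; rewrite ler_peMl // -addrA lerDl addr_ge0.
  have pos (a b : int) : 0 < 1 + `|a%:~R : R| + `|b%:~R : R| by rewrite -addrA ltr_pwDl // addr_ge0.
  case: o => a b; exists (1 + `|a%:~R| + `|b%:~R|); split=> // v;
  have [h1 h2 h3] := sup3_ge v; have h0 := sup3_ge0 v; rewrite sup3_le /=; apply/and3P.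
  - by split; [exact: (k a b)|exact: (k1 a b)|exact: (k1 a b)].
  - by split; [exact: (k1 a b)|exact: (k a b)|exact: (k1 a b)].
  - by split; [exact: (k1 a b)|exact: (k1 a b)|exact: (k a b)].
have [K2 [K2p h2]] := sh; exists (K2 * K); split; first exact: mulr_gt0.
by move=> v /=; apply: le_trans (h2 _) _; rewrite -mulrA ler_wpM2l // ltW.
Qed.

Variable l : seq shear.
Definition mm (v : R * R * R) : R := n3 (act l v).

Lemma mmZ k v : mm (k * v.1.1, k * v.1.2, k * v.2) = `|k| * mm v.
Proof.
rewrite /mm -n3Z; congr n3.
have -> : (k * v.1.1, k * v.1.2, k * v.2) = lc3 k 0 0 v v v by rewrite /lc3 !mul0r !addr0.
by rewrite act_lc3 /lc3 !mul0r !addr0.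
Qed.

Lemma mmD u v : mm (u.1.1 + v.1.1, u.1.2 + v.1.2, u.2 + v.2) <= mm u + mm v.
Proof.
rewrite /mm; apply: le_trans (n3D _ _); rewrite le_eqVlt; apply/orP; left; apply/eqP; congr n3.
have -> : (u.1.1 + v.1.1, u.1.2 + v.1.2, u.2 + v.2) = lc3 1 1 0 u v v by rewrite /lc3 !mul0r !mul1r !addr0.
by rewrite act_lc3 /lc3 !mul0r !mul1r !addr0.
Qed.

(** This constant depends on the shears [l]; it enters limits and integrability only, never the
    error term. *)
Lemma mmS : exists kap : R, 0 < kap /\ forall v, sup3 v <= kap * mm v.
Proof.
have [K [Kp h]] := act_sup3 (linv l); exists (K * K0 nrm); split.
  by rewrite mulr_gt0 // (lt_le_trans ltr01 K0_ge1).
move=> v; rewrite -{1}(actK l v); apply: le_trans (h _) _.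
by rewrite -mulrA ler_wpM2l ?(ltW Kp) //; exact: sup3_K0.
Qed.

Lemma phi_lc3 i r s t u v w : phi i (lc3 r s t u v w) = r * phi i u + s * phi i v + t * phi i w.
Proof. by rewrite /phi /lc3 /=; ring. Qed.

Lemma measurable_n3 (dd : measure_display) (T : measurableType dd) (f1 f2 f3 : T -> R) :
  measurable_fun setT f1 -> measurable_fun setT f2 -> measurable_fun setT f3 ->
  measurable_fun setT (fun x => n3 (f1 x, f2 x, f3 x)).
Proof.
move=> h1 h2 h3; under eq_fun do rewrite n3E.
have k i : measurable_fun setT (fun x => `|phi i (f1 x, f2 x, f3 x)|).
  apply: measurable_abs; apply: measurable_funD; last exact: measurable_funM.
  by apply: measurable_funD; exact: measurable_funM.
apply: (@measurable_maxr _ _ R setT (fun x => `|phi i0 (f1 x, f2 x, f3 x)|)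
  (fun x => Num.max `|phi i1 (f1 x, f2 x, f3 x)| `|phi i2 (f1 x, f2 x, f3 x)|)); first exact: k.
by apply: (@measurable_maxr _ _ R setT (fun x => `|phi i1 (f1 x, f2 x, f3 x)|)
  (fun x => `|phi i2 (f1 x, f2 x, f3 x)|)); exact: k.
Qed.

Lemma act_measurable (dd : measure_display) (T : measurableType dd) (f : T -> R * R * R) :
  measurable_fun setT (fun x => (f x).1.1) -> measurable_fun setT (fun x => (f x).1.2) ->
  measurable_fun setT (fun x => (f x).2) ->
  [/\ measurable_fun setT (fun x => (act l (f x)).1.1), measurable_fun setT (fun x => (act l (f x)).1.2)
    & measurable_fun setT (fun x => (act l (f x)).2)].
Proof.
move=> h1 h2 h3; elim: l => [|o l' [k1 k2 k3]] /=; first by split.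
have c (a b : int) (u v : T -> R) : measurable_fun setT u -> measurable_fun setT v ->
   measurable_fun setT (fun x => a%:~R * u x + b%:~R * v x).
  by move=> hu hv; apply: measurable_funD; exact: measurable_funM.
by case: o => a b; split=> //=; apply: measurable_funD => //; exact: c.
Qed.

Lemma mmM : measurable_fun setT (fun p : R * (R * R) => mm (p.1, p.2.1, p.2.2)).
Proof.
have m0 : measurable_fun setT (fun p : R * (R * R) => p.1) by exact: measurable_fst.
have m1 : measurable_fun setT (fun p : R * (R * R) => p.2.1) by exact: measurableT_comp.
have m2 : measurable_fun setT (fun p : R * (R * R) => p.2.2) by exact: measurableT_comp.
have [a1 a2 a3] := @act_measurable _ _ (fun p : R * (R * R) => (p.1, p.2.1, p.2.2)) m0 m1 m2.
have := measurable_n3 a1 a2 a3.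
rewrite (_ : (fun x => n3 _) = (fun p => mm (p.1, p.2.1, p.2.2))) //.
Qed.

Lemma I3_shear (k : R * R * R -> \bar R) o :
  measurable_fun setT (fun p : R * (R * R) => k (p.1, p.2.1, p.2.2)) -> (forall v, 0 <= k v)%E ->
  measurable_fun setT (fun p : R * (R * R) => k (shear1 o (p.1, p.2.1, p.2.2))) /\
  I3 (fun p => k (shear1 o (p.1, p.2.1, p.2.2))) = I3 (fun p => k (p.1, p.2.1, p.2.2)).
Proof.
move=> mk k0; pose h (p : R * (R * R)) := k (p.1, p.2.1, p.2.2).
have m1 : measurable_fun setT (fun p : R * (R * R) => p.2.1) by exact: measurableT_comp.
have m2 : measurable_fun setT (fun p : R * (R * R) => p.2.2) by exact: measurableT_comp.
have h0 p : (0 <= h p)%E by exact: k0.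
have c (a b : R) (u v : R * (R * R) -> R) : measurable_fun setT u -> measurable_fun setT v ->
   measurable_fun setT (fun x => a * u x + b * v x).
  by move=> hu hv; apply: measurable_funD; exact: measurable_funM.
case: o => a b /=; split.
- apply: (measurableT_comp mk (g := fun p : R * (R * R) => (p.1 + (a%:~R * p.2.1 + b%:~R * p.2.2), (p.2.1, p.2.2)))).
  apply: measurable_fun_pair; last exact: measurable_fun_pair.
  by apply: measurable_funD => //; apply: c.
- by have := @I3_shift1 R h a%:~R b%:~R mk h0; rewrite /h /=.
- apply: (measurableT_comp mk (g := fun p : R * (R * R) => (p.1, (p.2.1 + (a%:~R * p.1 + b%:~R * p.2.2), p.2.2)))).
  apply: measurable_fun_pair => //; apply: measurable_fun_pair => //.
  by apply: measurable_funD => //; apply: c.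
- by have := @I3_shift2 R h a%:~R b%:~R mk h0; rewrite /h /=.
- apply: (measurableT_comp mk (g := fun p : R * (R * R) => (p.1, (p.2.1, p.2.2 + (a%:~R * p.1 + b%:~R * p.2.1))))).
  apply: measurable_fun_pair => //; apply: measurable_fun_pair => //.
  by apply: measurable_funD => //; apply: c.
- by have := @I3_shift3 R h a%:~R b%:~R mk h0; rewrite /h /=.
Qed.

Lemma I3_act (k : R * R * R -> \bar R) l' :
  measurable_fun setT (fun p : R * (R * R) => k (p.1, p.2.1, p.2.2)) -> (forall v, 0 <= k v)%E ->
  I3 (fun p => k (act l' (p.1, p.2.1, p.2.2))) = I3 (fun p => k (p.1, p.2.1, p.2.2)).
Proof.
elim: l' k => [|o l' IH] k mk k0; first reflexivity.
have [m1 <-] := I3_shear o mk k0.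
exact (IH (fun v => k (shear1 o v)) m1 (fun v => k0 _)).
Qed.

Variables (Q : Ternary.polyZ) (d A B C : int).
Hypotheses (hQ : Ternary.quadratic_form Q) (d0 : 0 < d) (C0 : C != 0).
Hypothesis nfE : forall v, ev (FQ Q) (act l v) =
  d * v.1.1 * v.1.2 + A * v.1.2 ^+ 2 + B * v.1.2 * v.2 + C * v.2 ^+ 2.

Lemma nfRE (v : R * R * R) : ev (castF R (FQ Q)) (act l v) =
  d%:~R * v.1.1 * v.1.2 + A%:~R * v.1.2 ^+ 2 + B%:~R * v.1.2 * v.2 + C%:~R * v.2 ^+ 2.
Proof.
have E : pull (FQ Q) l = Form 0 A C B 0 d.
  by apply: ev_inj => w; rewrite ev_pull nfE /ev /=; ring.
by rewrite -ev_pull cast_pull E /ev /castF /=; ring.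
Qed.

Lemma vec3E (p : R * (R * R)) : vec3 p = col3 (p.1, p.2.1, p.2.2).
Proof.
apply/matrixP => i j; rewrite !mxE /=.
by have [->|->|->] := ord3 i; rewrite ?eqI ?eqxx valI.
Qed.

Lemma vol_I3 (b : R * R * R -> bool) (A' : set 'cV[R]_3) :
  measurable_fun setT (fun p : R * (R * R) => b (p.1, p.2.1, p.2.2)) ->
  (forall v, A' (col3 v) <-> b v) -> vol A' = I3 (fun p => (b (p.1, p.2.1, p.2.2))%:R%:E).
Proof.
move=> mb Ab; have mE : measurable_fun setT (fun p : R * (R * R) => (b (p.1, p.2.1, p.2.2))%:R%:E : \bar R).
  exact: measurable_boolE.
have b0 p : (0 <= (b (p.1, p.2.1, p.2.2))%:R%:E :> \bar R)%E by rewrite lee_fin.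
rewrite (I3E mE b0).
transitivity (\int[leb1 R]_x leb2 R (xsection (@vec3 R @^-1` A') x))%E; first by [].
apply: eq_integral => x _.
transitivity (leb2 R [set p | b (x, p.1, p.2)]).
  congr (leb2 R _); apply/seteqP; split => p; rewrite /xsection /= in_setE /= vec3E /=; by move/(Ab (x, p.1, p.2)).
rewrite -(@integral_bool _ _ R (leb2 R) (fun p => b (x, p.1, p.2))) //.
by apply: (measurableT_comp mb (g := fun p : R * R => (x, p))); exact: measurable_fun_pair.
Qed.

Definition VV : R := V d%:~R A%:~R B%:~R C%:~R mm.

Let d1R : 1 <= d%:~R :> R. Proof. by rewrite ler1z. Qed.
Let C1R : 1 <= `|C%:~R : R|. Proof. by rewrite -intr_norm ler1z -gtz0_ge1 normr_gt0. Qed.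

(** Shears preserve volume, so the density may be computed in normal coordinates. *)
Lemma sigma_ooE : sigma_oo Q nrm = 2 * VV.
Proof.
have [kap [kp hk]] := mmS.
apply: cvg_lim => //.
have E e : vol [set x | `|Ternary.eval Q x| <= e /\ nrm x <= 1] = Vol d%:~R A%:~R B%:~R C%:~R mm e; last first.
  apply: cvg_trans (real_density d1R C1R kp mmZ mmD hk mmM (A := A%:~R) (B := B%:~R)).
  by apply: near_eq_cvg; apply: nearW => e; cbv beta; rewrite E.
pose b (v : R * R * R) : bool := (`|ev (castF R (FQ Q)) v| <= e) && (n3 v <= 1).
have mb : measurable_fun setT (fun p : R * (R * R) => b (p.1, p.2.1, p.2.2)).
  have m1 : measurable_fun setT (fun p : R * (R * R) => p.2.1) by exact: measurableT_comp.
  have m2 : measurable_fun setT (fun p : R * (R * R) => p.2.2) by exact: measurableT_comp.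
  apply: measurable_and; last by apply: measurable_fun_ler => //; exact: measurable_n3.
  apply: measurable_fun_ler => //; apply: measurable_abs; rewrite /ev /=.
  have s (f : R * (R * R) -> R) c : measurable_fun setT f -> measurable_fun setT (fun x => c * f x ^+ 2).
    by move=> hf; apply: measurable_funM => //; exact: measurable_funX.
  have pr (f f' : R * (R * R) -> R) c : measurable_fun setT f -> measurable_fun setT f' -> measurable_fun setT (fun x => c * (f x * f' x)).
    by move=> hf hf'; apply: measurable_funM => //; exact: measurable_funM.
  apply: measurable_funD; last by apply: pr.
  apply: measurable_funD; last by apply: pr.
  apply: measurable_funD; last by apply: pr.
  apply: measurable_funD; last by apply: s.
  by apply: measurable_funD; apply: s.
have mE : measurable_fun setT (fun p : R * (R * R) => (b (p.1, p.2.1, p.2.2))%:R%:E : \bar R).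
  exact: measurable_boolE.
have b0 v : (0 <= (b v)%:R%:E :> \bar R)%E by rewrite lee_fin.
have fe : (fun p : R * (R * R) => (b (act l (p.1, p.2.1, p.2.2)))%:R%:E : \bar R) =
    (fun p => (hh d%:~R A%:~R B%:~R C%:~R mm e p)%:R%:E).
  by apply/funext => p; rewrite /b /hh nfRE.
transitivity (I3 (fun p : R * (R * R) => (b (p.1, p.2.1, p.2.2))%:R%:E : \bar R)).
  apply: vol_I3 mb _ => v /=; rewrite eval_FQ // col3K /b -/(n3 v); split; first by case=> -> ->.
  by case/andP.
by rewrite /Vol -fe; exact (esym (@I3_act (fun v => (b v)%:R%:E) l mE b0)).
Qed.

(** Each row of [g] composed with the parametrisation is a binary quadratic form in [(s, t)].
    Isometry with the maximum norm thus makes the region one cut out by three such forms. *)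
Definition cc (i : 'I_3) : R * R * R :=
  (phi i (act l (- A%:~R, d%:~R, 0)), phi i (act l (- B%:~R, 0, d%:~R)), phi i (act l (- C%:~R, 0, 0))).
Notation rg := (reg (cc i0) (cc i1) (cc i2)).

Lemma reg_mm X s t : rg X s t =
  (mm (- (A%:~R * s ^+ 2 + B%:~R * s * t + C%:~R * t ^+ 2), d%:~R * s ^+ 2, d%:~R * s * t) <= X).
Proof.
rewrite /reg /mm n3E sup3_le /=.
have -> : (- (A%:~R * s ^+ 2 + B%:~R * s * t + C%:~R * t ^+ 2), d%:~R * s ^+ 2, d%:~R * s * t) =
   lc3 (s ^+ 2) (s * t) (t ^+ 2) (- A%:~R, d%:~R, 0) (- B%:~R, 0, d%:~R) (- C%:~R, 0, 0) :> R * R * R.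
  by rewrite /lc3 /=; congr (_, _, _); ring.
have e i : s ^+ 2 * phi i (act l (- A%:~R, d%:~R, 0)) + s * t * phi i (act l (- B%:~R, 0, d%:~R))
    + t ^+ 2 * phi i (act l (- C%:~R, 0, 0)) = qf (cc i) s t by rewrite /qf /cc /=; ring.
by rewrite act_lc3 !phi_lc3 !e.
Qed.

Lemma areaVV X : 0 <= X -> area (cc i0) (cc i1) (cc i2) X = X * VV.
Proof.
move=> X0; have [kap [kp hk]] := mmS.
have := @real_area R d%:~R A%:~R B%:~R C%:~R kap mm d1R C1R kp mmZ mmD hk mmM X X0.
rewrite -/VV /area => h; have -> : X * VV = fine (X * VV)%:E by [].
rewrite -h; congr fine; apply: eq_integral => s _; apply: eq_integral => t _.
by rewrite reg_mm.
Qed.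
End NormData.

(** * Inverse square roots summed over divisors *)

Section DivisorSum.
Variable R : realType.

(** With [a = sqrt n] and [b = sqrt (n + 1)] the step [1 / b <= 2 (b - a)] follows from
    [(b - a) ^ 2 >= 0] and [b ^ 2 = a ^ 2 + 1]. *)
Lemma sum_invsqrt (n : nat) : \sum_(1 <= k < n.+1) (Num.sqrt (k%:R : R))^-1 <= 2 * Num.sqrt n%:R.
Proof.
elim: n => [|n IH]; first by rewrite big_geq // mulr_ge0 // sqrtr_ge0.
rewrite big_nat_recr //=; apply: le_trans (lerD IH (lexx _)) _.
set a := Num.sqrt n%:R; set b := Num.sqrt n.+1%:R.
have a0 : 0 <= a by rewrite sqrtr_ge0.
have b0 : 0 < b by rewrite sqrtr_gt0 ltr0n.
have ab : b ^+ 2 = a ^+ 2 + 1 by rewrite !sqr_sqrtr // -natr1.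
suff : b^-1 <= 2 * (b - a) by lra.
rewrite -div1r ler_pdivrMr //; have := sqr_ge0 (b - a).
have -> : (b - a) ^+ 2 = b ^+ 2 - 2 * a * b + a ^+ 2 by ring.
have -> : 2 * (b - a) * b = 2 * b ^+ 2 - 2 * a * b by ring.
by rewrite ab; lra.
Qed.

(** [Y] is the integer part of the square root of [N0]. Divisors up to [Y] are compared with all
    integers up to [Y]; a larger divisor has a codivisor at most [Y], so there are at most [Y] of
    them, each giving at most [1 / sqrt Y]. *)
Lemma sum_divisors (N0 : nat) : (0 < N0)%N -> exists Y : nat, (Y ^ 2 <= N0)%N /\
  \sum_(la <- divisors N0) (Num.sqrt (la%:R : R))^-1 <= 3 * Num.sqrt Y%:R.
Proof.
move=> N00.
have ex : exists Y : nat, (Y ^ 2 <= N0)%N by exists 1%N.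
have bd (Y : nat) : (Y ^ 2 <= N0 -> Y <= N0)%N by nia.
case: (ex_maxnP ex bd) => Y hY maxY; exists Y; split=> //.
have Y1 : (0 < Y)%N by apply: maxY.
have YN : (N0 < Y.+1 ^ 2)%N by rewrite ltnNge; apply/negP => /maxY; rewrite ltnn.
have YR : 0 < Num.sqrt (Y%:R : R) by rewrite sqrtr_gt0 ltr0n.
rewrite (bigID (fun la => la <= Y)%N) /=.
have h1 : \sum_(la <- divisors N0 | (la <= Y)%N) (Num.sqrt (la%:R : R))^-1 <= 2 * Num.sqrt Y%:R.
  apply: le_trans (sum_invsqrt Y); rewrite -big_filter.
  apply: le_trans (@sum_uniq_le R _ Y.+1 (fun k => (Num.sqrt (k%:R : R))^-1) _ _ _) _.
  - by rewrite filter_uniq // divisors_uniq.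
  - by move=> k; rewrite mem_filter => /andP[].
  - by move=> k; rewrite invr_ge0 sqrtr_ge0.
  by rewrite big_ltn // sqrtr0 invr0 add0r.
have h2 : \sum_(la <- divisors N0 | ~~ (la <= Y)%N) (Num.sqrt (la%:R : R))^-1 <= Num.sqrt Y%:R.
  rewrite -big_filter; set r := [seq _ <- _ | _].
  have rP la : la \in r -> (Y < la)%N /\ (la %| N0)%N.
    by rewrite mem_filter -ltnNge -dvdn_divisors // => /andP[].
  have sz : (size r <= Y)%N.
    have <- : size [seq (N0 %/ la)%N | la <- r] = size r by rewrite size_map.
    rewrite -(size_iota 1 Y); apply: uniq_leq_size.
      rewrite map_inj_in_uniq ?filter_uniq ?divisors_uniq // => x y /rP[_ dx] /rP[_ dy] e.
      have e1 : (N0 %/ (N0 %/ x) = N0 %/ (N0 %/ y))%N by rewrite e.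
      by rewrite !divnA // !mulKn // in e1.
    move=> m /mapP[la /rP[Yl dl] ->]; rewrite mem_iota add1n ltnS.
    have l0 : (0 < la)%N by apply: leq_trans Yl.
    rewrite divn_gt0 // dvdn_leq //= -ltnS ltn_divLR //.
    by apply: leq_trans YN _; rewrite -mulnn leq_mul2l Yl orbT.
  apply: le_trans (_ : _ <= \sum_(la <- r) (Num.sqrt Y%:R)^-1) _.
    rewrite big_seq [X in _ <= X]big_seq; apply: ler_sum => la /rP[Yl _].
    rewrite lef_pV2 ?posrE // ?sqrtr_gt0 ?ltr0n; last by apply: leq_trans Yl.
    by rewrite ler_sqrt // ler_nat ltnW.
  have e (c : R) : \sum_(la <- r) c = (size r)%:R * c by rewrite big_const_seq count_predT iter_addr_0 mulr_natl.
  rewrite e ler_pdivrMr // -expr2 sqr_sqrtr //.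
  by rewrite ler_nat.
lra.
Qed.
End DivisorSum.

(** * Collecting the constants *)

Section Numerics.
Variable R : realType.

Lemma ln_le_sub1 (x : R) : 0 < x -> ln x <= x - 1.
Proof.
move=> x0; have := @le_ln1Dx R (x - 1); rewrite [1 + _]addrC subrK; apply.
by rewrite ltrBrDr addNr.
Qed.

Lemma ln_ge_half (x : R) : 2 <= x -> 2^-1 <= ln x.
Proof.
move=> x2; have x0 : 0 < x by apply: lt_le_trans x2.
have := @ln_le_sub1 x^-1; rewrite invr_gt0 lnV ?posrE // => /(_ x0) h.
have : x^-1 <= 2^-1 by rewrite lef_pV2 ?posrE.
have : (2 : R)^-1 + 2^-1 = 1 by field.
lra.
Qed.

Lemma ln_prod3 (a b c : R) : 0 < a -> 0 < b -> 0 < c -> ln (a * b * c) = ln a + ln b + ln c.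
Proof. by move=> a0 b0 c0; rewrite lnM ?posrE ?mulr_gt0 // lnM ?posrE. Qed.

(** In terms of [w], the fourth root of [q], the factors are [O(q ^ 4 sqrt BK)] for [Dl H],
    [O(w ln BK)] for the logarithm and [O(w ^ 3)] for [S]. *)
Lemma error_numerics (q Dl N0 H0 BK S Y : R) : 1 <= q -> 1 <= Dl -> Dl <= 8 * q ^+ 3 ->
  0 <= H0 -> Dl ^+ 2 * H0 <= 60 * 1000 * q ^+ 8 -> 1 <= N0 -> N0 <= Dl -> 2 <= BK ->
  0 <= Y -> Y ^+ 2 <= N0 -> 0 <= S -> S <= 3 * Num.sqrt Y ->
  forall H, H = Num.sqrt (H0 * BK) + 1 ->
  51 * Dl * H * (1 + ln (N0 * H)) * S <=
  51 * 253 * 4105 * 6 * (Num.sqrt BK * ln BK * q ^+ 5).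
Proof.
move=> q1 D1 Dq H00 DH N1 ND BK2 Y0 YN S0 SY H HE.
have q0 : 0 <= q by lra.
have BK0 : 0 <= BK by lra.
set w := Num.sqrt (Num.sqrt q).
have w4 : w ^+ 4 = q by rewrite (_ : 4 = 2 * 2)%N // exprM !sqr_sqrtr // sqrtr_ge0.
have w0 : 0 <= w by rewrite sqrtr_ge0.
have w1 : 1 <= w.
  by rewrite -(@ler_pXn2r _ 4) ?nnegrE // expr1n w4.
set b := Num.sqrt BK.
have b0 : 0 <= b by rewrite sqrtr_ge0.
have b2 : b ^+ 2 = BK by rewrite sqr_sqrtr.
have b1 : 1 <= b by rewrite -(@ler_pXn2r _ 2) ?nnegrE // expr1n b2; lra.
have H1 : 1 <= H by rewrite HE lerDr sqrtr_ge0.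
have q4 : 0 <= q ^+ 4 by rewrite exprn_ge0.
have qX n : 1 <= q ^+ n by rewrite exprn_ege1.
(* [245 ^ 2 = 60 * 1000 + 25], and [253 = 245 + 8]. *)
have DHb : Dl * H <= 253 * q ^+ 4 * b.
  have e1 : Dl * Num.sqrt (H0 * BK) <= 245 * q ^+ 4 * b.
    rewrite -(@ler_pXn2r _ 2) ?nnegrE ?mulr_ge0 ?sqrtr_ge0 //; last lra.
    have -> : (Dl * Num.sqrt (H0 * BK)) ^+ 2 = Dl ^+ 2 * H0 * BK by rewrite exprMn sqr_sqrtr ?mulr_ge0 // mulrA.
    have -> : (245 * q ^+ 4 * b) ^+ 2 = (60 * 1000 + 25) * q ^+ 8 * BK by rewrite -b2; ring.
    apply: le_trans (_ : _ <= 60 * 1000 * q ^+ 8 * BK) _; first by rewrite ler_wpM2r.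
    by rewrite ler_wpM2r // ler_wpM2r ?exprn_ge0 //; lra.
  have e2 : Dl <= 8 * q ^+ 4 * b.
    apply: le_trans Dq _; rewrite -mulrA ler_wpM2l // [q ^+ 4]exprSr -mulrA ler_peMr ?exprn_ge0 //.
    by rewrite -[1]mulr1 ler_pM.
  rewrite HE mulrDr mulr1; apply: le_trans (lerD e1 e2) _.
  by rewrite le_eqVlt; apply/orP; left; apply/eqP; ring.
have Hb : H <= 253 * q ^+ 4 * b by apply: le_trans DHb; rewrite ler_peMl //; lra.
have el : 2^-1 <= ln BK by apply: ln_ge_half.
have NHp : 0 < N0 * H by rewrite mulr_gt0 //; lra.
have wp : 0 < w by apply: lt_le_trans w1.
(* [q ^ 7] is [w ^ 28]; the logarithm of the numerical constant is bounded by [ln x <= x - 1]. *)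
have [W [W0 WE lW]] : exists W : R, [/\ 0 < W, q ^+ 7 = W & ln W = ln w *+ 28].
  exists (w ^+ 28); split; [exact: exprn_gt0|by rewrite -w4 -exprM (_ : (4 * 7)%N = 28%N)|exact: lnXn].
have [K [Kp KE lK]] : exists K : R, [/\ 0 < K, K = 8 * 253 & ln K <= 8 * 253 - 1].
  by exists (8 * 253); split; [exact: mulr_gt0| |apply: ln_le_sub1; exact: mulr_gt0].
have NH : N0 * H <= K * W * BK.
  apply: le_trans (_ : _ <= (8 * q ^+ 3) * (253 * q ^+ 4 * b)) _.
    by apply: ler_pM => //; [lra|lra|exact: le_trans Dq].
  have -> : 8 * q ^+ 3 * (253 * q ^+ 4 * b) = K * q ^+ 7 * b by rewrite KE; ring.
  rewrite WE; apply: ler_wpM2l; first by apply: mulr_ge0; exact: ltW.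
  by rewrite -b2 expr2; apply: ler_peMl.
(* [4105 = 2 (8 * 253 + 28) + 1]: the terms without [ln BK] are absorbed by [1 <= w] and
   [1 / 2 <= ln BK]. *)
have lnb : 1 + ln (N0 * H) <= 4105 * ln BK * w.
  have lw : ln w <= w - 1 by apply: ln_le_sub1.
  have BKp : 0 < BK by lra.
  have l1 : ln (N0 * H) <= ln (K * W * BK).
    by rewrite ler_ln ?posrE // (lt_le_trans NHp NH).
  rewrite (ln_prod3 Kp W0 BKp) lW in l1.
  have l3 : ln w *+ 28 <= 28 * (w - 1) by rewrite -(mulr_natl (ln w)) ler_wpM2l.
  have l4 : 2^-1 * w <= ln BK * w by rewrite ler_wpM2r.
  have l5 : ln BK <= ln BK * w by rewrite ler_peMr //; lra.
  have l6 : (2 : R)^-1 * w * 2 = w by field.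
  lra.
(* Fourth powers are compared: [Y ^ 2 <= 8 q ^ 3 <= 16 w ^ 12]. *)
have Yw : Num.sqrt Y <= 2 * w ^+ 3.
  have w3 : 0 <= w ^+ 3 by rewrite exprn_ge0.
  rewrite -(@ler_pXn2r _ 4) ?nnegrE ?sqrtr_ge0 ?mulr_ge0 //.
  have -> : Num.sqrt Y ^+ 4 = Y ^+ 2 by rewrite (_ : 4 = 2 * 2)%N // exprM sqr_sqrtr.
  have -> : (2 * w ^+ 3) ^+ 4 = 8 * q ^+ 3 + 8 * q ^+ 3 by rewrite -w4; ring.
  have := qX 3; lra.
have Sw : S <= 6 * w ^+ 3 by lra.
have l0 : 0 <= 1 + ln (N0 * H).
  have : 0 <= ln (N0 * H) by rewrite ln_ge0 // -[1]mulr1 ler_pM.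
  lra.
have D0 : 0 <= Dl * H by rewrite mulr_ge0; lra.
apply: le_trans (_ : _ <= 51 * (253 * q ^+ 4 * b) * (4105 * ln BK * w) * (6 * w ^+ 3)) _.
  apply: ler_pM => //; first by rewrite mulr_ge0 // -mulrA mulr_ge0.
  apply: ler_pM => //; first by rewrite -mulrA mulr_ge0.
  by rewrite -mulrA ler_wpM2l.
rewrite le_eqVlt; apply/orP; left; apply/eqP.
have -> : q ^+ 5 = q ^+ 4 * w ^+ 4 by rewrite w4 -exprSr.
ring.
Qed.
End Numerics.

(** * Counting the zeros and matching the constants *)

Section Count.
Variables (R : realType) (nrm : 'cV[R]_3 -> R) (g : 'M[R]_3).
Hypotheses (hn : is_norm nrm) (ug : g \in unitmx) (ng : forall x, nrm x = `|g *m x|).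
Variables (Q : Ternary.polyZ) (l : seq shear) (d A B C : int).
Hypotheses (hQ : Ternary.quadratic_form Q) (d0 : 0 < d) (C0 : C != 0).
Hypothesis nfE : forall v, ev (FQ Q) (act l v) =
  d * v.1.1 * v.1.2 + A * v.1.2 ^+ 2 + B * v.1.2 * v.2 + C * v.2 ^+ 2.
Variable X : R.
Hypothesis X0 : 0 <= X.
Let N0 : nat := `|(d * C)%R|%N.
Let N00 : (0 < N0)%N. Proof. by rewrite absz_gt0 mulf_neq0 // gt_eqF. Qed.
Notation rg := (reg (cc g l d A B C i0) (cc g l d A B C i1) (cc g l d A B C i2)).
Notation ggs := (gg d A B C).
Notation mmr := (mm nrm l).

Lemma cast_col3 (v : int * int * int) : map_mx intr (col3 v) = col3 (castv R v).
Proof.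
apply/matrixP => i j; rewrite !mxE /castv /=; by case: ifP => // _; case: ifP.
Qed.

Lemma prim_gcd3 (x : 'cV[int]_3) : primitive x <-> gcd3 (trip x) = 1%N.
Proof.
rewrite /primitive !big_ord_recl big_ord0 gcdn0 /gcd3 /trip /=.
have -> : lift ord0 (lift ord0 ord0) = i2 :> 'I_3 by apply/val_inj; rewrite /= valI.
have -> : lift ord0 ord0 = i1 :> 'I_3 by apply/val_inj; rewrite /= valI.
have -> : ord0 = i0 :> 'I_3 by apply/val_inj; rewrite /= valI.
by [].
Qed.

(** Division by [gg s t] is traded for a larger bound, and the sign of [s] does not affect the
    norm. *)
Lemma pt_norm s t : s != 0 -> (nrm (map_mx intr (col3 (act l (pt d A B C s t)))) <= X) =
  rg (X * (ggs s t)%:R) s%:~R t%:~R.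
Proof.
move=> s0; have g0 := gg_gt0 A B C d0 t s0.
have gR : (0 : R) < (ggs s t)%:R by rewrite ltr0n.
rewrite (reg_mm ng) cast_col3 cast_act -/(n3 nrm _) -/(mmr _).
have [h1 h2 h3] := pt_scale A B C d0 s t.
have e : mmr (- (A%:~R * s%:~R ^+ 2 + B%:~R * s%:~R * t%:~R + C%:~R * t%:~R ^+ 2), d%:~R * s%:~R ^+ 2, d%:~R * s%:~R * t%:~R)
   = (ggs s t)%:R * mmr (castv R (pt d A B C s t)).
  have sg1 : `|(Num.sg s)%:~R : R| = 1 by rewrite -intr_norm normr_sg s0.
  set v0 := (v0 in mmr v0 = _).
  transitivity (`|(Num.sg s)%:~R : R| * mmr v0); first by rewrite sg1 mul1r.
  transitivity (`|(ggs s t)%:R : R| * mmr (castv R (pt d A B C s t))); last by rewrite gtr0_norm.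
  have E1 : (Num.sg s)%:~R * v0.1.1 = (ggs s t)%:R * ((pt d A B C s t).1.1)%:~R.
    by rewrite -[(ggs s t)%:R]/((ggs s t)%:Z%:~R) -[RHS]intrM h1 intrM /v0 /= /qq !expr2 mulrNz !intrD !intrM.
  have E2 : (Num.sg s)%:~R * v0.1.2 = (ggs s t)%:R * ((pt d A B C s t).1.2)%:~R.
    by rewrite -[(ggs s t)%:R]/((ggs s t)%:Z%:~R) -[RHS]intrM h2 intrM /v0 /= !expr2 !intrM.
  have E3 : (Num.sg s)%:~R * v0.2 = (ggs s t)%:R * ((pt d A B C s t).2)%:~R.
    by rewrite -[(ggs s t)%:R]/((ggs s t)%:Z%:~R) -[RHS]intrM h3 intrM /v0 /= !intrM.
  by rewrite -!(mmZ hn); congr mmr; congr (_, _, _); [exact: E1|exact: E2|exact: E3].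
by rewrite e mulrC ler_pM2r.
Qed.

Definition bb (s t : int) : bool :=
  [&& coprime `|s| `|t|, s != 0 & rg (X * (ggs s t)%:R) s%:~R t%:~R].

(** The pairs in [bb] parametrise the zeros with [y] nonzero; the remaining 2 allows for the images
    [a], [b] of [(1, 0, 0)] and [(-1, 0, 0)]. *)
Lemma N_count L : (forall s t, bb s t -> (`|s| <= L)%N /\ (`|t| <= L)%N) ->
  ((\sum_(s <- zr L) \sum_(t <- zr L) bb s t <= N Q nrm X)%N /\
  (N Q nrm X <= \sum_(s <- zr L) \sum_(t <- zr L) bb s t + 2)%N).
Proof.
move=> hb; have [fS <-] := card_box hb.
set S := [set p | _] in fS *.
pose f (p : int * int) : 'cV[int]_3 := col3 (act l (pt d A B C p.1 p.2)).
pose a : 'cV[int]_3 := col3 (act l (1, 0, 0)); pose b : 'cV[int]_3 := col3 (act l (-1, 0, 0)).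
have sub1 : f @` S `<=` zeros Q nrm X.
  move=> _ [p /and3P[cp s0 rp] <-]; split.
  - by apply/prim_gcd3; rewrite col3K gcd3_act pt_prim.
  - by rewrite eval_FQz // col3K nfE; exact: pt_zero.
  - by rewrite pt_norm.
have sub2 : zeros Q nrm X `<=` f @` S `|` [set a; b].
  move=> x [/prim_gcd3 px ex nx].
  pose v := act (linv l) (trip x); have xv : x = col3 (act l v) by rewrite actVK tripK.
  have gv : gcd3 v = 1%N by rewrite -(gcd3_act l) actVK.
  have nv : nf d A B C v = 0 by rewrite /nf -nfE actVK -eval_FQz.
  have [y0|y0] := eqVneq v.1.2 0.
    have [e|e] : v = (1, 0, 0) \/ v = (-1, 0, 0) by eapply zero_y0; eassumption.
      by right; left; rewrite /= xv e.
    by right; right; rewrite /= xv e.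
  have [s [t [s0 st vE]]] : exists s t, [/\ s != 0, coprime `|s| `|t| & v = pt d A B C s t].
    by eapply pt_surj; eassumption.
  left.
  exists (s, t); last by rewrite /f xv vE.
  by rewrite /S /= /bb st s0 /= -pt_norm // -vE -xv.
have fin1 : finite_set (f @` S) by exact: finite_image.
have finE : finite_set (f @` S `|` [set a; b]) by rewrite finite_setU; split.
have finZ : finite_set (zeros Q nrm X) by apply: sub_finite_set finE.
have cf : #|` fset_set (f @` S)| = #|` fset_set S|.
  rewrite fset_set_image //; apply/eqP/card_in_imfsetP => p q.
  rewrite !in_fset_set // !inE => /and3P[cp sp _] /and3P[cq sq _] fpq.
  have e : pt d A B C p.1 p.2 = pt d A B C q.1 q.2.
    rewrite -(actK l (pt _ _ _ _ p.1 _)) -(actK l (pt _ _ _ _ q.1 _)); congr (act _ _).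
    by rewrite -[LHS]col3K -[RHS]col3K; congr trip.
  have : (p.1, p.2) = (q.1, q.2) by eapply pt_inj; eassumption.
  by case: p q {cp sp cq sq fpq e} => ? ? [].
rewrite /N -cf; split.
  by apply: fsubset_leq_card; move: sub1; rewrite fset_set_sub.
have u : (#|` fset_set (zeros Q nrm X)| <= #|` fset_set (f @` S `|` [set a; b])|)%N.
  by apply: fsubset_leq_card; move: sub2; rewrite fset_set_sub.
apply: leq_trans u _; rewrite (fset_setU fin1 (finite_set2 a b)) cardfsU.
apply: leq_trans (leq_subr _ _) _; rewrite leq_add2l.
by rewrite (fset_setU (finite_set1 a) (finite_set1 b)) !fset_set1 cardfs2; case: (_ != _).
Qed.

(** For coprime pairs [gg] divides [N0], so its value depends only on the class modulo [N0]. The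
    class also rules out common primes dividing [N0]; the sieve takes care of the other primes. *)
Definition cl (la : nat) (s t : int) : bool :=
  coprime (gcdn `|s| `|t|) N0 && (gcdn (ggs s t) N0 == la).

Lemma sum_cl (F : nat -> R) (s t : int) :
  \sum_(la <- divisors N0) (cl la s t)%:R * F la =
  (coprime (gcdn `|s| `|t|) N0)%:R * F (gcdn (ggs s t) N0).
Proof.
rewrite /cl; case: (coprime _ _) => /=; last first.
  by rewrite mul0r big1 // => la _; rewrite mul0r.
rewrite (bigD1_seq (gcdn (ggs s t) N0)) /= ?divisors_uniq -?dvdn_divisors ?dvdn_gcdr // eqxx.
by rewrite big1 ?addr0 // => la /negbTE; rewrite eq_sym => ->; rewrite mul0r.
Qed.

Lemma bb_split L : (\sum_(s <- zr L) \sum_(t <- zr L) bb s t)%N%:R =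
  \sum_(la <- divisors N0) Np (cc g l d A B C i0) (cc g l d A B C i1) (cc g l d A B C i2)
     (X * la%:R) L (cl la) :> R.
Proof.
rewrite natr_sum /Np exchange_big /=; apply: eq_bigr => s _.
rewrite natr_sum exchange_big /=; apply: eq_bigr => t _.
have [cst|cst] := boolP (coprime `|s| `|t|); last by rewrite /bb (negbTE cst) big1.
have [s0|s0] := eqVneq s 0; first by rewrite /bb s0 eqxx andbF big1.
transitivity (\sum_(la <- divisors N0) (cl la s t)%:R * (rg (X * la%:R) s%:~R t%:~R)%:R : R); last first.
  by apply: eq_bigr => la _; rewrite /= -natrM mulnb.
rewrite sum_cl /bb cst s0 /= (eqP cst) coprime1n mul1r.
by have -> : gcdn (ggs s t) N0 = ggs s t by apply/gcdn_idPl; exact: gg_dvd.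
Qed.

(** Each class prime to [N0] occurs for exactly one divisor [la]. The weight [la] comes from the
    area [X la VV] of the region, and it turns the number of classes into the sum met in the local
    densities. *)
Lemma cG_Gam : \sum_(la <- divisors N0) (cG N0 (cl la))%:R * la%:R = Gam R d A B C N0.
Proof.
rewrite /Gam /sum2 /sumP.
transitivity (\sum_(la <- divisors N0) \sum_(0 <= a < N0) \sum_(0 <= b < N0) (cl la a%:Z b%:Z)%:R * la%:R : R).
  apply: eq_bigr => la _; rewrite /cG natr_sum mulr_suml; apply: eq_bigr => a _.
  by rewrite natr_sum mulr_suml.
rewrite exchange_big /=; apply: eq_bigr => a _.
rewrite exchange_big /=; apply: eq_bigr => b _.
by rewrite sum_cl /gam1.
Qed.

Lemma cl_per la s t s' t' : (N0%:Z %| s - s')%Z -> (N0%:Z %| t - t')%Z -> cl la s t = cl la s' t'.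
Proof.
move=> h1 h2; rewrite /cl /coprime (gcd2_congr h1 h2) /gg.
by rewrite (@gcd2_congr N0 (qq A B C s t) (d * s) (qq A B C s' t') (d * s')) ?qq_mod // -mulrBr dvdz_mull.
Qed.

Variables (H0 : R).
Hypothesis H0p : 0 <= H0.
Hypothesis parH : forall s t : R, s ^+ 2 <= H0 * sup3 (par l d A B C s t) /\
   t ^+ 2 <= H0 * sup3 (par l d A B C s t).
(** The summand 1 keeps every box side at least 1, as [sieve_count] requires. *)
Let HH : R := Num.sqrt (H0 * (X * K0 nrm)) + 1.

Let K1p : 0 <= K0 nrm. Proof. exact: le_trans (K0_ge1 ug ng). Qed.
Let HH1 : 1 <= HH. Proof. by rewrite lerDr sqrtr_ge0. Qed.

(** A point of the region has maximum norm at most [K0 X la], which [parH] converts into bounds on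
    [s ^ 2] and [t ^ 2]; this is where [K0] enters the error term. *)
Lemma rg_box (la : nat) (s t : R) : rg (X * la%:R) s t ->
  `|s| <= Num.sqrt la%:R * HH /\ `|t| <= Num.sqrt la%:R * HH.
Proof.
rewrite (reg_mm ng) => h.
have h2 : sup3 (par l d A B C s t) <= K0 nrm * (X * la%:R).
  by apply: le_trans (sup3_K0 ug ng _) _; rewrite ler_wpM2l.
have k (u : R) : u ^+ 2 <= H0 * sup3 (par l d A B C s t) -> `|u| <= Num.sqrt la%:R * HH.
  move=> hu; have h3 : u ^+ 2 <= la%:R * (H0 * (X * K0 nrm)).
    apply: le_trans hu _; apply: le_trans (ler_wpM2l H0p h2) _.
    by rewrite le_eqVlt; apply/orP; left; apply/eqP; ring.
  rewrite -sqrtr_sqr; apply: le_trans (_ : _ <= Num.sqrt (la%:R * (H0 * (X * K0 nrm)))) _.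
    by rewrite ler_sqrt // !mulr_ge0.
  by rewrite sqrtrM // ler_wpM2l ?sqrtr_ge0 // lerDl.
by have [/k h3 /k h4] := parH s t.
Qed.

Let dn : nat := `|d|%N.
Let dn0 : (0 < dn)%N. Proof. by rewrite absz_gt0 gt_eqF. Qed.

(** With box side [sqrt la HH] the error [N0 d D / la] of [sieve_count] becomes [N0 d HH / sqrt la];
    [51 = 43 + 8]. *)
Lemma sieve_la (la L y : nat) : (la %| N0)%N -> N0%:R * HH <= L%:R -> (L < y)%N ->
  `|Np (cc g l d A B C i0) (cc g l d A B C i1) (cc g l d A B C i2) (X * la%:R) L (cl la)
    - (cG N0 (cl la))%:R * la%:R * (X * VV nrm l d A B C / N0%:R ^+ 2 * tailprod R d C y)| <=
  51 * (N0%:R * dn%:R) * HH * (1 + ln (N0%:R * HH)) * (Num.sqrt la%:R)^-1.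
Proof.
move=> laN HL Ly; have la0 : (0 < la)%N by apply: dvdn_gt0 laN.
have laN' : (la <= N0)%N by apply: dvdn_leq.
set sl := Num.sqrt (la%:R : R).
have sl2 : sl ^+ 2 = la%:R by rewrite sqr_sqrtr.
have slp : 0 < sl by rewrite sqrtr_gt0 ltr0n.
have sl1 : 1 <= sl by rewrite -(@ler_pXn2r _ 2) ?nnegrE ?(ltW slp) // expr1n sl2 ler1n.
have slN : sl <= N0%:R.
  apply: le_trans (_ : sl ^+ 2 <= _); last by rewrite sl2 ler_nat.
  by rewrite expr2 ler_peMr // ltW.
have HHp : 0 < HH by apply: lt_le_trans HH1.
have DN : sl * HH <= N0%:R * HH by rewrite ler_wpM2r // ltW.
have D1 : 1 <= sl * HH by rewrite -[1]mulr1 ler_pM.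
have box (s t : R) : rg (X * la%:R) s t -> `|s| <= sl * HH /\ `|t| <= sl * HH by exact: rg_box.
have clprim (s t : int) p : cl la s t -> prime p -> (p %| N0)%N -> (p%:Z %| s)%Z -> (p%:Z %| t)%Z -> False.
  move=> /andP[cst _] pp pN hs ht.
  have : (p %| gcdn (gcdn `|s| `|t|) N0)%N by rewrite !dvdn_gcd pN andbT; move: hs ht; rewrite !dvdzE /= => -> ->.
  by rewrite (eqP cst) dvdn1 => /eqP p1; rewrite p1 in pp.
have clla (s t : int) : cl la s t -> (la%:Z %| dn%:Z * s)%Z.
  move=> /andP[_ /eqP<-]; rewrite gtz0_abs // dvdzE /=.
  exact: dvdn_trans (dvdn_gcdl _ _) (dvdn_gcdr _ _).
have := sieve_count D1 box (le_trans DN HL) N00 la0 dn0 laN (@cl_per la) clprim clla Ly.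
rewrite (areaVV hn ug ng) ?mulr_ge0 // -/(tailprod R d C y).
have -> : (cG N0 (cl la))%:R * (X * la%:R * VV nrm l d A B C) / N0%:R ^+ 2 * tailprod R d C y =
   (cG N0 (cl la))%:R * la%:R * (X * VV nrm l d A B C / N0%:R ^+ 2 * tailprod R d C y) by ring.
move=> h; apply: le_trans h _.
have N1 : (1 : R) <= N0%:R by rewrite ler1n.
have dR : (0 : R) <= dn%:R by [].
have l1 : 0 <= ln (sl * HH) by rewrite ln_ge0.
have l2 : ln (sl * HH) <= ln (N0%:R * HH) by rewrite ler_ln ?posrE ?mulr_gt0 // ltr0n.
rewrite -sl2.
have -> : 43 * (N0%:R * dn%:R / sl ^+ 2) * (sl * HH) * (1 + ln (sl * HH)) + 8 * dn%:R * (sl * HH) / sl ^+ 2 =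
   (43 * (N0%:R * dn%:R) * HH * (1 + ln (sl * HH)) + 8 * dn%:R * HH) / sl.
  by field; rewrite gt_eqF.
rewrite ler_wpM2r ?invr_ge0 ?(ltW slp) //.
have e1 : 43 * (N0%:R * dn%:R) * HH * (1 + ln (sl * HH)) <= 43 * (N0%:R * dn%:R) * HH * (1 + ln (N0%:R * HH)).
  by rewrite ler_wpM2l ?mulr_ge0 ?(ltW HHp) // lerD2l.
have e2 : 8 * dn%:R * HH <= 8 * (N0%:R * dn%:R) * HH * (1 + ln (N0%:R * HH)).
  apply: le_trans (_ : _ <= 8 * (N0%:R * dn%:R) * HH) _.
    by rewrite ler_wpM2r ?(ltW HHp) // ler_wpM2l // ler_peMl.
  by rewrite ler_peMr ?mulr_ge0 ?(ltW HHp) // lerDl (le_trans l1).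
apply: le_trans (lerD e1 e2) _; rewrite le_eqVlt; apply/orP; left; apply/eqP; ring.
Qed.

(** The bound of [sieve_la] is the same for all [y > L], so the truncated product may be replaced by
    its limit [T]. *)
Lemma count_error (T : R) : tailprod R d C y @[y --> \oo] --> T ->
  `|(N Q nrm X)%:R - X * VV nrm l d A B C * (Gam R d A B C N0 / N0%:R ^+ 2 * T)| <=
  51 * (N0%:R * dn%:R) * HH * (1 + ln (N0%:R * HH)) * (\sum_(la <- divisors N0) (Num.sqrt la%:R)^-1) + 2.
Proof.
move=> cT; set E := 51 * _ * _ * _; set SS := \sum_(la <- _) _.
(* One range serves all divisors, since [sqrt la <= N0]. *)
pose L := (Num.truncn (N0%:R * HH)).+1.
have HL : N0%:R * HH <= L%:R by apply: ltW; exact: truncnS_gt.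
have bbox s t : bb s t -> (`|s| <= L)%N /\ (`|t| <= L)%N.
  move=> /and3P[cst s0 rst]; have gN : (ggs s t <= N0)%N by apply: dvdn_leq => //; exact: gg_dvd.
  have [h1 h2] := rg_box rst.
  have g1 : (0 < ggs s t)%N by exact: gg_gt0.
  have sq : Num.sqrt ((ggs s t)%:R : R) <= N0%:R.
    rewrite -[N0%:R]ger0_norm // -sqrtr_sqr ler_sqrt // -natrX ler_nat.
    by apply: leq_trans gN _; rewrite -mulnn leq_pmulr.
  have k (u : int) : `|u%:~R : R| <= Num.sqrt (ggs s t)%:R * HH -> (`|u| <= L)%N.
    move=> hu; rewrite -(ler_nat R) natr_absz intr_norm; apply: le_trans hu _.
    by apply: le_trans HL; rewrite ler_wpM2r // (le_trans ler01).
  by split; exact: k.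
have [n1 n2] := N_count bbox.
set Sb := (\sum_(s <- zr L) _)%N in n1 n2.
have main : `|Sb%:R - X * VV nrm l d A B C * (Gam R d A B C N0 / N0%:R ^+ 2 * T)| <= E * SS.
  have c1 : `|Sb%:R - X * VV nrm l d A B C * (Gam R d A B C N0 / N0%:R ^+ 2 * tailprod R d C y)| @[y --> \oo] -->
     `|Sb%:R - X * VV nrm l d A B C * (Gam R d A B C N0 / N0%:R ^+ 2 * T)|.
    apply: cvg_norm; apply: cvgB; first exact: cvg_cst.
    apply: cvgM; first exact: cvg_cst.
    by apply: cvgM => //; exact: cvg_cst.
  apply: (ler_cvg_to c1 (cvg_cst (E * SS))); exists L.+1 => // y /= Ly.
  rewrite /Sb bb_split.
  have -> : X * VV nrm l d A B C * (Gam R d A B C N0 / N0%:R ^+ 2 * tailprod R d C y) =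
     \sum_(la <- divisors N0) (cG N0 (cl la))%:R * la%:R * (X * VV nrm l d A B C / N0%:R ^+ 2 * tailprod R d C y).
    by rewrite -mulr_suml cG_Gam; ring.
  rewrite -sumrB; apply: le_trans (ler_norm_sum _ _ _) _; rewrite /SS mulr_sumr.
  rewrite big_seq [X in _ <= X]big_seq; apply: ler_sum => la; rewrite -dvdn_divisors // => laN.
  exact: sieve_la.
have n3 : Sb%:R <= (N Q nrm X)%:R :> R by rewrite ler_nat.
have n4 : (N Q nrm X)%:R <= Sb%:R + 2 :> R by rewrite -natrD ler_nat.
move: main; rewrite !ler_norml => /andP[m1 m2]; apply/andP; split; lra.
Qed.
End Count.

(** The rational zero is multiplied by the product of the three denominators. *)
Lemma isotropic_int (Q : Ternary.polyZ) : Ternary.quadratic_form Q -> Ternary.isotropic Q ->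
  exists v : int * int * int, ev (FQ Q) v = 0 /\ v != (0, 0, 0).
Proof.
move=> hQ [x x0 ex]; rewrite eval_FQ // in ex.
pose a := trip x; pose D : int := denq a.1.1 * denq a.1.2 * denq a.2.
have D0 : D%:~R != 0 :> rat by rewrite intr_eq0 !mulf_neq0 // denq_neq0.
pose v : int * int * int := (numq a.1.1 * (denq a.1.2 * denq a.2),
   numq a.1.2 * (denq a.1.1 * denq a.2), numq a.2 * (denq a.1.1 * denq a.1.2)).
have vE : castv rat v = (D%:~R * a.1.1, D%:~R * a.1.2, D%:~R * a.2).
  have k (y : rat) : (numq y)%:~R = (denq y)%:~R * y by rewrite mulrC numqE.
  by rewrite /castv /v /D /= !intrM !k; congr (_, _, _); ring.
have hom (k : rat) (u : rat * rat * rat) (F : qform rat) : ev F (k * u.1.1, k * u.1.2, k * u.2) = k ^+ 2 * ev F u.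
  by rewrite /ev /=; ring.
exists v; split.
  apply/eqP; rewrite -(intr_eq0 rat); apply/eqP.
  have -> : (ev (FQ Q) v)%:~R = ev (castF rat (FQ Q)) (castv rat v).
    by rewrite /ev /castF /castv /= !(rmorphD, rmorphM, rmorphXn).
  by rewrite vE hom ex mulr0.
apply: contra x0 => /eqP v0; move: vE; rewrite v0 /castv /= => -[/esym/eqP h1 /esym/eqP h2 /esym/eqP h3].
rewrite !mulf_eq0 (negbTE D0) /= in h1 h2 h3.
apply/eqP/matrixP => i j; rewrite mxE ord1; by have [->|->|->] := ord3 i; apply/eqP.
Qed.

Theorem mainTheorem1 (R : realType) :
  exists C : R, 0 < C /\
    forall (Q : Ternary.polyZ) (nrm : 'cV[R]_3 -> R),
      Ternary.quadratic_form Q -> Ternary.nonsingular Q -> Ternary.isotropic Q ->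
      is_norm nrm -> isometric_to_max nrm ->
      forall B : R, 2 <= B ->
        `|(N Q nrm B)%:R - cQ Q nrm * B| <=
          C * (Num.sqrt (B * K0 nrm) * ln (B * K0 nrm) * (Ternary.height Q)%:R ^+ 5).
Proof.
(* The summand 4 pays for the two zeros with [y = 0]: the error term without its constant is at
   least [1 / 2]. *)
exists (51 * 253 * 4105 * 6 + 4); split; first lra.
move=> Q nrm hQ ns iso hn [g ug ng] X X2.
have [x0 [ex0 x00]] := isotropic_int hQ iso.
pose q := Ternary.height Q.
have hc i j : `|coef Q i j| <= q%:Z by rewrite -abszE lez_nat height_ge.
have dF : fdisc (FQ Q) != 0.
  have := nonsingular_disc ns; apply: contra => /eqP h; apply/eqP; rewrite -[RHS]h /disc /fdisc /FQ /=; ring.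
have q1 : (0 < q)%N.
  rewrite lt0n; apply/eqP => qz; move/eqP: dF; apply.
  have z i j : coef Q i j = 0 by apply/eqP; rewrite -normr_le0; have := hc i j; rewrite qz.
  by rewrite /fdisc /FQ /= !z; ring.
have [l [d [A [B [C [d0 C0 nfE [H0 [H0p hD hDH parH]]]]]]]] :=
  @good_parametrization R (FQ Q) q%:Z (hc _ _) (hc _ _) (hc _ _) (hc _ _) (hc _ _) (hc _ _) dF x0 ex0 x00.
have [T cT] := tailprod_cvg R d C.
have Xp : 0 <= X by lra.
have K1 := K0_ge1 ug ng.
have BK2 : 2 <= X * K0 nrm by apply: le_trans X2 _; rewrite ler_peMr.
(* The factor [2^-1] of [cQ] cancels the 2 in the real density [2 VV]; it reflects that [x] and
   [- x] are both zeros, as are [(s, t)] and [(- s, - t)] both parameters. *)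
have cQE : cQ Q nrm * X = X * VV nrm l d A B C * (Gam R d A B C `|(d * C)%R|%N / `|(d * C)%R|%N%:R ^+ 2 * T).
  rewrite /cQ (sigma_ooE hn ug ng hQ d0 C0 nfE) (local_product hQ d0 C0 nfE cT).
  by field; rewrite pnatr_eq0 absz_eq0 mulf_neq0 // gt_eqF.
rewrite cQE; apply: le_trans (count_error hn ug ng hQ d0 C0 nfE Xp (ltW H0p) parH cT) _.
set N0 := `|(d * C)%R|%N; set dn := `|d|%N.
have N00 : (0 < N0)%N by rewrite absz_gt0 mulf_neq0 // gt_eqF.
have dn0 : (0 < dn)%N by rewrite absz_gt0 gt_eqF.
have DlE : `|(C * d ^+ 2)%:~R : R| = N0%:R * dn%:R.
  rewrite -natrM -intr_norm -abszE.
  by have -> : `|(C * d ^+ 2)%R|%N = (N0 * dn)%N by rewrite /N0 /dn -abszM; congr absz; ring.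
have [Y [YN YS]] := sum_divisors R N00.
have N1 : (1 : R) <= N0%:R by rewrite ler1n.
have d1 : (1 : R) <= dn%:R by rewrite ler1n.
have S0 : 0 <= \sum_(la <- divisors N0) (Num.sqrt (la%:R : R))^-1.
  by apply: sumr_ge0 => la _; rewrite invr_ge0 sqrtr_ge0.
have qR : q%:Z%:~R = q%:R :> R by [].
rewrite DlE qR in hD hDH.
have l0 := ln_ge_half BK2.
have b1 : 1 <= Num.sqrt (X * K0 nrm) by rewrite -sqrtr1 ler_sqrt; lra.
have q5 : (1 : R) <= q%:R ^+ 5 by rewrite exprn_ege1 // ler1n.
have lp : 0 <= ln (X * K0 nrm) by apply: (le_trans _ l0); rewrite invr_ge0.
have q50 : (0 : R) <= q%:R ^+ 5 by apply: (le_trans _ q5).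
have m1 : 2^-1 <= Num.sqrt (X * K0 nrm) * ln (X * K0 nrm) * q%:R ^+ 5.
  apply: (le_trans l0); rewrite -mulrA; apply: (@le_trans _ _ (ln (X * K0 nrm) * q%:R ^+ 5)).
    exact: ler_peMr.
  by apply: ler_peMl => //; exact: mulr_ge0.
have m2 : 2 <= 4 * (Num.sqrt (X * K0 nrm) * ln (X * K0 nrm) * q%:R ^+ 5).
  by move: m1; generalize (Num.sqrt (X * K0 nrm) * ln (X * K0 nrm) * q%:R ^+ 5) => M m1; lra.
have hq : (1 : R) <= q%:R by rewrite ler1n.
have hDl : (1 : R) <= N0%:R * dn%:R by rewrite -natrM ler1n muln_gt0 N00.
have hND : (N0%:R : R) <= N0%:R * dn%:R by apply: ler_peMr.
have hYN : (Y%:R : R) ^+ 2 <= N0%:R by rewrite -natrX ler_nat.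
have m3 := @error_numerics R q%:R (N0%:R * dn%:R) N0%:R H0 (X * K0 nrm) _ Y%:R hq hDl hD (ltW H0p) hDH
  N1 hND BK2 (ler0n _ _) hYN S0 YS _ (erefl _).
by apply: le_trans (lerD m3 m2) _; rewrite -mulrDl.
Qed.
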